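(* Let $\phi:\mathbb{P}^1_{\mathbb{C}}\to\mathbb{P}^1_{\mathbb{C}}$ be a rational function, and let $A_i,B_j,C_k,D_l\in\mathbb{P}^1(\mathbb{C})$ for $i,j,k,l\in\{1,2\}$. Then, denoting by $\deg(\phi)$ the degree of $\phi$, we have $$\sum_{i,j,k,l}(-1)^{i+j+k+l}\Bigg(\sum_{\alpha_i,\beta_j,\gamma_k,\delta_l}\widetilde{\mathcal{L}_3}(\alpha_i,\beta_j,\gamma_k,\delta_l)\;-\;\deg(\phi)\cdot\widetilde{\mathcal{L}_3}(A_i,B_j,C_k,D_l)\Bigg)=0,$$ where the outer sum is over $i,j,k,l\in\{1,2\}$ and $\alpha_i$, $\beta_j$, $\gamma_k$ and $\delta_l$ run through the preimages under $\phi$ of $A_i$, $B_j$, $C_k$ and $D_l$, respectively, with multiplicities.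
   Context: Here $\widetilde{\mathcal{L}_3}(x,y,z,w)=\mathcal{L}_3\big(\mathrm{cr}(x,y,z,w)\big)$, where $\mathrm{cr}(x,y,z,w)=\frac{x-z}{x-w}\cdot\frac{y-w}{y-z}$ is the cross ratio and $\mathcal{L}_3$ is the one-valued continuous version of the trilogarithm, i.e. the case $m=3$ of the following real-valued function. For $|z|\le 1$, $z\notin\{0,1\}$, $$\mathcal{L}_m(z)=\Re_m\Big(\sum_{r=0}^{m}\frac{2^rB_r}{r!}\log^r|z|\,\mathrm{Li}_{m-r}(z)\Big),$$ where $\Re_m$ denotes the real part for $m$ odd and the imaginary part for $m$ even, $B_r$ is the $r$-th Bernoulli number ($B_0=1$, $B_1=-\tfrac12$, $B_2=\tfrac16,\dots$), and $\mathrm{Li}_k(z)=\sum_{n\ge1}z^n/n^k$ for $|z|<1$, analytically continued to $\mathbb{C}-[1,\infty)$. (For $m=3$ the term $r=3$ vanishes because $B_3=0$.) For $|z|>1$ one puts $\mathcal{L}_m(z)=(-1)^{m-1}\mathcal{L}_m(1/z)$, and for $z\in\{0,1,\infty\}$ the function is extended by continuity.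
   Formalization: It is assumed that every cross ratio cr(A_i,B_j,C_k,D_l) is defined, i.e. no three of the four points A_i, B_j, C_k, D_l coincide; otherwise the cross ratio is 0/0 and the formula has no meaning. *)

(* Defs.v *)
From HB Require Import structures.
From mathcomp Require Import all_boot all_order all_algebra.
From mathcomp Require Import all_classical all_reals all_analysis.
From mathcomp Require Import complex.

Set Implicit Arguments.
Unset Strict Implicit.
Unset Printing Implicit Defensive.

Import Order.TTheory GRing.Theory Num.Theory.
Import numFieldNormedType.Exports.

Local Open Scope classical_set_scope.
Local Open Scope ring_scope.
Local Open Scope complex_scope.

(* The name at type numClosedFieldType is what gives R[i] the topology of its
   norm. *)
Definition Cplx (R : realType) : numClosedFieldType := R[i].

(* [Some z] is the point [z : 1], [None] is the point at infinity [1 : 0]. *)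
Notation P1 R := (option (Cplx R)).

Section Trilogarithm.
Variable R : realType.
Implicit Types z : Cplx R.

(* The norm of Cplx R takes its values in Cplx R. *)
Definition cabs z : R := complex.Re `|z|.

(* Only used for k = 1, 2, 3, |z| <= 1 and z <> 1. There the series converges,
   and by Abel's theorem its sum on the unit circle is the value of the analytic
   continuation to C - [1, oo). *)
Definition Li (k : nat) z : Cplx R :=
  limn (fun N => \sum_(1 <= n < N) z ^+ n / n%:R ^+ k).

(* 2 ^ r * B_r / r! = 1, -1, 1/3, 0 for r = 0, 1, 2, 3. *)
Definition L3_disk z : R :=
  complex.Re (Li 3 z - (ln (cabs z))%:C * Li 2 z
      + ((ln (cabs z)) ^+ 2 / 3)%:C * Li 1 z).

(* The sign (-1) ^ (m - 1) of the inversion relation is 1 for m = 3. *)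
Definition L3_raw z : R :=
  if `|z| <= 1 then L3_disk z else L3_disk z^-1.

Definition L3 (p : P1 R) : R :=
  if p is Some z then
    if (z == 0) || (z == 1) then lim (L3_raw w @[w --> z^']) else L3_raw z
  else lim (L3_raw w^-1 @[w --> (0 : Cplx R)^']).

End Trilogarithm.

Section CrossRatio.
Variable R : realType.
Implicit Types p q x y z w : P1 R.

Definition hcoord p : Cplx R * Cplx R := if p is Some z then (z, 1) else (1, 0).

(* For finite points this is the difference p - q. *)
Definition bracket p q : Cplx R :=
  (hcoord p).1 * (hcoord q).2 - (hcoord p).2 * (hcoord q).1.

Definition cr_num x y z w := bracket x z * bracket y w.
Definition cr_den x y z w := bracket x w * bracket y z.

(* The cross ratio is the point [cr_num : cr_den]; it is undefined (0 / 0)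
   exactly when at least three of the four points coincide. *)
Definition cr_defined x y z w : bool :=
  (cr_num x y z w != 0) || (cr_den x y z w != 0).

Definition cr x y z w : P1 R :=
  if cr_den x y z w == 0 then None else Some (cr_num x y z w / cr_den x y z w).

Definition L3cr x y z w : R := L3 (cr x y z w).

Lemma bracket_eq0 p q : (bracket p q == 0) = (p == q).
Proof.
case: p q => [a|] [b|]; rewrite /bracket /= ?mulr1 ?mul1r ?mul0r ?mulr0.
- by rewrite subr_eq0 /eq_op.
- by rewrite sub0r oppr_eq0 oner_eq0.
- by rewrite subr0 oner_eq0.
- by rewrite subrr !eqxx.
Qed.

Lemma cr_definedE x y z w : cr_defined x y z w =
  ~~ [|| (x == y) && (y == z), (x == y) && (y == w),
         (x == z) && (z == w) | (y == z) && (z == w)].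
Proof.
rewrite /cr_defined /cr_num /cr_den !mulf_eq0 !bracket_eq0 -negb_and.
congr (~~ _); apply/idP/idP.
  by case/andP => /orP[] /eqP-> /orP[] /eqP->; rewrite !eqxx ?orbT.
by case/or4P => /andP[/eqP-> /eqP->]; rewrite !eqxx ?orbT.
Qed.

End CrossRatio.

Section RationalMaps.
Variable R : realType.

Record ratmap := RatMap {
  rnum : {poly Cplx R};
  rden : {poly Cplx R};
  ratmap_coprime : coprimep rnum rden
}.

Definition rdeg (phi : ratmap) : nat :=
  maxn (size (rnum phi)).-1 (size (rden phi)).-1.

(* The point of P1 with homogeneous coordinates [a : b]. *)
Definition hpoint (a b : Cplx R) : P1 R := if b == 0 then None else Some (a / b).

Definition rat_eval (phi : ratmap) (p : P1 R) : P1 R :=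
  if p is Some z then hpoint (rnum phi).[z] (rden phi).[z]
  else hpoint (rnum phi)`_(rdeg phi) (rden phi)`_(rdeg phi).

(* With A = [a : b], the dehomogenization of the binary form of degree rdeg phi
   whose zeros on P1, with multiplicity, are the preimages of A. *)
Definition fibre_poly (phi : ratmap) (A : P1 R) : {poly Cplx R} :=
  (hcoord A).2 *: rnum phi - (hcoord A).1 *: rden phi.

Definition roots (p : {poly Cplx R}) : seq (Cplx R) :=
  sval (closed_field_poly_normal p).

(* The form vanishes at infinity to the order by which the degree of its
   dehomogenization drops below rdeg phi. *)
Definition fibre (phi : ratmap) (A : P1 R) : seq (P1 R) :=
  [seq Some z | z <- roots (fibre_poly phi A)]
  ++ nseq ((rdeg phi).+1 - size (fibre_poly phi A)) None.

Lemma size_fibre_poly phi A : (size (fibre_poly phi A) <= (rdeg phi).+1)%N.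
Proof.
have le1 (p : {poly Cplx R}) : (size p <= (size p).-1.+1)%N by case: size.
rewrite /fibre_poly /rdeg (leq_trans (size_polyD _ _))// geq_max size_polyN.
apply/andP; split.
  by rewrite (leq_trans (size_scale_leq _ _))// (leq_trans (le1 _))// ltnS leq_maxl.
by rewrite (leq_trans (size_scale_leq _ _))// (leq_trans (le1 _))// ltnS leq_maxr.
Qed.

Lemma fibre_poly_neq0 phi A : (0 < rdeg phi)%N -> fibre_poly phi A != 0.
Proof.
case: phi => P Q cPQ; rewrite /rdeg /fibre_poly /= => d0.
apply/negP => /eqP e.
have h : (hcoord A).2 *: P = (hcoord A).1 *: Q by apply/eqP; rewrite -subr_eq0 e.
case: A e h => [a|] /= e; last first.
  rewrite scale0r scale1r => h; move: cPQ d0.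
  rewrite -h coprimep0 -size_poly_eq1 => /eqP ->.
  by rewrite size_poly0.
rewrite scale1r => h; move: cPQ d0; rewrite h => cPQ.
have : Q %| gcdp (a *: Q) Q by rewrite dvdp_gcd dvdpp -mul_polyC dvdp_mull.
move: cPQ; rewrite /coprimep size_poly_eq1 => g1.
rewrite (eqp_dvdr _ g1) dvdp1 => /eqP sQ; rewrite sQ /= maxn0.
by have := size_scale_leq a Q; rewrite sQ; case: size => [|[]].
Qed.

Lemma size_fibre phi A : (0 < rdeg phi)%N -> size (fibre phi A) = rdeg phi.
Proof.
move=> d0; have n0 := fibre_poly_neq0 A d0.
have := size_fibre_poly phi A.
rewrite /fibre size_cat size_map size_nseq /roots.
case: closed_field_poly_normal => r /= e.
rewrite e size_scale ?lead_coef_eq0// size_prod_XsubC => /subnKC.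
by rewrite addSn => -[].
Qed.

Lemma hpoint_eq a b A : (a != 0) || (b != 0) ->
  (hpoint a b == A) = ((hcoord A).2 * a - (hcoord A).1 * b == 0).
Proof.
rewrite /hpoint; case: A => [c|] /=.
  case: (eqVneq b 0) => [->|b0 _]; first by rewrite /= orbF mulr0 subr0 mul1r => /negPf->.
  rewrite mul1r subr_eq0; apply/eqP/eqP => [[<-]|->]; first by rewrite divfK.
  by rewrite mulfK.
by rewrite mul0r mul1r sub0r oppr_eq0; case: (eqVneq b 0).
Qed.

Lemma mem_fibre phi A p : (0 < rdeg phi)%N ->
  (p \in fibre phi A) = (rat_eval phi p == A).
Proof.
move=> d0; have n0 := fibre_poly_neq0 A d0.
have rootsE z : (z \in roots (fibre_poly phi A)) = root (fibre_poly phi A) z.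
  rewrite /roots; case: closed_field_poly_normal => r /= e.
  by rewrite [in RHS]e rootZ ?lead_coef_eq0// root_prod_XsubC.
rewrite /fibre mem_cat mem_nseq; case: p => [z|] /=.
  rewrite mem_map; last by move=> ? ? [].
  rewrite rootsE andbF orbF rootE hpoint_eq; last first.
    rewrite -negb_and; apply/negP => /andP[Pz Qz].
    by have := coprimep_root (ratmap_coprime phi) Pz; rewrite Qz.
  by rewrite /fibre_poly !hornerE.
have /negPf-> : None \notin [seq Some z | z <- roots (fibre_poly phi A)].
  by apply/mapP => -[].
rewrite /= andbT subn_gt0 ltnS hpoint_eq.
  rewrite -!coefZ -coefB -/(fibre_poly phi A).
  apply/idP/idP => [sz|/eqP c0]; first by rewrite nth_default.
  rewrite leqNgt; apply/negP => lt.
  have e : size (fibre_poly phi A) = (rdeg phi).+1.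
    by apply/eqP; rewrite eqn_leq lt size_fibre_poly.
  by move: n0; rewrite -lead_coef_eq0 lead_coefE e c0 eqxx.
have lc (q : {poly Cplx R}) : (0 < (size q).-1)%N -> q`_(size q).-1 != 0.
  by rewrite -lead_coefE lead_coef_eq0; case: eqVneq => // ->; rewrite size_poly0.
move: d0; rewrite /rdeg.
case: (leqP (size (rden phi)).-1 (size (rnum phi)).-1) => _ d0.
  by rewrite (lc _ d0).
by rewrite (lc _ d0) orbT.
Qed.

End RationalMaps.

(* Main.v *)
(* Let P be the Bloch-Wigner dilogarithm. Along a path x, with dlog x = xi and
   dlog (1 - x) = eta,
     dL_3(x) = - P(x) Im xi + ln|x| (ln|1 - x| Re xi - ln|x| Re eta) / 3,
     dP(x) = ln|x| Im eta - ln|1 - x| Im xi.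
   The identity comes from projection formulas: for formal differences B, C, D of
   two points,
     P(p, phi^*B, q, phi^*D) = P(phi(p), B, phi(q), D),
     L_3(p, phi^*B, phi^*C, phi^*D) - L_3(phi(p), B, C, D) is constant in p,
   and summing the second one over the fibres of A_1 and A_2 gives the theorem.
   Each of them holds because the derivative in p of the difference of the two
   sides is zero. In this derivative, ln|x| and ln|1 - x| are sums of logarithms
   of brackets of two of the points, and after alternation only the monomials
   involving all of the preimages survive; these are spanning trees rooted at p,
   which are summed over the fibres leaf by leaf thanks to
   prod_(phi(y) = c) [p, y] = [phi(p), c], up to factors independent of p or c.
   The terms with P in dL_3 are handled by the projection formula for P. *)

(* L_3 and P are differentiated along real polynomial paths. Their derivatives come from power
   series, so they are available inside the unit disk and, by inversion, outside of it, but not on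
   the unit circle. A path may therefore meet the circle, or a zero of a bracket, at finitely many
   times, and continuity closes the gaps. Brackets depend on the choice of coordinates, and phi
   lifts to coordinates only up to a scalar that varies with the point. The correction [f] of
   [potential] absorbs this scalar; it is harmless because every point has total weight zero in
   ln|x| and ln|1 - x|. The formula for P is exact, since both sides vanish at p = q. This exactness
   allows weights that depend on q to be summed over a fibre in the derivative of L_3. For L_3
   itself constancy suffices, because the fibres of A_1 and A_2 have the same size. The given points
   may overlap, so degenerate triples b, c, d are carried along everywhere; their functions of p are
   constant. *)
Require Import Defs.
From mathcomp Require Import all_boot all_order all_algebra.
From mathcomp Require Import all_classical all_reals all_analysis.
From mathcomp Require Import complex ring lra.

Set Implicit Arguments.
Unset Strict Implicit.
Unset Printing Implicit Defensive.

Import Order.TTheory GRing.Theory Num.Theory.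
Import numFieldNormedType.Exports.

Local Open Scope classical_set_scope.
Local Open Scope ring_scope.
Local Open Scope complex_scope.

Local Notation Re := complex.Re.
Local Notation Im := complex.Im.

(** * Complex numbers as pairs of reals *)

Section Complex.
Variable R : realType.
Implicit Types (z w : Cplx R) (t : R).

Lemma ReD z w : Re (z + w) = Re z + Re w. Proof. by case: z w => ? ? []. Qed.
Lemma ImD z w : Im (z + w) = Im z + Im w. Proof. by case: z w => ? ? []. Qed.
Lemma ReN z : Re (- z) = - Re z. Proof. by case: z. Qed.
Lemma ImN z : Im (- z) = - Im z. Proof. by case: z. Qed.
Lemma ReB z w : Re (z - w) = Re z - Re w. Proof. by rewrite ReD ReN. Qed.
Lemma ImB z w : Im (z - w) = Im z - Im w. Proof. by rewrite ImD ImN. Qed.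
Lemma ReM z w : Re (z * w) = Re z * Re w - Im z * Im w.
Proof. by case: z w => ? ? []. Qed.
Lemma ImM z w : Im (z * w) = Re z * Im w + Im z * Re w.
Proof. by case: z w => ? ? []. Qed.
Definition ReImE := (ReD, ImD, ReN, ImN, ReM, ImM).

Lemma Re_sum (I : Type) (r : seq I) (P : pred I) (F : I -> Cplx R) :
  Re (\sum_(i <- r | P i) F i) = \sum_(i <- r | P i) Re (F i).
Proof. exact: (big_morph _ ReD). Qed.

Lemma Im_sum (I : Type) (r : seq I) (P : pred I) (F : I -> Cplx R) :
  Im (\sum_(i <- r | P i) F i) = \sum_(i <- r | P i) Im (F i).
Proof. exact: (big_morph _ ImD). Qed.

Lemma eq_ReIm z w : Re z = Re w -> Im z = Im w -> z = w.
Proof. by case: z w => ? ? [] ? ? /= -> ->. Qed.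

Lemma cabsE z : cabs z = Num.sqrt (Re z ^+ 2 + Im z ^+ 2).
Proof. by case: z. Qed.

Lemma cabs_sqr z : cabs z ^+ 2 = Re z ^+ 2 + Im z ^+ 2.
Proof. by rewrite cabsE sqr_sqrtr// addr_ge0 ?sqr_ge0. Qed.

Lemma cabs_ge0 z : 0 <= cabs z.
Proof. by rewrite cabsE sqrtr_ge0. Qed.

Lemma normCE z : `|z| = (cabs z)%:C.
Proof. by case: z. Qed.

Lemma cabsM z w : cabs (z * w) = cabs z * cabs w.
Proof. by rewrite {1}/cabs normrM !normCE ReM /= mulr0 subr0. Qed.

Lemma cabs1 : cabs (1 : Cplx R) = 1.
Proof. by rewrite /cabs normr1. Qed.

Lemma cabs0 : cabs (0 : Cplx R) = 0.
Proof. by rewrite /cabs normr0. Qed.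

Lemma cabsN z : cabs (- z) = cabs z.
Proof. by rewrite /cabs normrN. Qed.

Lemma cabs_eq0 z : (cabs z == 0) = (z == 0).
Proof. by rewrite -[z == 0]normr_eq0 normCE (inj_eq (@complexI R)). Qed.

Lemma cabs_gt0 z : (0 < cabs z) = (z != 0).
Proof. by rewrite lt_def cabs_ge0 andbT cabs_eq0. Qed.

Lemma cabsX z n : cabs (z ^+ n) = cabs z ^+ n.
Proof. by elim: n => [|n IH]; rewrite ?expr0 ?cabs1// !exprS cabsM IH. Qed.

Lemma cabsV z : cabs z^-1 = (cabs z)^-1.
Proof.
have [->|z0] := eqVneq z 0; first by rewrite invr0 cabs0 invr0.
have c0 : cabs z != 0 by rewrite cabs_eq0.
by apply: (mulfI c0); rewrite -cabsM !divff// cabs1.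
Qed.

Lemma cabsD z w : cabs (z + w) <= cabs z + cabs w.
Proof. by have := ler_normD z w; rewrite !normCE -rmorphD lecR. Qed.

Lemma cabs_real t : cabs (t%:C : Cplx R) = `|t|.
Proof. by rewrite cabsE /= expr0n addr0 sqrtr_sqr. Qed.

Lemma Re_le_cabs z : `|Re z| <= cabs z.
Proof. by rewrite cabsE -sqrtr_sqr ler_wsqrtr// lerDl sqr_ge0. Qed.

Lemma Im_le_cabs z : `|Im z| <= cabs z.
Proof. by rewrite cabsE -sqrtr_sqr ler_wsqrtr// lerDr sqr_ge0. Qed.

Lemma cabs_le_ReIm z : cabs z <= `|Re z| + `|Im z|.
Proof.
have h : 0 <= `|Re z| + `|Im z| by rewrite addr_ge0.
rewrite -(@ler_pXn2r _ 2) ?nnegrE ?cabs_ge0// cabs_sqr sqrrD !real_normK ?num_real//.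
by rewrite lerD2r lerDl mulrn_wge0// mulr_ge0.
Qed.

Definition cconj z : Cplx R := conjc z.

Lemma cabs_conj z : cabs (cconj z) = cabs z.
Proof. by case: z => a b; rewrite !cabsE /= sqrrN. Qed.

Lemma Re_conj z : Re (cconj z) = Re z. Proof. by case: z. Qed.
Lemma Im_conj z : Im (cconj z) = - Im z. Proof. by case: z. Qed.

Lemma mul_conj z : z * cconj z = (cabs z ^+ 2)%:C.
Proof.
rewrite cabs_sqr; apply: eq_ReIm; rewrite ?ReM ?ImM Re_conj Im_conj /=; ring.
Qed.

Lemma conj_mul z w : cconj (z * w) = cconj z * cconj w.
Proof. exact: rmorphM. Qed.

Lemma conj_expr z n : cconj (z ^+ n) = cconj z ^+ n.
Proof. exact: rmorphXn. Qed.

Lemma conj_re t : cconj t%:C = t%:C.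
Proof. exact: conjc_real. Qed.

Lemma conj_conj z : cconj (cconj z) = z.
Proof. by case: z => a b; rewrite /cconj /= opprK. Qed.

Lemma ReV z : Re z^-1 = Re z / cabs z ^+ 2.
Proof. by rewrite cabs_sqr; case: z. Qed.

Lemma ImV z : Im z^-1 = - Im z / cabs z ^+ 2.
Proof. by rewrite cabs_sqr mulNr; case: z. Qed.

Lemma ccvgP (T : Type) (F : set_system T) (FF : Filter F) (f : T -> Cplx R) (l : Cplx R) :
  f @ F --> l <-> ((fun x => Re (f x)) @ F --> Re l) /\ ((fun x => Im (f x)) @ F --> Im l).
Proof.
split.
- move=> h; split; apply/cvgrPdist_lt => e e0.
  + have e0' : (0 : Cplx R) < e%:C by rewrite ltcR.
    move/cvgrPdist_lt: h => /(_ _ e0'); apply: filterS => x.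
    by rewrite normCE ltcR -ReB; apply: le_lt_trans (Re_le_cabs _).
  + have e0' : (0 : Cplx R) < e%:C by rewrite ltcR.
    move/cvgrPdist_lt: h => /(_ _ e0'); apply: filterS => x.
    by rewrite normCE ltcR -ImB; apply: le_lt_trans (Im_le_cabs _).
- case=> h1 h2; apply/cvgrPdist_lt => e e0.
  (* Positivity in [Cplx R] forces the imaginary part of e to vanish. *)
  have [r [re r0]] : exists r : R, e = r%:C /\ 0 < r.
    by move: e0; case: e => a b; rewrite ltcE /= => /andP[/eqP -> a0]; exists a.
  have r2 : 0 < r / 2 by rewrite divr_gt0.
  move/cvgrPdist_lt: h1 => /(_ _ r2) h1; move/cvgrPdist_lt: h2 => /(_ _ r2) h2.
  near=> x; rewrite re normCE ltcR (le_lt_trans (cabs_le_ReIm _))// ReB ImB.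
  rewrite [ltRHS](splitr r) ltrD//; near: x; [exact: h1|exact: h2].
Unshelve. all: by end_near.
Qed.

End Complex.

(** * Series dominated by an inverse square *)

Section Series.
Variable R : realType.
Implicit Types (z w : Cplx R) (s t : R) (u : nat -> R).

Definition psum u : nat -> R := fun N => \sum_(1 <= n < N) u n.

(** Telescoping: 2 K / n - 2 K / (n + 1) exceeds K / n ^ 2 by K (n - 1) / (n ^ 2 (n + 1)), which is
    nonnegative for n >= 1. *)
Lemma sum_inv_sqr_le (K : R) (N m : nat) : 0 <= K -> (0 < N)%N -> (N <= m)%N ->
  \sum_(N <= n < m) K / n%:R ^+ 2 <= 2 * K / N%:R - 2 * K / m%:R.
Proof.
move=> K0 N0 Nm.
have -> : 2 * K / N%:R - 2 * K / m%:R =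
    \sum_(N <= n < m) (2 * K / n%:R - 2 * K / n.+1%:R).
  rewrite -opprB -(@telescope_sumr _ N m (fun n => 2 * K / n%:R) Nm) -sumrN.
  by apply: eq_bigr => i _; rewrite opprB.
rewrite !big_nat; apply: ler_sum => n /andP[Nn _].
have n1 : 1 <= n%:R :> R by rewrite ler1n (leq_trans N0).
have n0 : n%:R != 0 :> R by rewrite gt_eqF ?(lt_le_trans ltr01).
have n0' : n%:R + 1 != 0 :> R by rewrite gt_eqF ?addr_gt0 ?(lt_le_trans ltr01 n1).
rewrite -[n.+1%:R]natr1 -subr_ge0.
have -> : 2 * K / n%:R - 2 * K / (n%:R + 1) - K / n%:R ^+ 2 =
    K * (n%:R - 1) / (n%:R ^+ 2 * (n%:R + 1)) by field; rewrite n0 n0'.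
by rewrite divr_ge0 ?mulr_ge0 ?exprn_ge0 ?subr_ge0// ?addr_ge0 ?(le_trans ler01 n1).
Qed.

Section Dominated.
Variables (K : R) (u : nat -> R).
Hypothesis uK : forall n, (0 < n)%N -> `|u n| <= K / n%:R ^+ 2.

Let K0 : 0 <= K.
Proof. by have := uK (ltn0Sn 0); rewrite expr1n divr1; apply: le_trans. Qed.

Lemma psum_tail N m : (0 < N)%N -> (N <= m)%N -> `|psum u m - psum u N| <= 2 * K / N%:R.
Proof.
move=> N0 Nm; rewrite /psum (big_cat_nat (n := N))//= addrAC subrr add0r.
apply: (le_trans (ler_norm_sum _ _ _)).
apply: (@le_trans _ _ (\sum_(N <= n < m) K / n%:R ^+ 2)).
  rewrite !big_nat; apply: ler_sum => n /andP[Nn _].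
  by apply: uK; rewrite (leq_trans N0).
apply: (le_trans (sum_inv_sqr_le K0 N0 Nm)); rewrite gerBl.
by rewrite divr_ge0 ?mulr_ge0.
Qed.

Lemma is_cvg_psum : cvgn (psum u).
Proof.
suff : cvgn (series u) by rewrite -(is_cvg_series_restrict 1).
apply: normed_cvg; rewrite -(is_cvg_series_restrict 1).
apply: nondecreasing_is_cvgn.
  apply/nondecreasing_seqP => -[|n] /=; first by rewrite !big_geq.
  by rewrite [leRHS]big_nat_recr//= lerDl.
exists (2 * K) => _ [[|n] _ <-] /=; first by rewrite big_geq// mulr_ge0.
apply: (@le_trans _ _ (\sum_(1 <= n < n.+1) K / n%:R ^+ 2)).
  by rewrite !big_nat; apply: ler_sum => i /andP[i1 _]; apply: uK.
apply: (le_trans (sum_inv_sqr_le K0 _ _)) => //; rewrite divr1 gerBl.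
by rewrite divr_ge0 ?mulr_ge0.
Qed.

Lemma lim_psum_tail N : (0 < N)%N -> `|limn (psum u) - psum u N| <= 2 * K / N%:R.
Proof.
move=> N0; have h : (fun m => `|psum u m - psum u N|) @ \oo --> `|limn (psum u) - psum u N|.
  by apply: cvg_norm; apply: cvgB; [exact: is_cvg_psum|exact: cvg_cst].
rewrite -(cvg_lim _ h)//; apply: limr_le; first by apply/cvg_ex; eexists; exact: h.
near=> m; apply: psum_tail => //; near: m; exact: nbhs_infty_ge.
Unshelve. all: by end_near.
Qed.

End Dominated.

(** Dominated convergence: the tails are at most 2 K / N uniformly in x, which leaves a finite sum
    and a division of e into three parts. *)
Lemma cvg_lim_psum (T : Type) (F : set_system T) (FF : ProperFilter F) (K : R)
    (f : T -> nat -> R) (l : nat -> R) :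
  (forall x n, (0 < n)%N -> `|f x n| <= K / n%:R ^+ 2) ->
  (forall n, (0 < n)%N -> `|l n| <= K / n%:R ^+ 2) ->
  (forall n, (0 < n)%N -> f x n @[x --> F] --> l n) ->
  limn (psum (f x)) @[x --> F] --> limn (psum l).
Proof.
move=> fK lK fl.
have K0 : 0 <= K by have := lK _ (ltn0Sn 0); rewrite expr1n divr1; apply: le_trans.
apply/cvgrPdist_lt => e e0.
have [N N0 Ne] : exists2 N : nat, (0 < N)%N & 2 * K / N%:R < e / 3.
  have [N] : exists N : nat, 6 * K / e < N%:R.
    by exists (Num.bound (6 * K / e)); rewrite archi_boundP// divr_ge0 ?mulr_ge0// ltW.
  move=> hN; have N0 : (0 < N%:R :> R).
    by apply: le_lt_trans hN; rewrite divr_ge0 ?mulr_ge0// ltW.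
  exists N; first by rewrite -(ltr0n R).
  move: hN; rewrite !ltr_pdivrMr// mulrAC; lra.
have hs : psum (f x) N @[x --> F] --> psum l N.
  rewrite /psum; elim: N {N0 Ne} => [|[|N] IH].
  - by rewrite big_geq//; under eq_fun do rewrite big_geq//; exact: cvg_cst.
  - by rewrite big_geq//; under eq_fun do rewrite big_geq//; exact: cvg_cst.
  - rewrite big_nat_recr//=; under eq_fun do rewrite big_nat_recr//=.
    by apply: cvgD => //; apply: fl.
have e3 : 0 < e / 3 by rewrite divr_gt0.
move/cvgrPdist_lt: hs => /(_ _ e3) hs; near=> x.
have h1 : `|psum l N - psum (f x) N| < e / 3 by near: x; exact: hs.
have h2 := lim_psum_tail lK N0; have h3 := lim_psum_tail (fK x) N0.
rewrite (_ : _ - _ = (limn (psum l) - psum l N) + (psum l N - psum (f x) N)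
  - (limn (psum (f x)) - psum (f x) N)); last by ring.
apply: (le_lt_trans (ler_normB _ _)); apply: (@lt_le_trans _ _ (e/3+e/3+e/3)); last lra.
apply: ltrD; last exact: le_lt_trans Ne.
by apply: (le_lt_trans (ler_normD _ _)); apply: ltrD => //; exact: le_lt_trans Ne.
Unshelve. all: by end_near.
Qed.

End Series.

(** * The trilogarithm and the Bloch-Wigner dilogarithm on the closed unit disk *)

Section Kernels.
Variable R : realType.
Implicit Types (z w : Cplx R) (s t : R).

Lemma abs_mul_ln_le s : 0 < s -> s <= 1 -> s * `|ln s| <= 1.
Proof.
move=> s0 s1; have h : - ln s <= s^-1 - 1.
  rewrite -lnV ?posrE// -[in leLHS](subrK 1 s^-1) addrC le_ln1Dx//.
  by rewrite -subr_gt0 opprK subrK invr_gt0.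
rewrite ler0_norm; last by rewrite -ln1 ler_ln ?posrE.
apply: (@le_trans _ _ (s * (s^-1 - 1))); first by rewrite ler_wpM2l// ltW.
by rewrite mulrBr divff ?gt_eqF// mulr1 gerBl ltW.
Qed.

(** With v the fourth root of s, ln s = 4 ln v and v |ln v| <= 1 absorbs the logarithms. The
    constant 11 rounds up 1 + 4 + 16 / 3. *)
Lemma mul_ln_le_sqrt s : 0 <= s -> s <= 1 ->
  s * (1 + `|ln s| + (ln s) ^+ 2 / 3) <= 11 * Num.sqrt s.
Proof.
rewrite le_eqVlt => /orP[/eqP <- _|s0 s1]; first by rewrite mul0r sqrtr0 mulr0.
set q := Num.sqrt s; set v := Num.sqrt q.
have q0 : 0 < q by rewrite sqrtr_gt0.
have v0 : 0 < v by rewrite sqrtr_gt0.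
have sq : s = q ^+ 2 by rewrite sqr_sqrtr// ltW.
have qv : q = v ^+ 2 by rewrite sqr_sqrtr// ltW.
have q1 : q <= 1 by rewrite -(@ler_pXn2r _ 2) ?nnegrE ?(ltW q0)// -sq expr1n.
have v1 : v <= 1 by rewrite -(@ler_pXn2r _ 2) ?nnegrE ?(ltW v0)// -qv expr1n.
have a1 := abs_mul_ln_le v0 v1.
have -> : ln s = 4 * ln v.
  by rewrite sq qv -exprM lnXn// mulr_natl.
rewrite normrM (ger0_norm (_ : (0:R) <= 4))//.
rewrite exprMn -(real_normK (num_real (ln v))).
have : 0 <= `|ln v| by [].
move: a1; set L := `|ln v| => a1 L0.
have vL : 0 <= v * L by rewrite mulr_ge0 ?(ltW v0).
have vL2 : (v * L) ^+ 2 <= 1 by rewrite expr_le1.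
rewrite sq qv.
have -> : (v ^+ 2) ^+ 2 * (1 + 4 * L + 4 ^+ 2 * L ^+ 2 / 3) =
  v ^+ 2 * (v ^+ 2 + 4 * v * (v * L) + (v * L) ^+ 2 * (16 / 3)) by ring.
rewrite [leRHS]mulrC ler_wpM2l ?exprn_ge0 ?(ltW v0)//.
have : v ^+ 2 <= 1 by rewrite expr_le1// ltW.
have : v * (v * L) <= 1 by rewrite mulr_ile1// ltW.
lra.
Qed.

(* The n-th terms of the series for L_3 and P are triker (z ^ n) / n ^ 3 and
   dilker (z ^ n) / n ^ 2, which makes their convergence uniform up to the unit
   circle. *)
Definition triker w : R := Re w * (1 - ln (cabs w) + ln (cabs w) ^+ 2 / 3).
Definition dilker w : R := Im w * (1 - ln (cabs w)).

Lemma triker_le w : cabs w <= 1 -> `|triker w| <= 11 * Num.sqrt (cabs w).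
Proof.
move=> w1; apply: le_trans (mul_ln_le_sqrt (cabs_ge0 w) w1).
rewrite normrM ler_pM// ?Re_le_cabs//.
rewrite (le_trans (ler_normD _ _))// (le_trans (lerD (ler_normB _ _) (lexx _)))//.
by rewrite normr1 lerD2l ger0_norm// divr_ge0// sqr_ge0.
Qed.

Lemma dilker_le w : cabs w <= 1 -> `|dilker w| <= 11 * Num.sqrt (cabs w).
Proof.
move=> w1; apply: le_trans (mul_ln_le_sqrt (cabs_ge0 w) w1).
rewrite normrM ler_pM// ?Im_le_cabs// (le_trans (ler_normB _ _))// normr1 lerDl.
by rewrite divr_ge0// sqr_ge0.
Qed.

(** Decay at 0 replaces continuity there, where the logarithm is singular. *)
Definition kernel_like (k : Cplx R -> R) :=
  (forall w, cabs w <= 1 -> `|k w| <= 11 * Num.sqrt (cabs w)) /\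
  (forall (T : Type) (F : set_system T) (FF : ProperFilter F) (f : T -> Cplx R)
    (l : Cplx R), l != 0 -> f @ F --> l -> k (f x) @[x --> F] --> k l).

Lemma cvg_cabs (T : Type) (F : set_system T) (FF : ProperFilter F) (f : T -> Cplx R)
    (l : Cplx R) : f @ F --> l -> cabs (f x) @[x --> F] --> cabs l.
Proof. by move/cvg_norm/ccvgP => []. Qed.

Lemma cvg_ln_cabs (T : Type) (F : set_system T) (FF : ProperFilter F) (f : T -> Cplx R)
    (l : Cplx R) : l != 0 -> f @ F --> l -> ln (cabs (f x)) @[x --> F] --> ln (cabs l).
Proof.
move=> l0 fl; apply: (@continuous_cvg _ _ _ F _ (fun x => cabs (f x)) (@ln R) (cabs l)).
  by apply: continuous_ln; rewrite cabs_gt0.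
exact: (cvg_cabs FF fl).
Qed.

Lemma triker_kernel : kernel_like triker.
Proof.
split; first exact: triker_le.
move=> T F FF f l l0 fl; have [fR fI] := (ccvgP _ f l).1 fl.
have h := cvg_ln_cabs FF l0 fl; apply: cvgM => //; apply: cvgD.
  by apply: cvgB => //; exact: cvg_cst.
by apply: cvgM; [exact: cvgM|exact: cvg_cst].
Qed.

Lemma dilker_kernel : kernel_like dilker.
Proof.
split; first exact: dilker_le.
move=> T F FF f l l0 fl; have [fR fI] := (ccvgP _ f l).1 fl.
by have h := cvg_ln_cabs FF l0 fl; apply: cvgM => //; apply: cvgB => //; exact: cvg_cst.
Qed.

Section KernelSeries.
Variables (k : Cplx R -> R) (m : nat).
Hypotheses (kK : kernel_like k) (m2 : (2 <= m)%N).

Lemma kernel_le w : cabs w <= 1 -> `|k w| <= 11.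
Proof.
move=> w1; apply: (le_trans (kK.1 _ w1)).
by rewrite ger_pMr// -sqrtr1 ler_wsqrtr.
Qed.

(** At l = 0 the bound by a square root gives k 0 = 0 and squeezes k (f x) to 0. *)
Lemma cvg_kernel (T : Type) (F : set_system T) (FF : ProperFilter F) (f : T -> Cplx R)
    (l : Cplx R) : (forall x, cabs (f x) <= 1) ->
  f @ F --> l -> k (f x) @[x --> F] --> k l.
Proof.
move=> f1; have [->|l0] := eqVneq l 0 => fl; last exact: kK.2.
have -> : k 0 = 0.
  have := kK.1 (0 : Cplx R); rewrite cabs0 sqrtr0 mulr0 ler01 => /(_ isT).
  by rewrite normr_le0 => /eqP.
have h : 11 * Num.sqrt (cabs (f x)) @[x --> F] --> (0 : R).
  rewrite -[X in _ --> X](_ : 11 * Num.sqrt (cabs (0 : Cplx R)) = 0); last first.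
    by rewrite cabs0 sqrtr0 mulr0.
  apply: cvgM; first exact: cvg_cst.
  apply: (@continuous_cvg _ _ _ F _ (fun x => cabs (f x)) (@Num.sqrt R) (cabs (0 : Cplx R))).
    exact: sqrt_continuous.
  exact: (cvg_cabs FF fl).
apply: (@squeeze_cvgr _ _ _ _ (fun x => - (11 * Num.sqrt (cabs (f x))))
  (fun x => 11 * Num.sqrt (cabs (f x)))) => //.
  by near=> x; rewrite -ler_norml; apply: kK.1.
by rewrite -oppr0; apply: cvgN.
Unshelve. all: by end_near.
Qed.

Definition kernel_series w : R := limn (psum (fun n => k (w ^+ n) / n%:R ^+ m)).

Lemma kernel_term_le w n : cabs w <= 1 -> (0 < n)%N ->
  `|k (w ^+ n) / n%:R ^+ m| <= 11 / n%:R ^+ 2.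
Proof.
move=> w1 n0; have w1n : cabs (w ^+ n) <= 1 by rewrite cabsX exprn_ile1 ?cabs_ge0.
rewrite normrM ler_pM ?kernel_le// ger0_norm; last by rewrite invr_ge0 exprn_ge0.
by rewrite lef_pV2 ?posrE ?exprn_gt0 ?ltr0n// ler_weXn2l// ler1n.
Qed.

Lemma cvg_cexpr (T : Type) (F : set_system T) (FF : ProperFilter F) (f : T -> Cplx R)
    (l : Cplx R) n : f @ F --> l -> f x ^+ n @[x --> F] --> l ^+ n.
Proof.
move=> fl; elim: n => [|n IH].
  by rewrite expr0; under eq_fun do rewrite expr0; exact: cvg_cst.
by rewrite exprS; under eq_fun do rewrite exprS; exact: (cvgM fl IH).
Qed.

Lemma cvg_kernel_series (T : Type) (F : set_system T) (FF : ProperFilter F)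
    (f : T -> Cplx R) (l : Cplx R) : (forall x, cabs (f x) <= 1) -> cabs l <= 1 ->
  f @ F --> l -> kernel_series (f x) @[x --> F] --> kernel_series l.
Proof.
move=> f1 l1 fl; apply: (@cvg_lim_psum _ _ _ FF 11).
- by move=> x n; apply: kernel_term_le.
- by move=> n; apply: kernel_term_le.
- move=> n n0; apply: cvgM; last exact: cvg_cst.
  apply: (@cvg_kernel _ _ FF (fun x => f x ^+ n) (l ^+ n)); last first.
    exact: (@cvg_cexpr _ _ FF f l n fl).
  by move=> x; rewrite cabsX exprn_ile1 ?cabs_ge0.
Qed.

Lemma kernel_series0 : k 0 = 0 -> kernel_series 0 = 0.
Proof.
move=> k0; rewrite /kernel_series (_ : psum _ = fun=> 0) ?lim_cst//.
apply/funext => N; rewrite /psum big_nat big1// => n /andP[n0 _].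
by rewrite expr0n gtn_eqF// k0 mul0r.
Qed.

End KernelSeries.

Definition Lp3 := kernel_series triker 3.
Definition Dil := kernel_series dilker 2.

Lemma Lp3_conj w : Lp3 (cconj w) = Lp3 w.
Proof.
rewrite /Lp3 /kernel_series; congr (limn (psum _)); apply/funext => n.
by rewrite -conj_expr /triker cabs_conj Re_conj.
Qed.

(** The terms change sign, so, unlike in [Lp3_conj], the limit has to exist before it can be
    negated; this is the reason for the bound on w. *)
Lemma Dil_conj w : cabs w <= 1 -> Dil (cconj w) = - Dil w.
Proof.
move=> w1; rewrite /Dil /kernel_series -limN; last first.
  by apply: is_cvg_psum => n n0; apply: kernel_term_le => //; exact: dilker_kernel.
congr (limn _); apply/funext => N; rewrite fctE /psum -sumrN; apply: eq_bigr => n _.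
by rewrite -conj_expr /dilker cabs_conj Im_conj !mulNr.
Qed.

Lemma Lp3_0 : Lp3 0 = 0. Proof. by apply: kernel_series0; rewrite /triker mul0r. Qed.
Lemma Dil_0 : Dil 0 = 0. Proof. by apply: kernel_series0; rewrite /dilker mul0r. Qed.

End Kernels.

(** * Derivatives of complex functions of a real variable *)

Section ComplexDerivative.
Variable R : realType.
Implicit Types (z w : Cplx R) (s t : R) (f g x : R -> Cplx R).

Lemma is_derive_cvg (f : R -> R) t (l : R) :
  h^-1 * (f (h + t) - f t) @[h --> 0^'] --> l -> is_derive t 1 f l.
Proof.
move=> h.
have e : (fun h => h^-1 *: ((f \o shift t) (h *: 1) - f t)) =
    (fun h => h^-1 * (f (h + t) - f t)).
  by apply/funext => k; rewrite /= /shift /= [k *: 1]mulr1.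
split.
  by rewrite /derivable e; apply/cvg_ex; exists l.
by rewrite /derive e; apply: cvg_lim.
Qed.

Lemma cvg_is_derive (f : R -> R) t (l : R) : is_derive t 1 f l ->
  h^-1 * (f (h + t) - f t) @[h --> 0^'] --> l.
Proof.
case=> h1 <-; rewrite /derive.
have e : (fun h => h^-1 *: ((f \o shift t) (h *: 1) - f t)) =
    (fun h => h^-1 * (f (h + t) - f t)).
  by apply/funext => k; rewrite /= /shift /= [k *: 1]mulr1.
by move: h1; rewrite /derivable e.
Qed.

Lemma is_derive_continuous (f : R -> R) t (l : R) : is_derive t 1 f l ->
  f s @[s --> t] --> f t.
Proof. by case=> h _; apply: differentiable_continuous; apply/derivable1_diffP. Qed.

(** The difference quotient of f at t is dominated by that of g. It is applied with g a quadratic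
    bound on a Taylor remainder. *)
Lemma is_derive_squeeze (f g : R -> R) t :
  (\forall s \near t, `|f s| <= g s) -> g t = 0 -> is_derive t 1 g 0 ->
  is_derive t 1 f 0.
Proof.
move=> fg g0 /cvg_is_derive gd; apply: is_derive_cvg.
have f0 : f t = 0.
  by have := nbhs_singleton fg; rewrite g0 normr_le0 => /eqP.
rewrite f0; rewrite g0 in gd.
under eq_fun do rewrite subr0.
have {}gd : h^-1 * g (h + t) @[h --> 0^'] --> (0 : R) by under eq_fun do rewrite -[g _]subr0.
have gd' : `|h^-1 * g (h + t)| @[h --> 0^'] --> (0 : R).
  by rewrite -[X in _ --> X](@normr0 _ R); apply: cvg_norm.
have fg' : \forall h \near 0^', `|f (h + t)| <= g (h + t).
  have : \forall h \near (0 : R), `|f (h + t)| <= g (h + t).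
    have hc : (fun h : R => h + t) @ (0 : R) --> t.
      by rewrite -[X in _ --> X]add0r; apply: cvgD; [exact: cvg_id|exact: cvg_cst].
    exact: (hc _ fg).
  exact: cvg_within.
apply: (@squeeze_cvgr _ _ _ _ (fun h => - `|h^-1 * g (h + t)|)
  (fun h => `|h^-1 * g (h + t)|)) => //.
  near=> h; rewrite -ler_norml !normrM ler_wpM2l//.
  by apply: (le_trans _ (ler_norm _)); near: h.
by rewrite -[X in _ --> X]oppr0; apply: cvgN.
Unshelve. all: by end_near.
Qed.

Definition cderiv f t (l : Cplx R) :=
  is_derive t 1 (fun s => Re (f s)) (Re l) /\ is_derive t 1 (fun s => Im (f s)) (Im l).

Lemma cderiv_eq f t l l' : cderiv f t l -> l = l' -> cderiv f t l'.
Proof. by move=> h <-. Qed.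

Lemma cderiv_cvg f t l : cderiv f t l -> f s @[s --> t] --> f t.
Proof.
by case=> h1 h2; apply/ccvgP;
  split; [exact: is_derive_continuous h1|exact: is_derive_continuous h2].
Qed.

Lemma cderiv_cst z t : cderiv (fun=> z) t 0.
Proof. by split; exact: is_derive_cst. Qed.

Lemma cderiv_real t : cderiv (fun s => s%:C) t 1.
Proof. by split; [exact: is_derive_id|exact: is_derive_cst]. Qed.

Lemma cderivD f g t l m : cderiv f t l -> cderiv g t m ->
  cderiv (fun s => f s + g s) t (l + m).
Proof.
move=> [f1 f2] [g1 g2]; split; rewrite ReImE.
  by under eq_fun do rewrite ReD; exact: is_deriveD.
by under eq_fun do rewrite ImD; exact: is_deriveD.
Qed.

Lemma cderivN f t l : cderiv f t l -> cderiv (fun s => - f s) t (- l).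
Proof.
move=> [f1 f2]; split; rewrite ReImE.
  by under eq_fun do rewrite ReN; exact: is_deriveN.
by under eq_fun do rewrite ImN; exact: is_deriveN.
Qed.

Lemma cderivB f g t l m : cderiv f t l -> cderiv g t m ->
  cderiv (fun s => f s - g s) t (l - m).
Proof. by move=> fl gm; apply: cderivD => //; apply: cderivN. Qed.

Lemma cderivM f g t l m : cderiv f t l -> cderiv g t m ->
  cderiv (fun s => f s * g s) t (l * g t + f t * m).
Proof.
move=> [f1 f2] [g1 g2]; split; rewrite !ReImE.
  under eq_fun do rewrite ReM.
  apply: (is_derive_eq (is_deriveB (is_deriveM f1 g1) (is_deriveM f2 g2))).
  rewrite /GRing.scale /=; ring.
under eq_fun do rewrite ImM.
apply: (is_derive_eq (is_deriveD (is_deriveM f1 g2) (is_deriveM f2 g1))).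
rewrite /GRing.scale /=; ring.
Qed.

Lemma is_derive_abs2 f t l : cderiv f t l ->
  is_derive t 1 (fun s => Re (f s) ^+ 2 + Im (f s) ^+ 2)
    (2 * (Re (f t) * Re l + Im (f t) * Im l)).
Proof.
move=> [f1 f2]; apply: (is_derive_eq (is_deriveD (is_deriveM f1 f1) (is_deriveM f2 f2))).
rewrite /GRing.scale /=; ring.
Qed.

Lemma abs2_gt0 z : z != 0 -> 0 < Re z ^+ 2 + Im z ^+ 2.
Proof. by move=> z0; rewrite -cabs_sqr exprn_gt0// cabs_gt0. Qed.

(** This identity and the next express (1 / f)' = - f' / f ^ 2 in real and imaginary parts, with f =
    a + i b and f' = p + i q. *)
Lemma Re_derive_inv (F : fieldType) (a b p q : F) : a ^+ 2 + b ^+ 2 != 0 ->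
  a * (- (a ^+ 2 + b ^+ 2) ^- 2 * (2 * (a * p + b * q))) + (a ^+ 2 + b ^+ 2)^-1 * p =
  - p * ((a * a - b * b) / (a ^+ 2 + b ^+ 2) ^+ 2) -
    - q * (- (a * b + b * a) / (a ^+ 2 + b ^+ 2) ^+ 2).
Proof. by move=> ?; field. Qed.

Lemma Im_derive_inv (F : fieldType) (a b p q : F) : a ^+ 2 + b ^+ 2 != 0 ->
  - b * (- (a ^+ 2 + b ^+ 2) ^- 2 * (2 * (a * p + b * q))) + (a ^+ 2 + b ^+ 2)^-1 * - q =
  - p * (- (a * b + b * a) / (a ^+ 2 + b ^+ 2) ^+ 2) +
    - q * ((a * a - b * b) / (a ^+ 2 + b ^+ 2) ^+ 2).
Proof. by move=> ?; field. Qed.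

Lemma cderivV f t l : cderiv f t l -> f t != 0 ->
  cderiv (fun s => (f s)^-1) t (- l / f t ^+ 2).
Proof.
move=> fl f0; have [f1 f2] := fl; have d2 := is_derive_abs2 fl.
have n0 := abs2_gt0 f0; have nn0 := lt0r_neq0 n0.
have dV := @is_deriveV R (fun s => Re (f s) ^+ 2 + Im (f s) ^+ 2) t _ 1 nn0 d2.
split.
  under eq_fun do rewrite ReV cabs_sqr; apply: (is_derive_eq (is_deriveM f1 dV)).
  rewrite /GRing.scale /=.
  rewrite ReM ReV ImV !ReImE cabsX !cabs_sqr.
  exact: Re_derive_inv.
under eq_fun do rewrite ImV cabs_sqr; apply: (is_derive_eq (is_deriveM (is_deriveN f2) dV)).
rewrite /GRing.scale /=.
rewrite ImM ReV ImV !ReImE cabsX !cabs_sqr; exact: Im_derive_inv.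
Qed.

(** This trades the square root in [cabs] for a sum of squares, which is easy to differentiate. At z
    = 0 both sides are 0 because [ln] is 0 there. *)
Lemma ln_cabsE z : ln (cabs z) = ln (Re z ^+ 2 + Im z ^+ 2) / 2.
Proof.
rewrite -cabs_sqr; have [->|z0] := eqVneq z 0.
  by rewrite cabs0 expr0n /= ln0// mul0r.
by rewrite lnXn ?cabs_gt0// -[_ *+ 2]mulr_natr mulfK.
Qed.

Lemma derive_half_ln (F : numFieldType) (a b p q c : F) : a ^+ 2 + b ^+ 2 != 0 ->
  c * 0 + 2^-1 * ((a ^+ 2 + b ^+ 2)^-1 * (2 * (a * p + b * q))) =
  p * (a / (a ^+ 2 + b ^+ 2)) - q * (- b / (a ^+ 2 + b ^+ 2)).
Proof. by move=> ?; field. Qed.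

Lemma is_derive_ln_cabs f t l : cderiv f t l -> f t != 0 ->
  is_derive t 1 (fun s => ln (cabs (f s))) (Re (l / f t)).
Proof.
move=> fl f0; have d2 := is_derive_abs2 fl; have n0 := abs2_gt0 f0.
have dln := @is_derive1_comp R (@ln R) (fun s => Re (f s) ^+ 2 + Im (f s) ^+ 2) t _ _
  (is_derive1_ln n0) d2.
under eq_fun do rewrite ln_cabsE.
apply: (is_derive_eq (is_deriveM dln (is_derive_cst _ _ _))).
rewrite /GRing.scale /= ReM ReV ImV cabs_sqr. apply: derive_half_ln; exact: lt0r_neq0.
Qed.

End ComplexDerivative.

(** * Power series of polylogarithms *)

Section PowerSeries.
Variable R : realType.
Implicit Types (z w : Cplx R) (s t : R) (u : nat -> Cplx R).

Definition cpsum u : nat -> Cplx R := fun N => \sum_(1 <= n < N) u n.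

Lemma psum_eq (u v : nat -> R) : (forall n, (0 < n)%N -> u n = v n) -> psum u = psum v.
Proof.
by move=> uv; apply/funext => N; apply: eq_big_nat => n /andP[n0 _]; apply: uv.
Qed.

Lemma cvg_psumE (u : nat -> R) : cvgn (psum u) = cvgn (series u).
Proof. exact: is_cvg_series_restrict. Qed.

Lemma Re_cpsum u N : Re (cpsum u N) = psum (fun n => Re (u n)) N.
Proof. exact: Re_sum. Qed.

Lemma Im_cpsum u N : Im (cpsum u N) = psum (fun n => Im (u n)) N.
Proof. exact: Im_sum. Qed.

Lemma is_cvg_psum_le (u v : nat -> R) :
  (forall n, (0 < n)%N -> `|u n| <= v n) -> cvgn (series v) -> cvgn (psum u).
Proof.
(* The hypothesis does not bound u 0, which [psum] skips but [series] includes; it is replaced by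
   0. *)
move=> uv cv; pose u' n := if n is 0 then 0 else u n.
have e : psum u = psum u' by apply: psum_eq => -[].
rewrite e cvg_psumE; apply: normed_cvg.
have cv' : cvgn (series (fun n => `|v n|)).
  rewrite -cvg_psumE (_ : psum _ = psum v) ?cvg_psumE//; apply: psum_eq => n n0.
  by rewrite ger0_norm// (le_trans _ (uv n n0)).
apply: (series_le_cvg _ _ _ cv') => //= -[|n]; rewrite ?normr0//.
by apply: le_trans (ler_norm _); apply: uv.
Qed.

Lemma is_cvg_cpsum u (v : nat -> R) :
  (forall n, (0 < n)%N -> cabs (u n) <= v n) -> cvgn (series v) -> cvgn (cpsum u).
Proof.
move=> uv cv.
have h1 : cvgn (psum (fun n => Re (u n))).
  by apply: (@is_cvg_psum_le _ v) => // n n0; apply: le_trans (Re_le_cabs _) (uv n n0).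
have h2 : cvgn (psum (fun n => Im (u n))).
  by apply: (@is_cvg_psum_le _ v) => // n n0; apply: le_trans (Im_le_cabs _) (uv n n0).
apply/cvg_ex; exists (limn (psum (fun n => Re (u n))) +i* limn (psum (fun n => Im (u n)))).
apply/ccvgP; split.
  by rewrite (_ : (fun N => _) = psum (fun n => Re (u n)))//; apply/funext => N; apply: Re_cpsum.
by rewrite (_ : (fun N => _) = psum (fun n => Im (u n)))//; apply/funext => N; apply: Im_cpsum.
Qed.

Lemma Re_lim_cpsum u : cvgn (cpsum u) ->
  psum (fun n => Re (u n)) @ \oo --> Re (limn (cpsum u)).
Proof.
case/ccvgP => h _; rewrite (_ : psum _ = (fun N => Re (cpsum u N)))//.
by apply/funext => N; rewrite Re_cpsum.
Qed.

Lemma Im_lim_cpsum u : cvgn (cpsum u) ->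
  psum (fun n => Im (u n)) @ \oo --> Im (limn (cpsum u)).
Proof.
case/ccvgP => _ h; rewrite (_ : psum _ = (fun N => Im (cpsum u N)))//.
by apply/funext => N; rewrite Im_cpsum.
Qed.

Lemma LiE k z : Li k z = limn (cpsum (fun n => z ^+ n / n%:R ^+ k)).
Proof. by []. Qed.

Lemma cabs_nat n : cabs (n%:R : Cplx R) = n%:R.
Proof.
have -> : n%:R = (n%:R : R)%:C :> Cplx R by rewrite rmorph_nat.
by rewrite cabs_real normr_nat.
Qed.

Lemma natV_le1 n k : (n.+1%:R ^+ k)^-1 <= 1 :> R.
Proof. by rewrite invf_le1 ?exprn_gt0// exprn_ege1// ler1n. Qed.

Lemma is_cvg_geometric (r : R) : 0 <= r -> r < 1 -> cvgn (series (fun n => r ^+ n)).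
Proof.
move=> r0 r1; have := @is_cvg_geometric_series R 1 r.
rewrite ger0_norm// => /(_ r1); rewrite (_ : geometric 1 r = (fun n => r ^+ n))//.
by apply/funext => n; rewrite /= mul1r.
Qed.

Lemma is_cvg_Li k z : cabs z < 1 -> cvgn (cpsum (fun n => z ^+ n / n%:R ^+ k)).
Proof.
move=> z1; apply: (@is_cvg_cpsum _ (fun n => cabs z ^+ n)); last first.
  by apply: is_cvg_geometric => //; apply: cabs_ge0.
case=> // n _; rewrite cabsM cabsV !cabsX cabs_nat.
by rewrite ler_piMr ?exprn_ge0 ?cabs_ge0 ?natV_le1.
Qed.

Lemma is_cvg_Li_disk k z : cabs z <= 1 -> (1 < k)%N ->
  cvgn (cpsum (fun n => z ^+ n / n%:R ^+ k)).
Proof.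
move=> z1 k1; have uK n : (0 < n)%N -> cabs (z ^+ n / n%:R ^+ k) <= 1 / n%:R ^+ 2.
  move=> n0; rewrite cabsM cabsV !cabsX cabs_nat ler_pM ?exprn_ge0 ?cabs_ge0//.
  - by rewrite exprn_ile1 ?cabs_ge0.
  - by rewrite lef_pV2 ?posrE ?exprn_gt0 ?ltr0n// ler_weXn2l// ler1n.
apply: (@is_cvg_cpsum _ (fun n => 1 / n%:R ^+ 2)) => //.
rewrite -cvg_psumE.
apply: (@is_cvg_psum _ 1) => n n0; rewrite ger0_norm// divr_ge0//.
Qed.

(** The power series of Li_k(z) / z, that is, of the derivative of Li_(k + 1); it also makes sense
    at z = 0. *)
Definition dLi k z : Cplx R := limn (cpsum (fun n => z ^+ n.-1 / n%:R ^+ k)).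

Lemma is_cvg_dLi k z : cabs z < 1 -> cvgn (cpsum (fun n => z ^+ n.-1 / n%:R ^+ k)).
Proof.
move=> z1; apply: (@is_cvg_cpsum _ (fun n => cabs z ^+ n.-1)); last first.
  have h := is_cvg_geometric (cabs_ge0 z) z1.
  (* The indices 0 and 1 both give the exponent 0, hence the additional 1. *)
  apply/cvg_ex; exists (1 + limn (series (fun n => cabs z ^+ n))).
  rewrite -(cvg_shiftS (series (fun n => cabs z ^+ n.-1))).
  rewrite (_ : [sequence _]_n = (fun n => 1 + series (fun n => cabs z ^+ n) n)); last first.
    by apply/funext => n; rewrite /series /= big_nat_recl.
  by apply: cvgD h; apply: cvg_cst.
case=> // n _; rewrite cabsM cabsV !cabsX cabs_nat.
by rewrite ler_piMr ?exprn_ge0 ?cabs_ge0 ?natV_le1.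
Qed.

Lemma mul_dLi k z : cabs z < 1 -> z * dLi k z = Li k z.
Proof.
move=> z1; rewrite LiE; symmetry; apply: cvg_lim => //.
have h : z * cpsum (fun n => z ^+ n.-1 / n%:R ^+ k) N @[N --> \oo] --> z * dLi k z.
  exact: (@cvgM _ _ _ _ (fun=> z) _ _ _ (cvg_cst _) (@is_cvg_dLi k z z1)).
apply: cvg_trans h; apply: near_eq_cvg; near=> N.
rewrite /cpsum /= mulr_sumr !big_nat; apply: eq_bigr => -[|n] // _.
by rewrite mulrA -exprS.
Unshelve. all: by end_near.
Qed.

(** The geometric series S satisfies S = 1 + z S. *)
Lemma dLi0 z : cabs z < 1 -> dLi 0 z = (1 - z)^-1.
Proof.
move=> z1; have z10 : 1 - z != 0.
  by rewrite subr_eq0; apply: contraTneq z1 => <-; rewrite cabs1 ltxx.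
have h := @is_cvg_dLi 0 z z1.
have h2 : 1 + z * cpsum (fun n => z ^+ n.-1 / n%:R ^+ 0) N @[N --> \oo] --> 1 + z * dLi 0 z.
  apply: cvgD; first exact: cvg_cst.
  exact: (@cvgM _ _ _ _ (fun=> z) _ _ _ (cvg_cst _) h).
have e : dLi 0 z = 1 + z * dLi 0 z.
  rewrite {1}/dLi; apply: cvg_lim; first exact: norm_hausdorff.
  rewrite -cvg_shiftS; apply: cvg_trans h2; apply: near_eq_cvg.
  exists 1%N => // -[|N] // _; rewrite /cpsum /= [RHS]big_nat_recl//=.
  rewrite !expr0 divr1 mulr_sumr; congr (_ + _).
  by apply: eq_big_nat => -[|n] //= _; rewrite !divr1 exprS.
by apply: (mulfI z10); rewrite divff// mulrBl mul1r {1}e addrK.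
Qed.

(** By induction: the next remainder is w times the current one plus (n + 1) z ^ n (w - z) ^ 2, and
    (n + 1) n + (n + 1) <= (n + 2) (n + 1). *)
Lemma expr_taylor1_le (rho : R) z w n : cabs z <= rho -> cabs w <= rho ->
  cabs (w ^+ n.+1 - z ^+ n.+1 - (w - z) * (n.+1%:R * z ^+ n)) <=
  (n.+1 * n)%:R * rho ^+ n.-1 * cabs (w - z) ^+ 2.
Proof.
move=> zr wr; have r0 : 0 <= rho := le_trans (cabs_ge0 z) zr.
elim: n => [|n IH].
  by rewrite muln0 !mul0r expr0 !expr1 !mulr1 subrr cabs0.
have -> : w ^+ n.+2 - z ^+ n.+2 - (w - z) * (n.+2%:R * z ^+ n.+1) =
  w * (w ^+ n.+1 - z ^+ n.+1 - (w - z) * (n.+1%:R * z ^+ n)) +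
  n.+1%:R * z ^+ n * (w - z) ^+ 2.
  rewrite -[n.+2%:R]natr1 !exprS; ring.
apply: (le_trans (cabsD _ _)); rewrite !cabsM !cabsX cabs_nat.
have h1 : cabs w * cabs (w ^+ n.+1 - z ^+ n.+1 - (w - z) * (n.+1%:R * z ^+ n)) <=
    (n.+1 * n)%:R * rho ^+ n * cabs (w - z) ^+ 2.
  apply: (le_trans (ler_pM (cabs_ge0 _) (cabs_ge0 _) wr IH)).
  case: n {IH} => [|n]; first by rewrite muln0 !mul0r mulr0.
  by rewrite le_eqVlt; apply/orP; left; apply/eqP;
    rewrite /= [rho ^+ n.+1]exprS; set a := _%:R; ring.
have h2 : n.+1%:R * cabs z ^+ n * cabs (w - z) ^+ 2 <=
    n.+1%:R * rho ^+ n * cabs (w - z) ^+ 2.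
  rewrite ler_wpM2r ?exprn_ge0 ?cabs_ge0// ler_wpM2l//.
  by rewrite lerXn2r ?nnegrE ?cabs_ge0.
apply: (le_trans (lerD h1 h2)); rewrite -!mulrDl /=.
rewrite ler_wpM2r ?exprn_ge0 ?cabs_ge0// ler_wpM2r ?exprn_ge0//.
by rewrite -natrD ler_nat -mulnSr leq_mul.
Qed.

(** The differentiated geometric series. Multiplied by (1 - rho) ^ 2, its partial sums have the
    closed form 1 - (N + 1 - N rho) rho ^ N. *)
Lemma sum_nat_expr_le (rho : R) N : 0 <= rho -> rho < 1 ->
  \sum_(0 <= m < N) m%:R * rho ^+ m.-1 <= (1 - rho) ^- 2.
Proof.
move=> r0 r1; have r10 : 0 < (1 - rho) ^+ 2 by rewrite exprn_gt0// subr_gt0.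
rewrite -[leRHS]mul1r ler_pdivlMr//; case: N => [|N]; first by rewrite big_geq// mul0r.
have -> : (\sum_(0 <= m < N.+1) m%:R * rho ^+ m.-1) * (1 - rho) ^+ 2 =
    1 - (N.+1%:R - N%:R * rho) * rho ^+ N.
  elim: N => [|N IH]; first by rewrite big_nat1 !mul0r expr0 subr0 mulr1 subrr.
  rewrite big_nat_recr//= mulrDl IH -[N.+2%:R]natr1 -[N.+1%:R]natr1 [rho ^+ N.+1]exprS.
  by move: (rho ^+ N) (N%:R) => a b; ring.
rewrite gerBl mulr_ge0 ?exprn_ge0// subr_ge0 -natr1.
apply: (@le_trans _ _ N%:R); first by rewrite ler_piMr// ltW.
by rewrite lerDl.
Qed.

(** Termwise from [expr_taylor1_le]: the denominator n ^ (k + 1) cancels the factor n of n (n - 1),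
    and [sum_nat_expr_le] sums what remains. *)
Lemma Li_taylor1_le (rho : R) k z w : rho < 1 -> cabs z <= rho -> cabs w <= rho ->
  cabs (Li k.+1 w - Li k.+1 z - (w - z) * dLi k z) <= (1 - rho) ^- 2 * cabs (w - z) ^+ 2.
Proof.
move=> r1 zr wr; have r0 : 0 <= rho := le_trans (cabs_ge0 z) zr.
have z1 := le_lt_trans zr r1; have w1 := le_lt_trans wr r1.
pose P N := cpsum (fun n => w ^+ n / n%:R ^+ k.+1) N -
  cpsum (fun n => z ^+ n / n%:R ^+ k.+1) N -
  (w - z) * cpsum (fun n => z ^+ n.-1 / n%:R ^+ k) N.
have PL : P N @[N --> \oo] --> Li k.+1 w - Li k.+1 z - (w - z) * dLi k z.
  apply: cvgB; last first.
    exact: (@cvgM _ _ _ _ (fun=> w - z) _ _ _ (cvg_cst _) (@is_cvg_dLi k z z1)).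
  exact: cvgB (@is_cvg_Li k.+1 w w1) (@is_cvg_Li k.+1 z z1).
have cP := @cvg_cabs R nat \oo eventually_filter P _ PL.
rewrite -(cvg_lim _ cP)//; apply: limr_le; first by apply/cvg_ex; eexists; exact: cP.
have sumK M : \sum_(1 <= n < M) n.-1%:R * rho ^+ n.-2 <= (1 - rho) ^- 2.
  case: M => [|M]; first by rewrite big_geq// invr_ge0 exprn_ge0// subr_ge0 ltW.
  by rewrite big_add1 /=; apply: sum_nat_expr_le.
near=> N; rewrite /P /cpsum mulr_sumr -!sumrB.
apply: (@le_trans _ _ (\sum_(1 <= n < N) n.-1%:R * rho ^+ n.-2 * cabs (w - z) ^+ 2)).
  rewrite !big_nat; elim/big_ind2 : _ => [|x x' y y' h1 h2|[|n] // _].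
  - by rewrite cabs0.
  - by apply: (le_trans (cabsD _ _)); apply: lerD.
  have n0 : n.+1%:R != 0 :> Cplx R by rewrite pnatr_eq0.
  rewrite (_ : _ - _ = (w ^+ n.+1 - z ^+ n.+1 - (w - z) * (n.+1%:R * z ^+ n)) / n.+1%:R ^+ k.+1);
    last by rewrite /= [n.+1%:R ^+ k.+1]exprS; field; rewrite nat1r n0 expf_neq0.
  rewrite cabsM cabsV cabsX cabs_nat ler_pdivrMr ?exprn_gt0//.
  apply: (le_trans (expr_taylor1_le n zr wr)); rewrite natrM.
  rewrite (_ : n.+1%:R * n%:R * _ * _ = n%:R * rho ^+ n.-1 * cabs (w - z) ^+ 2 * n.+1%:R);
    last by ring.
  by rewrite ler_wpM2l ?mulr_ge0 ?exprn_ge0 ?cabs_ge0// ler_eXnr// ler1n.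
rewrite -mulr_suml ler_wpM2r ?exprn_ge0 ?cabs_ge0//.
Unshelve. all: by end_near.
Qed.

(** Near t the path stays in a disk of radius rho < 1, where the remainder D is quadratically small
    and so has derivative 0 at t. The radius is the midpoint of |x t| and 1. *)
Lemma cderiv_Li k (x : R -> Cplx R) t (l : Cplx R) : cderiv x t l -> cabs (x t) < 1 ->
  cderiv (fun s => Li k.+1 (x s)) t (l * dLi k (x t)).
Proof.
move=> xl x1; pose rho := (1 + cabs (x t)) / 2.
have r1 : rho < 1 by rewrite ltr_pdivrMr// mul1r -ltrBrDl; lra.
have xr : cabs (x t) < rho by rewrite ltr_pdivlMr//; lra.
have xc := cderiv_cvg xl.
have near_rho : \forall s \near t, cabs (x s) <= rho.
  have h : cabs (x s) @[s --> t] --> cabs (x t) by apply: cvg_cabs xc.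
  have e0 : 0 < rho - cabs (x t) by rewrite subr_gt0.
  move/cvgrPdist_lt : h => /(_ _ e0); apply: filterS => s.
  by rewrite ltr_norml => /andP[h _]; lra.
pose D s := Li k.+1 (x s) - Li k.+1 (x t) - (x s - x t) * dLi k (x t).
have DK : \forall s \near t, cabs (D s) <= (1 - rho) ^- 2 * cabs (x s - x t) ^+ 2.
  by apply: filterS near_rho => s; apply: Li_taylor1_le => //; exact: ltW.
have dxl : cderiv (fun s => x s - x t) t l.
  by apply: cderiv_eq (cderivB xl (cderiv_cst (x t) t)) _; rewrite subr0.
have g0 : is_derive t 1 (fun s => (1 - rho) ^- 2 * cabs (x s - x t) ^+ 2) 0.
  under eq_fun do rewrite cabs_sqr.
  apply: (is_derive_eq (is_deriveM (is_derive_cst _ _ _) (is_derive_abs2 dxl))).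
  by rewrite subrr /= !mul0r addr0 mulr0 scaler0 scaler0 addr0.
have gt0 : (1 - rho) ^- 2 * cabs (x t - x t) ^+ 2 = 0.
  by rewrite subrr cabs0 expr0n mulr0.
have dD : cderiv D t 0.
  pose g s := (1 - rho) ^- 2 * cabs (x s - x t) ^+ 2.
  split.
    apply: (@is_derive_squeeze R (fun s => Re (D s)) g t _ gt0 g0).
    by apply: filterS DK => s; apply: le_trans; apply: Re_le_cabs.
  apply: (@is_derive_squeeze R (fun s => Im (D s)) g t _ gt0 g0).
  by apply: filterS DK => s; apply: le_trans; apply: Im_le_cabs.
have h := cderivD (cderivD dD (cderiv_cst (Li k.+1 (x t)) t))
  (cderivM dxl (cderiv_cst (dLi k (x t)) t)).
have -> : (fun s => Li k.+1 (x s)) =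
   (fun s => D s + Li k.+1 (x t) + (x s - x t) * dLi k (x t)).
  by apply/funext => s; rewrite /D addrAC !subrK.
by apply: cderiv_eq h _; rewrite addr0 add0r mulr0 addr0.
Qed.

End PowerSeries.

(** * Derivatives inside the unit disk *)

Section ExplicitFormulas.
Variable R : realType.
Implicit Types (z w : Cplx R) (s t : R) (x : R -> Cplx R).

Lemma Re_divn w n k : Re (w / n%:R ^+ k) = Re w / n%:R ^+ k.
Proof.
have -> : (n%:R ^+ k)^-1 = ((n%:R ^+ k)^-1 : R)%:C :> Cplx R.
  by rewrite fmorphV rmorphXn rmorph_nat.
by rewrite ReM /= mulr0 subr0.
Qed.

Lemma Im_divn w n k : Im (w / n%:R ^+ k) = Im w / n%:R ^+ k.
Proof.
have -> : (n%:R ^+ k)^-1 = ((n%:R ^+ k)^-1 : R)%:C :> Cplx R.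
  by rewrite fmorphV rmorphXn rmorph_nat.
by rewrite ImM /= mulr0 add0r.
Qed.

Lemma ln_cabsX z n : (0 < n)%N -> ln (cabs (z ^+ n)) = n%:R * ln (cabs z).
Proof.
move=> n0; rewrite cabsX; have [->|z0] := eqVneq z 0.
  by rewrite cabs0 expr0n gtn_eqF//= ln0// mulr0.
by rewrite lnXn ?cabs_gt0// mulr_natl.
Qed.

Lemma triker_expr z n : (0 < n)%N -> triker (z ^+ n) / n%:R ^+ 3 =
  Re (z ^+ n / n%:R ^+ 3) - ln (cabs z) * Re (z ^+ n / n%:R ^+ 2)
  + ln (cabs z) ^+ 2 / 3 * Re (z ^+ n / n%:R ^+ 1).
Proof.
move=> n0; rewrite !Re_divn /triker ln_cabsX//.
have : n%:R != 0 :> R by rewrite pnatr_eq0 -lt0n.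
move: (Re _) (n%:R) (ln _) => a b c b0; by field.
Qed.

Lemma dilker_expr z n : (0 < n)%N -> dilker (z ^+ n) / n%:R ^+ 2 =
  Im (z ^+ n / n%:R ^+ 2) - ln (cabs z) * Im (z ^+ n / n%:R ^+ 1).
Proof.
move=> n0; rewrite !Im_divn /dilker ln_cabsX//.
have : n%:R != 0 :> R by rewrite pnatr_eq0 -lt0n.
move: (Im _) (n%:R) (ln _) => a b c b0; by field.
Qed.

Lemma psumD (u v : nat -> R) : psum (fun n => u n + v n) = (fun N => psum u N + psum v N).
Proof. by apply/funext => N; rewrite /psum big_split. Qed.

Lemma psumZ (a : R) (u : nat -> R) : psum (fun n => a * u n) = (fun N => a * psum u N).
Proof. by apply/funext => N; rewrite /psum mulr_sumr. Qed.

Lemma Lp3E z : cabs z < 1 ->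
  Lp3 z = Re (Li 3 z) - ln (cabs z) * Re (Li 2 z) + ln (cabs z) ^+ 2 / 3 * Re (Li 1 z).
Proof.
move=> z1; rewrite /Lp3 /kernel_series.
rewrite (psum_eq (fun n n0 => triker_expr z n0)).
apply: cvg_lim => //; rewrite psumD; apply: cvgD.
  rewrite (_ : psum _ = (fun N => psum (fun n => Re (z ^+ n / n%:R ^+ 3)) N +
     (- ln (cabs z)) * psum (fun n => Re (z ^+ n / n%:R ^+ 2)) N)); last first.
    by apply/funext => N; rewrite /psum mulr_sumr -big_split; apply: eq_bigr => n _; rewrite mulNr.
  rewrite -mulNr; apply: cvgD; first exact: (Re_lim_cpsum (@is_cvg_Li R 3 z z1)).
  by apply: cvgMl_tmp; exact: (Re_lim_cpsum (@is_cvg_Li R 2 z z1)).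
rewrite psumZ; apply: cvgMl_tmp; exact: (Re_lim_cpsum (@is_cvg_Li R 1 z z1)).
Qed.

Lemma DilE z : cabs z < 1 -> Dil z = Im (Li 2 z) - ln (cabs z) * Im (Li 1 z).
Proof.
move=> z1; rewrite /Dil /kernel_series.
rewrite (psum_eq (fun n n0 => dilker_expr z n0)).
apply: cvg_lim => //.
rewrite (_ : psum _ = (fun N => psum (fun n => Im (z ^+ n / n%:R ^+ 2)) N +
     (- ln (cabs z)) * psum (fun n => Im (z ^+ n / n%:R ^+ 1)) N)); last first.
  by apply/funext => N; rewrite /psum mulr_sumr -big_split; apply: eq_bigr => n _; rewrite mulNr.
rewrite -mulNr; apply: cvgD; first exact: (Im_lim_cpsum (@is_cvg_Li R 2 z z1)).
by apply: cvgMl_tmp; exact: (Im_lim_cpsum (@is_cvg_Li R 1 z z1)).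
Qed.

Lemma Lp3_unit z : cabs z = 1 -> Lp3 z = Re (Li 3 z).
Proof.
move=> z1; rewrite /Lp3 /kernel_series.
rewrite (_ : psum _ = psum (fun n => Re (z ^+ n / n%:R ^+ 3))); last first.
  by apply: psum_eq => n n0; rewrite triker_expr// z1 ln1 expr0n /= !mul0r subr0 addr0.
apply: cvg_lim => //; apply: (Re_lim_cpsum (@is_cvg_Li_disk R 3 z _ _)) => //.
by rewrite z1.
Qed.

Lemma L3_diskE z : cabs z <= 1 -> L3_disk z = Lp3 z.
Proof.
rewrite le_eqVlt => /orP[/eqP z1|z1].
  by rewrite Lp3_unit// /L3_disk z1 ln1 expr0n /= !mul0r subr0 addr0.
by rewrite Lp3E// /L3_disk ReD ReB !ReM /= !mul0r !subr0.
Qed.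

Lemma one_minus_neq0 z : cabs z < 1 -> 1 - z != 0.
Proof. by move=> z1; rewrite subr_eq0; apply: contraTneq z1 => <-; rewrite cabs1 ltxx. Qed.

Lemma Li_0 k : Li k 0 = 0 :> Cplx R.
Proof.
by rewrite -(@mul_dLi R k 0) ?mul0r// cabs0.
Qed.

(** The sum Re Li_1 + ln |1 - .| has derivative 0 along the segment from 0 to z, and it vanishes at
    0. *)
Lemma Re_Li1 z : cabs z < 1 -> Re (Li 1 z) = - ln (cabs (1 - z)).
Proof.
move=> z1; pose x s : Cplx R := s%:C * z.
have xd s : cderiv x s z.
  by apply: cderiv_eq (cderivM (cderiv_real s) (cderiv_cst z s)) _; rewrite mul1r mulr0 addr0.
pose f s := Re (Li 1 (x s)) + ln (cabs (1 - x s)).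
have fd s : 0 <= s <= 1 -> is_derive s 1 f 0.
  move=> /andP[s0 s1]; have xs1 : cabs (x s) < 1.
    rewrite cabsM cabs_real ger0_norm//; apply: le_lt_trans z1.
    by rewrite ler_piMl ?cabs_ge0.
  have x10 := one_minus_neq0 xs1.
  have h1 := (cderiv_Li 0 (xd s) xs1).1.
  have h2 := is_derive_ln_cabs (cderivB (cderiv_cst 1 s) (xd s)) x10.
  apply: (is_derive_eq (is_deriveD h1 h2)).
  by rewrite dLi0// -ReD sub0r -mulrDl subrr mul0r.
have fc : {within `[0, 1], continuous f}.
  by apply: derivable_within_continuous => s; rewrite in_itv /= => /fd[].
have fd' s : s \in `]0, 1[ -> is_derive s 1 f 0.
  by rewrite in_itv /= => /andP[/ltW s0 /ltW s1]; apply: fd; rewrite s0.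
have [c _] := MVT ltr01 fd' fc.
rewrite mul0r /f /x mul1r mul0r Li_0 subr0 cabs1 ln1 addr0 subr0 => /eqP.
by rewrite addr_eq0 => /eqP.
Qed.


Section InsideDisk.
Variables (x : R -> Cplx R) (t : R) (l : Cplx R).
Hypotheses (xl : cderiv x t l) (x0 : x t != 0) (x1 : cabs (x t) < 1).
Let xi := l / x t.
Let eta := - l / (1 - x t).

Let near_lt1 : \forall s \near t, cabs (x s) < 1.
Proof.
have h : cabs (x s) @[s --> t] --> cabs (x t) by apply: cvg_cabs (cderiv_cvg xl).
have e0 : 0 < 1 - cabs (x t) by rewrite subr_gt0.
move/cvgrPdist_lt : h => /(_ _ e0); apply: filterS => s.
by rewrite ltr_norml => /andP[h _]; lra.
Qed.

Let dLi_S k : cderiv (fun s => Li k.+2 (x s)) t (xi * Li k.+1 (x t)).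
Proof.
apply: cderiv_eq (cderiv_Li k.+1 xl x1) _.
by rewrite -(mul_dLi k.+1 x1) mulrA divfK.
Qed.

Let dLi_1 : cderiv (fun s => Li 1 (x s)) t (- eta).
Proof. by apply: cderiv_eq (cderiv_Li 0 xl x1) _; rewrite dLi0// /eta mulNr opprK. Qed.

(** The terms in Re Li_2 cancel, those in Im Li_2 and Im Li_1 assemble into [Dil], and Re Li_1 = -
    ln |1 - x| turns the rest into logarithms. *)
Lemma is_derive_Lp3_disk :
  is_derive t 1 (fun s => Lp3 (x s)) (- Dil (x t) * Im xi +
    ln (cabs (x t)) * (ln (cabs (1 - x t)) * Re xi - ln (cabs (x t)) * Re eta) / 3).
Proof.
have dl := is_derive_ln_cabs xl x0.
apply: (@near_eq_is_derive _ _ _ (fun s => Re (Li 3 (x s)) -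
   ln (cabs (x s)) * Re (Li 2 (x s)) +
   ln (cabs (x s)) * ln (cabs (x s)) * (Re (Li 1 (x s)) * 3^-1))).
  by apply: filterS near_lt1 => s s1; rewrite Lp3E// expr2; ring.
have d3 := (dLi_S 1).1; have d2 := (dLi_S 0).1; have d1 := dLi_1.1.
have h := is_deriveD (is_deriveB d3 (is_deriveM dl d2))
  (is_deriveM (is_deriveM dl dl) (is_deriveM d1 (is_derive_cst (3^-1 : R) t 1))).
apply: (is_derive_eq h).
rewrite !fctE /GRing.scale /= -/xi DilE// (ReM xi) (ReM xi) (ReN eta) Re_Li1//.
move: (Re xi) (Im xi) (Re eta) (Im eta) (ln (cabs (x t))) (ln (cabs (1 - x t)))
  (Re (Li 2 (x t))) (Im (Li 2 (x t))) (Im (Li 1 (x t))) => a b c d e f g h' i.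
by field.
Qed.

Lemma is_derive_Dil_disk :
  is_derive t 1 (fun s => Dil (x s))
    (ln (cabs (x t)) * Im eta - ln (cabs (1 - x t)) * Im xi).
Proof.
have dl := is_derive_ln_cabs xl x0.
apply: (@near_eq_is_derive _ _ _ (fun s => Im (Li 2 (x s)) -
   ln (cabs (x s)) * Im (Li 1 (x s)))).
  by apply: filterS near_lt1 => s s1; rewrite DilE.
have d2 := (dLi_S 0).2; have d1 := dLi_1.2.
apply: (is_derive_eq (is_deriveB d2 (is_deriveM dl d1))).
rewrite /GRing.scale /= -/xi (ImM xi) (ImN eta) Re_Li1//.
move: (Re xi) (Im xi) (Re eta) (Im eta) (ln (cabs (x t))) (ln (cabs (1 - x t)))
  (Re (Li 2 (x t))) (Im (Li 2 (x t))) (Im (Li 1 (x t))) => a b c d e f g h' i.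
by ring.
Qed.

End InsideDisk.
End ExplicitFormulas.

(** * Extension to the projective line *)

Section Homogeneous.
Variable R : realType.
Implicit Types (n m c z : Cplx R) (s t : R).

(* The point n / m of P^1, or its inverse conjugate 1 / (n / m)^* when it lies
   outside of the unit disk: a continuous retraction of P^1 onto the disk. *)
Definition disk_pt n m : Cplx R :=
  n * cconj m * ((Num.max (cabs n) (cabs m) ^- 2)%:C : Cplx R).

Definition L3h n m : R := Lp3 (disk_pt n m).
Definition Dilh n m : R := Dil (disk_pt n m).

Lemma max_cabs_gt0 n m : (n != 0) || (m != 0) -> 0 < Num.max (cabs n) (cabs m).
Proof. by rewrite lt_max !cabs_gt0. Qed.

Lemma cabs_disk_pt n m : cabs (disk_pt n m) <= 1.
Proof.
rewrite !cabsM cabs_conj cabs_real.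
have [->|n0] := eqVneq n 0; first by rewrite cabs0 !mul0r.
have M0 := max_cabs_gt0 (n := n) (m := m); rewrite n0 in M0; have {M0} := M0 isT.
set M := Num.max _ _ => M0.
rewrite ger0_norm ?invr_ge0 ?exprn_ge0 ?(ltW M0)// ler_pdivrMr ?exprn_gt0// mul1r expr2.
by rewrite ler_pM ?cabs_ge0// le_max lexx ?orbT.
Qed.

(** Inversion on P1 becomes conjugation on the disk, so the inversion relations of L_3 and P reduce
    to their parity under conjugation. *)
Lemma disk_ptC n m : disk_pt m n = cconj (disk_pt n m).
Proof. by rewrite /disk_pt maxC !conj_mul conj_conj conj_re [m * _]mulrC. Qed.

Lemma L3hC n m : L3h m n = L3h n m.
Proof. by rewrite /L3h disk_ptC Lp3_conj. Qed.

Lemma DilhC n m : Dilh m n = - Dilh n m.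
Proof. by rewrite /Dilh disk_ptC Dil_conj ?cabs_disk_pt. Qed.

Lemma disk_ptZ c n m : c != 0 -> disk_pt (c * n) (c * m) = disk_pt n m.
Proof.
move=> c0; rewrite /disk_pt !cabsM -maxr_pMr ?cabs_ge0// exprMn invfM conj_mul rmorphM /=.
rewrite (_ : c * n * _ * _ = (c * cconj c) * ((cabs c ^- 2)%:C : Cplx R) * (n * cconj m *
  ((Num.max (cabs n) (cabs m) ^- 2)%:C : Cplx R))); last by ring.
by rewrite mul_conj -rmorphM mulfV ?mul1r// expf_neq0// cabs_eq0.
Qed.

Lemma disk_pt_div n m : cabs n <= cabs m -> m != 0 -> disk_pt n m = n / m.
Proof.
move=> nm m0; rewrite /disk_pt (max_idPr nm) -mulrA; congr (_ * _).
apply: (mulfI m0); rewrite divff// mulrA mul_conj -rmorphM divff//.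
by rewrite expf_neq0// cabs_eq0.
Qed.

Lemma disk_pt0l m : disk_pt 0 m = 0.
Proof. by rewrite /disk_pt !mul0r. Qed.

Lemma disk_pt0r n : disk_pt n 0 = 0.
Proof. by rewrite disk_ptC disk_pt0l /cconj conjc0. Qed.

Lemma cvg_disk_pt (T : Type) (F : set_system T) (FF : ProperFilter F)
    (f g : T -> Cplx R) n m : (n != 0) || (m != 0) ->
  f @ F --> n -> g @ F --> m -> disk_pt (f x) (g x) @[x --> F] --> disk_pt n m.
Proof.
move=> nm fn gm.
have cf : cabs (f x) @[x --> F] --> cabs n by apply: cvg_cabs fn.
have cg : cabs (g x) @[x --> F] --> cabs m by apply: cvg_cabs gm.
have cM : Num.max (cabs (f x)) (cabs (g x)) @[x --> F] --> Num.max (cabs n) (cabs m).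
  rewrite maxr_absE; under eq_fun do rewrite maxr_absE.
  apply: cvgM; last exact: cvg_cst.
  by apply: cvgD; [exact: cvgD|apply: cvg_norm; exact: cvgB].
have cV : Num.max (cabs (f x)) (cabs (g x)) ^- 2 @[x --> F] -->
    Num.max (cabs n) (cabs m) ^- 2.
  by apply: cvgV; [rewrite expf_neq0// lt0r_neq0// max_cabs_gt0|exact: cvgM].
have [fR fI] := (ccvgP _ f n).1 fn; have [gR gI] := (ccvgP _ g m).1 gm.
apply/ccvgP; split.
- rewrite /disk_pt ReM ReM ImM Re_conj Im_conj /=.
  under eq_fun do rewrite ReM ReM ImM Re_conj Im_conj /=.
  apply: cvgB; last by apply: cvgM; [apply: cvgD; apply: cvgM => //; exact: cvgN|exact: cvg_cst].
  by apply: cvgM => //; apply: cvgB; apply: cvgM => //; exact: cvgN.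
- rewrite /disk_pt ImM ReM ImM Re_conj Im_conj /=.
  under eq_fun do rewrite ImM ReM ImM Re_conj Im_conj /=.
  apply: cvgD; first by apply: cvgM; [apply: cvgB; apply: cvgM => //; exact: cvgN|exact: cvg_cst].
  by apply: cvgM => //; apply: cvgD; apply: cvgM => //; exact: cvgN.
Qed.

Lemma cvg_L3h (T : Type) (F : set_system T) (FF : ProperFilter F)
    (f g : T -> Cplx R) n m : (n != 0) || (m != 0) ->
  f @ F --> n -> g @ F --> m -> L3h (f x) (g x) @[x --> F] --> L3h n m.
Proof.
move=> nm fn gm.
exact: (@cvg_kernel_series R (@triker R) 3 (@triker_kernel R) isT T F FF
  (fun x => disk_pt (f x) (g x)) (disk_pt n m) (fun x => cabs_disk_pt _ _)
  (cabs_disk_pt _ _) (cvg_disk_pt FF nm fn gm)).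
Qed.

Lemma cvg_Dilh (T : Type) (F : set_system T) (FF : ProperFilter F)
    (f g : T -> Cplx R) n m : (n != 0) || (m != 0) ->
  f @ F --> n -> g @ F --> m -> Dilh (f x) (g x) @[x --> F] --> Dilh n m.
Proof.
move=> nm fn gm.
exact: (@cvg_kernel_series R (@dilker R) 2 (@dilker_kernel R) isT T F FF
  (fun x => disk_pt (f x) (g x)) (disk_pt n m) (fun x => cabs_disk_pt _ _)
  (cabs_disk_pt _ _) (cvg_disk_pt FF nm fn gm)).
Qed.

Lemma L3_rawE z : L3_raw z = L3h z 1.
Proof.
rewrite /L3_raw normCE lecR /L3h; case: ifPn => z1.
  by rewrite disk_pt_div ?cabs1 ?oner_eq0// divr1 L3_diskE.
have z0 : z != 0 by apply: contraNneq z1 => ->; rewrite cabs0.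
have z1' : 1 <= cabs z by rewrite leNgt; apply: contra z1 => /ltW.
rewrite disk_ptC Lp3_conj disk_pt_div ?cabs1// mul1r L3_diskE//.
by rewrite cabsV invf_le1 ?cabs_gt0.
Qed.

Lemma cvg_dnbhs_id (T : topologicalType) (x : T) : id @ x^' --> x.
Proof. exact: cvg_within. Qed.

Lemma L3_Some z : L3 (Some z) = L3h z 1.
Proof.
rewrite /L3; case: ifP => _; last exact: L3_rawE.
under eq_fun do rewrite L3_rawE.
apply: cvg_lim => //; apply: (@cvg_L3h (Cplx R) _ _ id (fun=> 1) z 1).
- by rewrite oner_eq0 orbT.
- exact: cvg_dnbhs_id.
- exact: cvg_cst.
Qed.

Lemma L3_None : L3 (None : P1 R) = 0.
Proof.
rewrite /L3; apply: cvg_lim => //.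
have e : {near (0 : Cplx R)^', (fun w => L3h 1 w) =1 (fun w => L3_raw w^-1)}.
  near=> w; have w0 : w != 0 by near: w; exact: nbhs_dnbhs_neq.
  have w0' : w^-1 != 0 by rewrite invr_eq0.
  by have := disk_ptZ 1 w w0'; rewrite mulr1 mulVf// /L3h L3_rawE /L3h => ->.
suff h : L3h 1 w @[w --> (0 : Cplx R)^'] --> (0 : R) by exact: cvg_trans (near_eq_cvg e) h.
rewrite -[X in _ --> X](_ : L3h 1 0 = 0); last by rewrite /L3h disk_pt0r Lp3_0.
apply: (@cvg_L3h (Cplx R) _ _ (fun=> 1) id 1 0).
- by rewrite oner_eq0.
- exact: cvg_cst.
- exact: cvg_dnbhs_id.
Unshelve. all: by end_near.
Qed.


Section HomogeneousDerivative.
Variables (n m : R -> Cplx R) (t : R) (n' m' : Cplx R).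
Hypotheses (dn : cderiv n t n') (dm : cderiv m t m').
Hypotheses (n0 : n t != 0) (m0 : m t != 0) (k0 : m t - n t != 0).
Let xi := n' / n t - m' / m t.
Let eta := (m' - n') / (m t - n t) - m' / m t.
Let a := ln (cabs (n t)) - ln (cabs (m t)).
Let b := ln (cabs (m t - n t)) - ln (cabs (m t)).

(** For x = n / m one has xi = dlog x, eta = dlog (1 - x), a = ln |x| and b = ln |1 - x|, and x
    equals [disk_pt n m] near t. *)
Lemma is_derive_homogeneous_lt : cabs (n t) < cabs (m t) ->
  is_derive t 1 (fun s => L3h (n s) (m s))
    (- Dilh (n t) (m t) * Im xi + a * (b * Re xi - a * Re eta) / 3) /\
  is_derive t 1 (fun s => Dilh (n s) (m s)) (a * Im eta - b * Im xi).
Proof.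
move=> nm; pose x s := n s / m s.
have dx : cderiv x t (n' / m t - n t * m' / m t ^+ 2).
  apply: cderiv_eq (cderivM dn (cderivV dm m0)) _.
  by rewrite mulNr mulrN mulrA.
have x0 : x t != 0 by rewrite mulf_neq0// invr_eq0.
have x1 : cabs (x t) < 1 by rewrite cabsM cabsV ltr_pdivrMr ?cabs_gt0// mul1r.
have near_lt : \forall s \near t, cabs (n s) < cabs (m s).
  have hn : cabs (n s) @[s --> t] --> cabs (n t) by apply: cvg_cabs (cderiv_cvg dn).
  have hm : cabs (m s) @[s --> t] --> cabs (m t) by apply: cvg_cabs (cderiv_cvg dm).
  have e0 : 0 < (cabs (m t) - cabs (n t)) / 2 by rewrite divr_gt0// subr_gt0.
  move/cvgrPdist_lt : hn => /(_ _ e0) hn; move/cvgrPdist_lt : hm => /(_ _ e0) hm.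
  by apply: filterS2 hn hm => s; rewrite !ltr_norml => /andP[h1 _] /andP[_ h2]; lra.
have near_x : \forall s \near t, x s = disk_pt (n s) (m s).
  apply: filterS near_lt => s nms; rewrite disk_pt_div//; first exact: ltW.
  by rewrite -cabs_gt0; apply: le_lt_trans nms; apply: cabs_ge0.
have xt : disk_pt (n t) (m t) = x t by rewrite disk_pt_div// ltW.
have exi : (n' / m t - n t * m' / m t ^+ 2) / x t = xi.
  by rewrite /x /xi; field; rewrite n0 m0.
have eeta : - (n' / m t - n t * m' / m t ^+ 2) / (1 - x t) = eta.
  by rewrite /x /eta; field; rewrite m0 k0.
have ea : ln (cabs (x t)) = a.
  by rewrite cabsM cabsV lnM ?posrE ?invr_gt0 ?cabs_gt0// lnV ?posrE ?cabs_gt0.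
have eb : ln (cabs (1 - x t)) = b.
  rewrite -[1](divff m0) -mulrBl cabsM cabsV.
  by rewrite lnM ?posrE ?invr_gt0 ?cabs_gt0// lnV ?posrE ?cabs_gt0.
have h1 := is_derive_Lp3_disk dx x0 x1; have h2 := is_derive_Dil_disk dx x0 x1.
rewrite exi eeta ea eb in h1 h2.
split.
- rewrite /Dilh xt; apply: near_eq_is_derive h1.
  by apply: filterS near_x => s e; rewrite /L3h -e.
- by apply: near_eq_is_derive h2; apply: filterS near_x => s e; rewrite /Dilh -e.
Qed.

End HomogeneousDerivative.

(** For |n| > |m| the roles of n and m are exchanged: (xi, eta, a, b) becomes (- xi, eta - xi, - a,
    b - a), and both formulas are compatible with [L3hC] and [DilhC]. *)
Lemma is_derive_homogeneous (n m : R -> Cplx R) (t : R) (n' m' : Cplx R) :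
  cderiv n t n' -> cderiv m t m' ->
  n t != 0 -> m t != 0 -> m t - n t != 0 -> cabs (n t) != cabs (m t) ->
  let xi := n' / n t - m' / m t in
  let eta := (m' - n') / (m t - n t) - m' / m t in
  let a := ln (cabs (n t)) - ln (cabs (m t)) in
  let b := ln (cabs (m t - n t)) - ln (cabs (m t)) in
  is_derive t 1 (fun s => L3h (n s) (m s))
    (- Dilh (n t) (m t) * Im xi + a * (b * Re xi - a * Re eta) / 3) /\
  is_derive t 1 (fun s => Dilh (n s) (m s)) (a * Im eta - b * Im xi).
Proof.
move=> dn dm n0 m0 k0; rewrite neq_lt => /orP[lt|lt] xi eta a b.
  exact: is_derive_homogeneous_lt.
have k0' : n t - m t != 0 by rewrite -opprB oppr_eq0.
have [h1 h2] := is_derive_homogeneous_lt dm dn m0 n0 k0' lt.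
have exi : m' / m t - n' / n t = - xi by rewrite opprB.
have eeta : (n' - m') / (n t - m t) - n' / n t = eta - xi.
  by rewrite /eta /xi -[n' - m']opprB -[n t - m t]opprB invrN mulrNN; ring.
have ea : ln (cabs (m t)) - ln (cabs (n t)) = - a by rewrite opprB.
have eb : ln (cabs (n t - m t)) - ln (cabs (n t)) = b - a.
  by rewrite -[n t - m t]opprB cabsN /a /b; ring.
rewrite exi eeta ea eb in h1 h2.
split.
- under eq_fun do rewrite -L3hC; apply: is_derive_eq h1 _.
  by rewrite DilhC ReB ReN ImN; move: (Re xi) (Re eta) (Im xi) (Dilh _ _) => c d e f; ring.
- under eq_fun do rewrite DilhC; apply: is_derive_eq (is_deriveN h2) _.
  by rewrite ImB ImN; move: (Im xi) (Im eta) => c d; ring.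
Qed.

End Homogeneous.

(** * Constancy along polynomial paths *)

Section Constancy.
Variable R : realType.
Implicit Types (s t : R) (z : {poly Cplx R}).

(** Induction on [bad]: the interval is cut at each bad time inside it, and continuity allows the
    mean value theorem on the closed pieces. *)
Lemma constant_off_finite (f : R -> R) (bad : seq R) (a b : R) : a <= b ->
  (forall t, f s @[s --> t] --> f t) ->
  (forall t, a < t < b -> t \notin bad -> is_derive t 1 f 0) -> f a = f b.
Proof.
move=> ab fc; elim: bad a b ab => [|c bad IH] a b ab fd.
  move: ab; rewrite le_eqVlt => /orP[/eqP -> //|ab].
  have fd' t : t \in `]a, b[ -> is_derive t 1 f 0.
    by rewrite in_itv /= => tab; apply: fd.
  have [d _] := MVT ab fd' (continuous_subspaceT fc).
  by rewrite mul0r => /eqP; rewrite subr_eq0 => /eqP.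
have [/andP[ac cb]|nab] := boolP (a < c < b).
  transitivity (f c).
    apply: IH => [|t /andP[at' tc] tb]; first exact: ltW.
    apply: fd; first by rewrite at' (lt_trans tc).
    by rewrite inE negb_or tb lt_eqF.
  apply: IH => [|t /andP[ct tb] tbad]; first exact: ltW.
  apply: fd; first by rewrite tb (lt_trans ac).
  by rewrite inE negb_or tbad gt_eqF.
apply: IH => // t tab tb; apply: fd => //.
by rewrite inE negb_or tb andbT; apply: contraNneq nab => <-.
Qed.

Lemma interpolation (F : numFieldType) (zs : seq F) :
  exists p : {poly F}, forall i, (i < size zs)%N -> p.[i%:R] = zs`_i.
Proof.
elim/last_ind: zs => [|zs z [p Hp]]; first by exists 0.
pose q : {poly F} := \prod_(0 <= i < size zs) ('X - (i%:R)%:P).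
have qE x : q.[x] = \prod_(0 <= i < size zs) (x - i%:R).
  by rewrite horner_prod; apply: eq_bigr => i _; rewrite hornerXsubC.
have q0 : q.[(size zs)%:R] != 0.
  rewrite qE big_mkord; apply/prodf_neq0 => i _.
  by rewrite subr_eq0 eqr_nat gtn_eqF.
pose k := (z - p.[(size zs)%:R]) / q.[(size zs)%:R].
exists (p + k *: q) => i; rewrite size_rcons ltnS leq_eqVlt => /orP[/eqP ->|ik].
  by rewrite hornerD hornerZ divfK// subrKC nth_rcons ltnn eqxx.
rewrite hornerD hornerZ Hp// nth_rcons ik qE (bigD1_seq i) ?mem_index_iota ?iota_uniq//=.
by rewrite subrr mul0r mulr0 addr0.
Qed.

(** The quotient N / M is off the unit circle at w. With M = 0 the same condition says that N does
    not vanish at w, so one notion covers both kinds of obstacles. *)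
Definition admissible (N M : {poly Cplx R}) (w : Cplx R) := cabs N.[w] != cabs M.[w].

(** At real t the conjugate of a polynomial value is the value of the polynomial with conjugate
    coefficients. Hence |N(z(t))| ^ 2 - |M(z(t))| ^ 2 is a polynomial in t, nonzero at t0. *)
Lemma finitely_many_inadmissible (N M z : {poly Cplx R}) (t0 : R) :
  admissible N M z.[t0%:C] ->
  exists bad : seq R, forall t, t \notin bad -> admissible N M z.[t%:C].
Proof.
move=> h0; pose cj := map_poly (@Num.conj (Cplx R)).
pose Z := (N \Po z) * cj (N \Po z) - (M \Po z) * cj (M \Po z).
have ZE t : Z.[t%:C] = (cabs N.[z.[t%:C]] ^+ 2)%:C - (cabs M.[z.[t%:C]] ^+ 2)%:C.
  have cjE (p : {poly Cplx R}) : (cj p).[t%:C] = cconj p.[t%:C].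
    have e : Num.conj (t%:C : Cplx R) = t%:C by exact: conj_re.
    by rewrite -{1}e horner_map.
  by rewrite /Z !hornerE !cjE !horner_comp !mul_conj.
have Zadm t : Z.[t%:C] != 0 -> admissible N M z.[t%:C].
  by rewrite ZE; apply: contra => /eqP ->; rewrite subrr.
have Z0 : Z != 0.
  apply: contraNneq h0 => Z0; have := ZE t0; rewrite Z0 horner0 => /esym/eqP.
  rewrite -rmorphB /= (inj_eq (@complexI R) _ 0) subr_eq0.
  by rewrite eqrXn2 ?cabs_ge0.
have [r Zr] := closed_field_poly_normal Z.
(* The real parts of all complex roots include every real root. *)
exists [seq Re x | x <- r] => t tr; apply: Zadm.
rewrite Zr hornerZ mulf_neq0 ?lead_coef_eq0// -/(root _ _) root_prod_XsubC.
by apply: contra tr => tr; apply/mapP; exists t%:C.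
Qed.

Lemma cderiv_horner (z : {poly Cplx R}) t :
  cderiv (fun s => z.[s%:C]) t (z^`()).[t%:C].
Proof.
elim/poly_ind: z => [|p c IH].
  by under eq_fun do rewrite horner0; rewrite deriv0 horner0; exact: cderiv_cst.
under eq_fun do rewrite hornerMXaddC.
apply: cderiv_eq (cderivD (cderivM IH (cderiv_real t)) (cderiv_cst c t)) _.
by rewrite derivMXaddC hornerD hornerMX addr0 mulr1 addrC.
Qed.

Section Meta.
Variables (Phi : Cplx R * Cplx R -> R) (L : seq ({poly Cplx R} * {poly Cplx R})).
Hypothesis PhiZ : forall c x y, c != 0 -> Phi (c * x, c * y) = Phi (x, y).
Hypothesis Phi_cont : forall (x y : R -> Cplx R) t, (x t != 0) || (y t != 0) ->
  x s @[s --> t] --> x t -> y s @[s --> t] --> y t ->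
  Phi (x s, y s) @[s --> t] --> Phi (x t, y t).
Hypothesis L_admissible : forall NM, NM \in L -> exists w, admissible NM.1 NM.2 w.
Hypothesis Phi_derive : forall z t,
  (forall NM, NM \in L -> admissible NM.1 NM.2 z.[t%:C]) ->
  is_derive t 1 (fun s => Phi (z.[s%:C], 1)) 0.

(* The path interpolates a, b and a witness for each pair in L, so that each pair
   is inadmissible at finitely many times only. *)
Lemma admissible_path (a b : Cplx R) : exists z : {poly Cplx R}, exists bad : seq R,
  [/\ z.[0%:C] = a, z.[1%:C] = b & forall t, t \notin bad -> forall NM, NM \in L ->
    admissible NM.1 NM.2 z.[t%:C]].
Proof.
have [ws Hws] : exists ws : seq (Cplx R), size ws = size L /\ forall i, (i < size L)%N ->
    admissible (nth (0, 0) L i).1 (nth (0, 0) L i).2 ws`_i.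
  elim: L L_admissible => [|NM M IH] LM; first by exists [::].
  have [w Hw] := LM NM (mem_head _ _).
  have [|ws [sz Hws]] := IH; first by move=> P PM; apply: LM; rewrite inE PM orbT.
  by exists (w :: ws); split; [rewrite /= sz|case].
have [z Hz] := interpolation [:: a, b & ws].
exists z.
have [bad Hbad] : exists bad : seq R, forall t, t \notin bad -> forall NM, NM \in L ->
    admissible NM.1 NM.2 z.[t%:C].
  case: Hws => sz Hws.
  have Hz' i : (i < size L)%N ->
      admissible (nth (0, 0) L i).1 (nth (0, 0) L i).2 z.[(i.+2%:R : R)%:C].
    by move=> iL; rewrite rmorph_nat (Hz i.+2) /= ?sz//; apply: Hws.
  suff H (M : seq ({poly Cplx R} * {poly Cplx R})) : {subset M <= L} ->
      exists bad : seq R, forall t, t \notin bad -> forall NM, NM \in M ->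
      admissible NM.1 NM.2 z.[t%:C] by apply: H.
  elim: M => [|NM M IH] ML; first by exists [::].
  have [|bad1 H1] := IH; first by move=> P PM; apply: ML; rewrite inE PM orbT.
  have NML : NM \in L by apply: ML; rewrite mem_head.
  have := Hz' (index NM L); rewrite index_mem nth_index// => /(_ NML) h.
  have [bad2 H2] := finitely_many_inadmissible h.
  exists (bad1 ++ bad2) => t; rewrite mem_cat negb_or => /andP[t1 t2] P.
  by rewrite inE => /orP[/eqP ->|]; [apply: H2|apply: H1].
exists bad; split=> //.
- by have := Hz 0%N isT.
- by have := Hz 1%N isT.
Qed.

Lemma Phi_constant_finite (a b : Cplx R) : Phi (a, 1) = Phi (b, 1).
Proof.
have [z [bad [za zb Hbad]]] := admissible_path a b.
have zc (t : R) : z.[s%:C] @[s --> t] --> z.[t%:C] by apply: cderiv_cvg (cderiv_horner z t).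
rewrite -za -zb; apply: (@constant_off_finite (fun s => Phi (z.[s%:C], 1)) bad) => // t.
  apply: (@Phi_cont (fun s => z.[s%:C]) (fun=> 1)) => //; first by rewrite oner_eq0 orbT.
  exact: cvg_cst.
by move=> _ tbad; apply: Phi_derive; apply: Hbad.
Qed.

(** Infinity is the limit of the points (1 : s), which for s <> 0 are the finite points 1 / s. *)
Lemma Phi_infty : Phi (1, 0) = Phi (0, 1).
Proof.
have h : Phi (1, s%:C) @[s --> (0 : R)] --> Phi (1, 0).
  apply: (@Phi_cont (fun=> 1) (fun s => s%:C) 0); first by rewrite oner_eq0.
    exact: cvg_cst.
  exact: cderiv_cvg (cderiv_real 0).
have h' : Phi (1, s%:C) @[s --> (0 : R)^'] --> Phi (1, 0).
  by apply: cvg_trans h; apply: cvg_app; exact: nbhs_dnbhs.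
have e : {near (0 : R)^', (fun s => Phi (1, s%:C)) =1 (fun=> Phi (0, 1))}.
  near=> s; have s0 : s != 0 by near: s; exact: nbhs_dnbhs_neq.
  have s0' : (s%:C : Cplx R) != 0 by rewrite (inj_eq (@complexI R) _ 0).
  rewrite (Phi_constant_finite 0 (s%:C)^-1) -(PhiZ (s%:C)^-1 1 s0').
  by rewrite mulfV// mulr1.
have h2 : Phi (1, s%:C) @[s --> (0 : R)^'] --> Phi (0, 1).
  by apply: cvg_trans (near_eq_cvg _) (cvg_cst _); apply: filterS e => s /= ->.
by rewrite -(cvg_lim _ h')// (cvg_lim _ h2).
Unshelve. all: by end_near.
Qed.

Lemma Phi_constant (a b : P1 R) : Phi (hcoord a) = Phi (hcoord b).
Proof.
suff h c : Phi (hcoord c) = Phi (0, 1) by rewrite !h.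
by case: c => [c|]; [exact: Phi_constant_finite|exact: Phi_infty].
Qed.

End Meta.
End Constancy.

(** * Rational maps in homogeneous coordinates *)

Section Lift.
Variable R : realType.
Local Notation V := (Cplx R * Cplx R)%type.
Implicit Types (p q : V) (a b c : P1 R) (f g : {poly Cplx R}).

Definition br p q : Cplx R := p.1 * q.2 - p.2 * q.1.

Lemma br_hcoord a b : br (hcoord a) (hcoord b) = bracket a b.
Proof. by []. Qed.

Lemma bracketC a b : bracket b a = - bracket a b.
Proof. by rewrite /bracket opprB [_.2 * _]mulrC [_.1 * _.2]mulrC. Qed.

(** The Plucker relation: through it 1 minus a cross ratio is again a quotient of products of
    brackets. *)
Lemma br_plucker p q r s : br p s * br q r - br p r * br q s = br p q * br s r.
Proof. rewrite /br; ring. Qed.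

(** Both p.1 [a, b] and p.2 [a, b] are combinations of [p, a] and [p, b]. *)
Lemma br_eq0 p a b : p.1 != 0 \/ p.2 != 0 -> br p (hcoord a) = 0 -> br p (hcoord b) = 0 -> a = b.
Proof.
move=> p0 ha hb; apply/eqP; rewrite -bracket_eq0 -br_hcoord; apply/eqP.
have h1 : p.1 * br (hcoord a) (hcoord b) = 0.
  rewrite (_ : _ * _ = (hcoord a).1 * br p (hcoord b) - (hcoord b).1 * br p (hcoord a)).
    by rewrite ha hb !mulr0 subrr.
  by rewrite /br; ring.
have h2 : p.2 * br (hcoord a) (hcoord b) = 0.
  rewrite (_ : _ * _ = (hcoord a).2 * br p (hcoord b) - (hcoord b).2 * br p (hcoord a)).
    by rewrite ha hb !mulr0 subrr.
  by rewrite /br; ring.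
by case: p0 => /mulfI; apply; rewrite mulr0.
Qed.

Definition hom (d : nat) (f : {poly Cplx R}) p : Cplx R :=
  \sum_(i < d.+1) f`_i * (p.1 ^+ i * p.2 ^+ (d - i)).

Lemma hom_horner d f p : (size f <= d.+1)%N -> p.2 != 0 ->
  hom d f p = p.2 ^+ d * f.[p.1 / p.2].
Proof.
move=> sf p0; rewrite (horner_coef_wide _ sf) mulr_sumr; apply: eq_bigr => i _.
rewrite [RHS]mulrCA; congr (_ * _); rewrite expr_div_n [RHS]mulrCA; congr (_ * _).
by rewrite expfB_cond// (negPf p0) add0n -ltnS.
Qed.

Lemma hom_infty d f p : p.2 = 0 -> hom d f p = f`_d * p.1 ^+ d.
Proof.
move=> p0; rewrite /hom (bigD1 ord_max)//= subnn expr0 mulr1 p0 big1 ?addr0// => i ne.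
have id : (i < d)%N.
  by rewrite ltn_neqAle -ltnS ltn_ord andbT; apply: contra ne => /eqP e; apply/eqP/val_inj.
by rewrite expr0n subn_eq0 leqNgt id /= !mulr0.
Qed.

Lemma homB d f g x y p : hom d (x *: f - y *: g) p = x * hom d f p - y * hom d g p.
Proof.
by rewrite /hom !mulr_sumr -sumrB; apply: eq_bigr => i _; rewrite coefB !coefZ; ring.
Qed.

Variable phi : ratmap R.
Hypothesis d0 : (0 < rdeg phi)%N.
Let d := rdeg phi.

Definition philift p : V := (hom d (rnum phi) p, hom d (rden phi) p).

Lemma br_philift p c : br (philift p) (hcoord c) = hom d (fibre_poly phi c) p.
Proof. by rewrite /br /= homB [_.2 * _]mulrC [_.1 * _]mulrC. Qed.

Lemma br_philift_finite z c : br (philift (z, 1)) (hcoord c) = (fibre_poly phi c).[z].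
Proof.
by rewrite br_philift hom_horner ?size_fibre_poly ?oner_eq0//= expr1n mul1r divr1.
Qed.

(** The normalization in [prod_fibre]: every copy of infinity in the fibre contributes [p, infinity]
    = - p.2, hence the sign, and the finite roots determine [fibre_poly] up to its leading
    coefficient. *)
Definition mu c : Cplx R :=
  (-1) ^+ ((rdeg phi).+1 - size (fibre_poly phi c)) / lead_coef (fibre_poly phi c).

Lemma mu_neq0 c : mu c != 0.
Proof. by rewrite mulf_neq0// ?signr_eq0// invr_eq0 lead_coef_eq0 fibre_poly_neq0. Qed.

Lemma prod_fibre p c :
  \prod_(g <- fibre phi c) br p (hcoord g) = mu c * br (philift p) (hcoord c).
Proof.
have n0 := fibre_poly_neq0 c d0; have := size_fibre_poly phi c.
rewrite br_philift /fibre /mu /Defs.roots big_cat big_map big_nseq /=.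
case: (closed_field_poly_normal (fibre_poly phi c)) => r /=.
move: n0; set f := fibre_poly phi c => n0 fE szf.
have lc0 : lead_coef f != 0 by rewrite lead_coef_eq0.
have sz : size f = (size r).+1 by rewrite fE size_scale// size_prod_XsubC.
have rd : (size r <= d)%N by rewrite -ltnS -sz.
rewrite sz subSS -/d.
have -> : \prod_(z <- r) br p (z, 1) = \prod_(z <- r) (p.1 - p.2 * z).
  by apply: eq_bigr => z _; rewrite /br /= mulr1.
have -> : iter (d - size r) ( *%R (br p (1, 0))) 1 = (-1) ^+ (d - size r) * p.2 ^+ (d - size r).
  by rewrite iter_mulr_1 -exprNn /br /= mulr0 mulr1 sub0r.
rewrite mulrCA -[RHS]mulrA; congr (_ * _).
(* At p.2 = 0 the form reduces to its coefficient of degree d, which is 0 exactly when the fibre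
   contains infinity. *)
have [p0|p0] := eqVneq p.2 0.
  rewrite hom_infty// p0 expr0n.
  have -> : f`_d = if (d - size r == 0)%N then lead_coef f else 0.
    rewrite lead_coefE sz /=; case: eqP => [/eqP|/eqP].
      by rewrite subn_eq0 => dr; congr (f`_ _); apply/eqP; rewrite eqn_leq dr rd.
    by rewrite subn_eq0 -ltnNge => lt; rewrite nth_default// sz.
  case: eqP => [/eqP|_]; last by rewrite mulr0 mul0r mulr0.
  rewrite subn_eq0 => dr; have -> : d = size r by apply/eqP; rewrite eqn_leq dr rd.
  rewrite mulr1 mulKf//; under eq_bigr do rewrite mul0r subr0.
  by rewrite big_const_seq count_predT iter_mulr_1.
rewrite hom_horner//.
have -> : f.[p.1 / p.2] = lead_coef f * \prod_(z <- r) ('X - z%:P).[p.1 / p.2].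
  by rewrite {1}fE hornerZ horner_prod.
rewrite [X in _ = _ * X]mulrCA mulKf//.
rewrite -(subnK rd) exprD -mulrA addnK [LHS]mulrC; congr (_ * _).
rewrite -[p.2 ^+ size r]iter_mulr_1 -count_predT -big_const_seq -big_split /=.
by apply: eq_bigr => z _; rewrite hornerXsubC mulrBr mulrCA divff// mulr1.
Qed.

(** If both coordinates vanished, then by [prod_fibre] the point of P1 given by p would lie in every
    fibre, so above both infinity and 0. *)
Lemma philift_neq0 p : p.1 != 0 \/ p.2 != 0 -> (philift p).1 != 0 \/ (philift p).2 != 0.
Proof.
move=> p0; have [h1|] := eqVneq (philift p).1 0; last by left.
have [h2|] := eqVneq (philift p).2 0; last by right.
have ex c : exists2 g, g \in fibre phi c & br p (hcoord g) = 0.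
  have : \prod_(g <- fibre phi c) br p (hcoord g) = 0.
    by rewrite prod_fibre /br h1 h2 !mul0r subrr mulr0.
  by move/eqP; rewrite prodf_seq_eq0 => /hasP[g gc /= /eqP]; exists g.
have [g gc g0] := ex None; have [g' gc' g0'] := ex (Some 0).
move: gc gc'; rewrite !mem_fibre// (br_eq0 p0 g0 g0') => /eqP -> /eqP.
by [].
Qed.

(** Since a lies in the fibre of its own image, the product over that fibre vanishes, which makes
    the lift proportional to the image. *)
Lemma philift_hcoord a :
  exists2 l, l != 0 & philift (hcoord a) = (l * (hcoord (rat_eval phi a)).1,
                                            l * (hcoord (rat_eval phi a)).2).
Proof.
have a0 : (hcoord a).1 != 0 \/ (hcoord a).2 != 0.
  by case: a => [z|] /=; rewrite oner_eq0; [right|left].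
have h : br (philift (hcoord a)) (hcoord (rat_eval phi a)) = 0.
  apply: (mulfI (mu_neq0 (rat_eval phi a))); rewrite -prod_fibre mulr0.
  apply/eqP; rewrite prodf_seq_eq0; apply/hasP; exists a; first by rewrite mem_fibre.
  by rewrite br_hcoord /= bracket_eq0.
have := philift_neq0 a0; move: h; case: (philift _) => x y; rewrite /br /=.
case: (rat_eval phi a) => [z|] /=; rewrite ?mulr1 ?mulr0.
- move/eqP; rewrite subr_eq0 => /eqP -> h; exists y; last by rewrite mulr1.
  by case: h => //; rewrite mulf_eq0 negb_or => /andP[].
- rewrite sub0r => /eqP; rewrite oppr_eq0 => /eqP -> h; exists x; last by rewrite mulr1 mulr0.
  by case: h => //; rewrite eqxx.
Qed.

End Lift.

(** * Logarithms of brackets *)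

Section Potential.
Variable R : realType.
Implicit Types (a b c : P1 R).

Lemma ln_cabsM (z w : Cplx R) : z != 0 -> w != 0 ->
  ln (cabs (z * w)) = ln (cabs z) + ln (cabs w).
Proof. by move=> z0 w0; rewrite cabsM lnM ?posrE ?cabs_gt0. Qed.

Lemma ln_cabs_prod (I : eqType) (s : seq I) (F : I -> Cplx R) :
  (forall i, i \in s -> F i != 0) ->
  ln (cabs (\prod_(i <- s) F i)) = \sum_(i <- s) ln (cabs (F i)).
Proof.
elim: s => [|i s IH] F0; first by rewrite !big_nil cabs1 ln1.
have F0' j : j \in s -> F j != 0 by move=> js; apply: F0; rewrite inE js orbT.
rewrite !big_cons ln_cabsM ?IH//; first by apply: F0; rewrite mem_head.
by rewrite prodf_seq_neq0; apply/allP => j /F0'.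
Qed.

Variable phi : ratmap R.
Hypothesis d0 : (0 < rdeg phi)%N.

Lemma fibre_map (c g : P1 R) : g \in fibre phi c -> rat_eval phi g = c.
Proof. by rewrite mem_fibre// => /eqP. Qed.

Lemma sum_fibre_cst c (x : R) : \sum_(g <- fibre phi c) x = (rdeg phi)%:R * x.
Proof. by rewrite big_const_seq count_predT size_fibre// iter_addr_0 mulr_natl. Qed.

(* Off the diagonal u is ln |b - c|, renormalized at each point so that its sum
   over a fibre of c is a function of phi b and c; the values on the diagonal
   are chosen so that this also holds when phi b = c. *)
Lemma potential : exists (u U : P1 R -> P1 R -> R) (f : P1 R -> R) (kappa : R),
  [/\ (forall b c, u b c = u c b),
      (forall b c, b != c -> u b c = ln (cabs (bracket b c)) + f b + f c),
      (forall b c, b != c -> U b c = ln (cabs (bracket b c)) + kappa),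
      (forall b c, \sum_(g <- fibre phi c) u b g = U (rat_eval phi b) c) &
      (forall c, \sum_(g <- fibre phi c) f g = kappa - ln (cabs (mu phi c)))].
Proof.
have dn0 : (rdeg phi)%:R != 0 :> R by rewrite pnatr_eq0 -lt0n.
have [lam Hlam] : {lam : P1 R -> Cplx R & forall a, lam a != 0 /\
    philift phi (hcoord a) = (lam a * (hcoord (rat_eval phi a)).1,
                              lam a * (hcoord (rat_eval phi a)).2)}.
  apply: (@boolp.choice _ _ (fun a l => l != 0 /\ philift phi (hcoord a) =
    (l * (hcoord (rat_eval phi a)).1, l * (hcoord (rat_eval phi a)).2))).
  by move=> a; have [l l0 e] := philift_hcoord d0 a; exists l.
(* A fibre has [rdeg phi] points, so summing f b over it cancels the term ln |lam b| of [brlift]. *)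
pose f a : R := - ln (cabs (lam a)) / (rdeg phi)%:R.
pose S c := \sum_(g <- fibre phi c) f g + ln (cabs (mu phi c)).
pose v b c := ln (cabs (bracket b c)) + f b + f c.
have bC b c : cabs (bracket b c) = cabs (bracket c b) by rewrite bracketC cabsN.
have vC b c : v b c = v c b by rewrite /v bC addrAC.
have brlift b c : br (philift phi (hcoord b)) (hcoord c) = lam b * bracket (rat_eval phi b) c.
  by rewrite (Hlam b).2 /br /bracket /=; ring.
have sumv b c : rat_eval phi b != c ->
    \sum_(g <- fibre phi c) v b g = ln (cabs (bracket (rat_eval phi b) c)) + S c.
  move=> bc; have gb g : g \in fibre phi c -> br (hcoord b) (hcoord g) != 0.
    by move=> gc; rewrite br_hcoord bracket_eq0; apply: contraNneq bc => ->; rewrite (fibre_map gc).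
  rewrite big_split big_split /= sum_fibre_cst -(ln_cabs_prod gb) prod_fibre// brlift.
  have b0 : bracket (rat_eval phi b) c != 0 by rewrite bracket_eq0.
  have [l0 m0] := ((Hlam b).1, mu_neq0 d0 c).
  rewrite (ln_cabsM m0 (mulf_neq0 l0 b0)) (ln_cabsM l0 b0) /S /f.
  by field.
(* The double sum of the symmetric v over two fibres is evaluated in both orders. *)
have SE b c : b != c -> S b = S c.
  move=> bc; have e1 : \sum_(x <- fibre phi b) \sum_(y <- fibre phi c) v x y =
      (rdeg phi)%:R * (ln (cabs (bracket b c)) + S c).
    rewrite -(sum_fibre_cst b); apply: eq_big_seq => x /fibre_map xb.
    by rewrite sumv xb.
  have e2 : \sum_(x <- fibre phi b) \sum_(y <- fibre phi c) v x y =
      (rdeg phi)%:R * (ln (cabs (bracket c b)) + S b).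
    rewrite exchange_big -(sum_fibre_cst c); apply: eq_big_seq => x /fibre_map xc.
    by under eq_bigr do rewrite vC; rewrite sumv xc// eq_sym.
  have /(mulfI dn0) := etrans (esym e1) e2.
  by rewrite bC => /addrI ->.
pose kappa := S None.
have SK c : S c = kappa by case: (eqVneq c None) => [->|/SE].
(* The denominator is the multiplicity of b in its own fibre; this choice makes the whole sum 0, the
   value given to U on the diagonal. *)
pose u b c := if b == c then - (\sum_(g <- fibre phi (rat_eval phi b) | g != b) v b g) /
  (count_mem b (fibre phi (rat_eval phi b)))%:R else v b c.
exists u, (fun b c => if b == c then 0 else ln (cabs (bracket b c)) + kappa), f, kappa.
split.
- by move=> b c; rewrite /u eq_sym; case: eqVneq => [->|] //; rewrite vC.
- by move=> b c bc; rewrite /u (negPf bc).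
- by move=> b c bc; rewrite (negPf bc).
- move=> b c; case: (eqVneq (rat_eval phi b) c) => bc; last first.
    rewrite -(SK c) -sumv//; apply: eq_big_seq => g /fibre_map gc.
    by rewrite /u; case: eqVneq => // bg; move: bc; rewrite bg gc eqxx.
  rewrite (bigID (fun g => g == b)) /=.
  have -> : \sum_(g <- fibre phi c | g == b) u b g =
      (count_mem b (fibre phi c))%:R * u b b.
    rewrite (eq_bigr (fun=> u b b)); last by move=> g /eqP ->.
    by rewrite big_const_seq iter_addr_0 mulr_natl.
  have n0 : (count_mem b (fibre phi c))%:R != 0 :> R.
    by rewrite pnatr_eq0 -lt0n -has_count has_pred1 mem_fibre// bc.
  rewrite {1}/u eqxx bc mulrC divfK// addrC; apply/eqP; rewrite subr_eq0; apply/eqP.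
  by apply: eq_bigr => g gb; rewrite /u eq_sym (negPf gb).
- by move=> c; rewrite -(SK c) /S addrK.
Qed.

End Potential.

(** * Cross ratios with a moving point *)

Section Terms.
Variable R : realType.
Implicit Types (b c d : P1 R) (t s : R).

(* The derivatives of L_3 and of the Bloch-Wigner dilogarithm at a cross ratio of
   a moving point p and fixed points b, c, d, as polynomials in the logarithms
   u.. of the brackets and the logarithmic derivatives o. of the brackets of p. *)
Definition L3_form (ub uc ud ubc ubd ucd ob oc od : R) : R :=
  (uc + ubd - ud - ubc) * ((ub + ucd - ud - ubc) * (oc - od)
    - (uc + ubd - ud - ubc) * (ob - od)).

Definition Dil_form (ub uc ud ubc ubd ucd ob oc od : R) : R :=
  (uc + ubd - ud - ubc) * (ob - od) - (ub + ucd - ud - ubc) * (oc - od).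

(* For c = d the cross ratio is 1, except that it is 0 / 0 at p = c. *)
Definition L3_pt (p : Cplx R * Cplx R) b c d : R :=
  if c == d then Lp3 1
  else L3h (br p (hcoord c) * bracket b d) (br p (hcoord d) * bracket b c).

Definition Dil_pt (p : Cplx R * Cplx R) b c d : R :=
  Dilh (br p (hcoord c) * bracket b d) (br p (hcoord d) * bracket b c).

(** A triple with a repetition needs no condition, as its functions of p are constant. For the
    others the cross ratio must be off the unit circle. *)
Definition good_pt (p : Cplx R * Cplx R) b c d : bool :=
  [|| b == c, b == d, c == d | cabs (br p (hcoord c) * bracket b d) !=
                               cabs (br p (hcoord d) * bracket b c)].

Lemma bracketxx b : bracket b b = 0.
Proof. by apply/eqP; rewrite bracket_eq0. Qed.

Lemma L3h0r (z : Cplx R) : L3h z 0 = 0. Proof. by rewrite /L3h disk_pt0r Lp3_0. Qed.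
Lemma L3h0l (z : Cplx R) : L3h 0 z = 0. Proof. by rewrite /L3h disk_pt0l Lp3_0. Qed.
Lemma Dilh0r (z : Cplx R) : Dilh z 0 = 0. Proof. by rewrite /Dilh disk_pt0r Dil_0. Qed.
Lemma Dilh0l (z : Cplx R) : Dilh 0 z = 0. Proof. by rewrite /Dilh disk_pt0l Dil_0. Qed.

Lemma Dilhxx (z : Cplx R) : Dilh z z = 0.
Proof. by have := DilhC z z; lra. Qed.

Lemma Dil_ptbb p b d : Dil_pt p b b d = 0.
Proof. by rewrite /Dil_pt bracketxx mulr0 Dilh0r. Qed.

Lemma Dil_ptbcb p b c : Dil_pt p b c b = 0.
Proof. by rewrite /Dil_pt bracketxx mulr0 Dilh0l. Qed.

Lemma Dil_ptcc p b c : Dil_pt p b c c = 0.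
Proof. exact: Dilhxx. Qed.

Lemma Dil_ptC p b c d : Dil_pt p b d c = - Dil_pt p b c d.
Proof. exact: DilhC. Qed.

Lemma L3_ptbb p b d : b != d -> L3_pt p b b d = 0.
Proof. by move=> bd; rewrite /L3_pt (negPf bd) bracketxx mulr0 L3h0r. Qed.

Lemma L3_ptbcb p b c : b != c -> L3_pt p b c b = 0.
Proof. by move=> bc; rewrite /L3_pt eq_sym (negPf bc) bracketxx mulr0 L3h0l. Qed.

Section Frame.
Variables (p : R -> Cplx R * Cplx R) (om : P1 R -> Cplx R) (t : R).
Variables (u : P1 R -> P1 R -> R) (v f : P1 R -> R) (g : R).
Hypothesis uC : forall b c, u b c = u c b.
Hypothesis uE : forall b c, b != c -> u b c = ln (cabs (bracket b c)) + f b + f c.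

(* The values u b b are arbitrary: when two of the points b, c, d coincide, both
   sides vanish whatever these values are. *)
Lemma is_derive_pt b c d :
  (forall e, e \in [:: b; c; d] -> v e = ln (cabs (br (p t) (hcoord e))) + f e + g) ->
  (forall e, e \in [:: b; c; d] -> br (p t) (hcoord e) != 0) ->
  (forall e, e \in [:: b; c; d] ->
    cderiv (fun s => br (p s) (hcoord e)) t (br (p t) (hcoord e) * om e)) ->
  good_pt (p t) b c d ->
  is_derive t 1 (fun s => L3_pt (p s) b c d)
    (- Dil_pt (p t) b c d * (Im (om c) - Im (om d)) +
     L3_form (v b) (v c) (v d) (u b c) (u b d) (u c d)
       (Re (om b)) (Re (om c)) (Re (om d)) / 3) /\
  is_derive t 1 (fun s => Dil_pt (p s) b c d)
    (Dil_form (v b) (v c) (v d) (u b c) (u b d) (u c d)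
       (Im (om b)) (Im (om c)) (Im (om d))).
Proof.
move=> vE N0 dN; have [->|bc] := eqVneq b c.
  move=> _; split.
    have -> : (fun s => L3_pt (p s) c c d) = (fun=> if c == d then Lp3 1 else 0).
      by apply/funext => s; case: eqVneq => [->|cd]; [rewrite /L3_pt eqxx|exact: L3_ptbb].
    apply: is_derive_eq (is_derive_cst _ _ _) _; rewrite Dil_ptbb /L3_form.
    move: (Im _) (Im _) (Re _) (Re _) => *; ring.
  have -> : (fun s => Dil_pt (p s) c c d) = (fun=> 0).
    by apply/funext => s; exact: Dil_ptbb.
  apply: is_derive_eq (is_derive_cst _ _ _) _; rewrite /Dil_form.
  move: (Im _) (Im _) => *; ring.
have [->|bd] := eqVneq b d.
  move=> _; split.
    have -> : (fun s => L3_pt (p s) d c d) = (fun=> if c == d then Lp3 1 else 0).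
      apply/funext => s; case: eqVneq => [->|cd]; first by rewrite /L3_pt eqxx.
      by apply: L3_ptbcb; rewrite eq_sym.
    apply: is_derive_eq (is_derive_cst _ _ _) _; rewrite Dil_ptbcb /L3_form (uC d c).
    move: (Im _) (Im _) (Re _) (Re _) => *; ring.
  have -> : (fun s => Dil_pt (p s) d c d) = (fun=> 0).
    by apply/funext => s; exact: Dil_ptbcb.
  apply: is_derive_eq (is_derive_cst _ _ _) _; rewrite /Dil_form (uC d c).
  move: (Im _) (Im _) => *; ring.
have [->|cd] := eqVneq c d.
  move=> _; split.
    have -> : (fun s => L3_pt (p s) b d d) = (fun=> Lp3 1).
      by apply/funext => s; rewrite /L3_pt eqxx.
    apply: is_derive_eq (is_derive_cst _ _ _) _; rewrite Dil_ptcc /L3_form.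
    move: (Im _) (Re _) (Re _) => *; ring.
  have -> : (fun s => Dil_pt (p s) b d d) = (fun=> 0).
    by apply/funext => s; exact: Dil_ptcc.
  apply: is_derive_eq (is_derive_cst _ _ _) _; rewrite /Dil_form.
  move: (Im _) (Im _) => *; ring.
rewrite /good_pt (negPf bc) (negPf bd) (negPf cd) /= => good.
have Nb := N0 b; have Nc := N0 c; have Nd := N0 d.
have vb := vE b; have vc := vE c; have vd := vE d.
have db := dN b; have dc := dN c; have dd := dN d.
rewrite !inE !eqxx ?orbT in Nb Nc Nd db dc dd vb vc vd.
have {}vb := vb isT; have {}vc := vc isT; have {}vd := vd isT.
have {}Nb := Nb isT; have {}Nc := Nc isT; have {}Nd := Nd isT.
have {}db := db isT; have {}dc := dc isT; have {}dd := dd isT.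
have bc0 : bracket b c != 0 by rewrite bracket_eq0.
have bd0 : bracket b d != 0 by rewrite bracket_eq0.
have dc0 : bracket d c != 0 by rewrite bracket_eq0 eq_sym.
pose n s := br (p s) (hcoord c) * bracket b d.
pose m s := br (p s) (hcoord d) * bracket b c.
have kE s : m s - n s = br (p s) (hcoord b) * bracket d c.
  by rewrite /n /m -!br_hcoord br_plucker.
have dn : cderiv n t (n t * om c).
  apply: cderiv_eq (cderivM dc (cderiv_cst (bracket b d) t)) _.
  by rewrite mulr0 addr0 /n mulrAC.
have dm : cderiv m t (m t * om d).
  apply: cderiv_eq (cderivM dd (cderiv_cst (bracket b c) t)) _.
  by rewrite mulr0 addr0 /m mulrAC.
(* The derivative of m - n is computed from the difference and from the product [kE]; this
   identifies eta with om b - om d. *)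
have kd : m t * om d - n t * om c = (m t - n t) * om b.
  have dk : cderiv (fun s => m s - n s) t ((m t - n t) * om b).
    rewrite kE; under eq_fun do rewrite kE.
    apply: cderiv_eq (cderivM db (cderiv_cst (bracket d c) t)) _.
    by rewrite mulr0 addr0 mulrAC.
  have [h1 h2] := cderivB dm dn; have [h3 h4] := dk.
  have uniq (F : R -> R) x y : is_derive t 1 F x -> is_derive t 1 F y -> x = y.
    by move=> [_ <-] [_ <-].
  by apply: eq_ReIm; [apply: uniq h1 h3|apply: uniq h2 h4].
have n0 : n t != 0 by rewrite mulf_neq0.
have m0 : m t != 0 by rewrite mulf_neq0.
have k0 : m t - n t != 0 by rewrite kE mulf_neq0.
have := is_derive_homogeneous dn dm n0 m0 k0 good.
rewrite /= kd !(mulrC (_ - _) (om b)) !(mulrC (n t)) !(mulrC (m t)) !mulfK//.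
rewrite kE /n /m (ln_cabsM Nc bd0) (ln_cabsM Nd bc0) (ln_cabsM Nb dc0).
rewrite !ReB !ImB => -[h1 h2].
have lnc : ln (cabs (bracket d c)) = ln (cabs (bracket c d)).
  by rewrite [bracket d c]bracketC cabsN.
(* The corrections f and g cancel, here and in [eb], because each point has total weight zero. *)
have ea : v c + u b d - v d - u b c = ln (cabs (br (p t) (hcoord c))) +
   ln (cabs (bracket b d)) - (ln (cabs (br (p t) (hcoord d))) + ln (cabs (bracket b c))).
  by rewrite !uE// vc vd; ring.
have eb : v b + u c d - v d - u b c = ln (cabs (br (p t) (hcoord b))) +
   ln (cabs (bracket d c)) - (ln (cabs (br (p t) (hcoord d))) + ln (cabs (bracket b c))).
  by rewrite lnc !uE// vb vd; ring.
rewrite /L3_form /Dil_form ea eb; split; last exact: h2.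
by under eq_fun do rewrite /L3_pt (negPf cd); exact: h1.
Qed.

End Frame.
End Terms.

(** * Sums over fibres *)

Section FormalSums.
Variable R : realType.
Variable phi : ratmap R.
Hypothesis d0 : (0 < rdeg phi)%N.
Implicit Types b c d : P1 R.

Definition ts b c d (F : P1 R -> P1 R -> P1 R -> R) : R :=
  \sum_(x <- fibre phi b) \sum_(y <- fibre phi c) \sum_(z <- fibre phi d) F x y z.

Lemma ts12 b c d F : ts b c d F = ts c b d (fun y x z => F x y z).
Proof. exact: exchange_big. Qed.

Lemma ts23 b c d F : ts b c d F = ts b d c (fun x z y => F x y z).
Proof. by apply: eq_bigr => x _; exact: exchange_big. Qed.

Lemma tsD b c d F G : ts b c d (fun x y z => F x y z + G x y z) = ts b c d F + ts b c d G.
Proof.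
rewrite /ts -big_split; apply: eq_bigr => x _; rewrite -big_split.
by apply: eq_bigr => y _; rewrite -big_split.
Qed.

Lemma tsZ b c d (k : R) F : ts b c d (fun x y z => k * F x y z) = k * ts b c d F.
Proof.
rewrite /ts mulr_sumr; apply: eq_bigr => x _; rewrite mulr_sumr.
by apply: eq_bigr => y _; rewrite mulr_sumr.
Qed.

Lemma ts_cst1 b c d (K : P1 R -> P1 R -> R) : ts b c d (fun _ y z => K y z) =
  (rdeg phi)%:R * \sum_(y <- fibre phi c) \sum_(z <- fibre phi d) K y z.
Proof. by rewrite /ts sum_fibre_cst. Qed.

Lemma ts_cst2 b c d (K : P1 R -> P1 R -> R) : ts b c d (fun x _ z => K x z) =
  (rdeg phi)%:R * \sum_(x <- fibre phi b) \sum_(z <- fibre phi d) K x z.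
Proof. by rewrite ts12 ts_cst1. Qed.

Lemma ts_cst3 b c d (K : P1 R -> P1 R -> R) : ts b c d (fun x y _ => K x y) =
  (rdeg phi)%:R * \sum_(x <- fibre phi b) \sum_(y <- fibre phi c) K x y.
Proof. by rewrite ts23 ts_cst2. Qed.

Variables u U : P1 R -> P1 R -> R.
Hypotheses (uC : forall b c, u b c = u c b) (UC : forall b c, U b c = U c b).
Hypothesis Hu : forall b c, \sum_(g <- fibre phi c) u b g = U (rat_eval phi b) c.

Lemma sum_fibre_u (k : R) b c x : x \in fibre phi b ->
  \sum_(y <- fibre phi c) k * u x y = k * U b c.
Proof. by move=> xb; rewrite -mulr_sumr Hu (fibre_map d0 xb). Qed.

Section Trees.
Variables (f g h F G H : P1 R -> R).
Hypothesis Hf : forall c, \sum_(x <- fibre phi c) f x = F c.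
Hypothesis Hg : forall c, \sum_(x <- fibre phi c) g x = G c.
Hypothesis Hh : forall c, \sum_(x <- fibre phi c) h x = H c.

(** The first of four shapes of trees rooted at p: f, g and h weigh the edges at the root, u the
    other ones. Here all three points are attached to the root. *)
Lemma ts_star b c d E : (forall x y z, E x y z = f x * g y * h z) ->
  ts b c d E = F b * G c * H d.
Proof.
move=> EE; rewrite -Hf -Hg -Hh /ts !mulr_suml; apply: eq_bigr => x _.
rewrite [f x * _]mulr_sumr mulr_suml; apply: eq_bigr => y _; rewrite mulr_sumr.
by apply: eq_bigr => z _.
Qed.

(** The leaf z is summed first: by [Hu] it turns u y z into U c d, which no longer depends on the
    choice of y in its fibre. *)
Lemma ts_two b c d E : (forall x y z, E x y z = f x * g y * u y z) ->
  ts b c d E = F b * G c * U c d.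
Proof.
move=> EE; rewrite -Hf -Hg /ts !mulr_suml; apply: eq_bigr => x _.
rewrite [f x * _]mulr_sumr mulr_suml; apply: eq_big_seq => y yc.
by under eq_bigr do rewrite EE; rewrite (sum_fibre_u _ _ yc).
Qed.

Lemma ts_path b c d E : (forall x y z, E x y z = f x * u x y * u y z) ->
  ts b c d E = F b * U b c * U c d.
Proof.
move=> EE; rewrite -Hf /ts !mulr_suml; apply: eq_big_seq => x xb.
rewrite -(sum_fibre_u (f x) c xb) mulr_suml; apply: eq_big_seq => y yc.
by under eq_bigr do rewrite EE; rewrite (sum_fibre_u _ _ yc).
Qed.

Lemma ts_fork b c d E : (forall x y z, E x y z = f x * u x y * u x z) ->
  ts b c d E = F b * U b c * U b d.
Proof.
move=> EE; rewrite -Hf /ts !mulr_suml; apply: eq_big_seq => x xb.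
rewrite -(sum_fibre_u (f x) c xb) mulr_suml; apply: eq_bigr => y _.
by under eq_bigr do rewrite EE; rewrite (sum_fibre_u _ _ xb).
Qed.

End Trees.

Variables v o V O : P1 R -> R.
Hypothesis Hv : forall c, \sum_(x <- fibre phi c) v x = V c.
Hypothesis Ho : forall c, \sum_(x <- fibre phi c) o x = O c.

(* A monomial of L3_form that involves all three points is a spanning tree of
   the complete graph on p, x, y, z, rooted at p: it is summed over the fibres
   leaf by leaf. The others only contribute terms independent of b, c or d. *)
Lemma sum_L3_form : exists k1 k2 k3 : P1 R -> P1 R -> R, forall b c d,
  ts b c d (fun x y z => L3_form (v x) (v y) (v z) (u x y) (u x z) (u y z) (o x) (o y) (o z)) =
  L3_form (V b) (V c) (V d) (U b c) (U b d) (U c d) (O b) (O c) (O d)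
  + (k1 c d + k2 b d + k3 b c).
Proof.
(* K1, K2 and K3 collect the monomials of [L3_form] without x, y and z respectively; L1, L2 and L3
   are their counterparts in the form for b, c, d and have to be subtracted. *)
pose K1 y z := o y * v y * u y z - o y * v y * v z - o y * u y z * v z + o y * v z * v z
    + o z * v y * v y - o z * v y * u y z - o z * v y * v z + o z * u y z * v z.
pose K2 x z := - (o x * u x z * u x z) + 2 * (o x * u x z * v z) - o x * v z * v z
    - o z * v x * u x z + o z * v x * v z + o z * u x z * u x z - o z * u x z * v z.
pose K3 x y := - (o x * u x y * u x y) + 2 * (o x * u x y * v y) - o x * v y * v y
    - o y * v x * u x y + o y * v x * v y + o y * u x y * u x y - o y * u x y * v y.
pose L1 c d : R := O c * V c * U c d - O c * V c * V d - O c * U c d * V d + O c * V d * V d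
    + O d * V c * V c - O d * V c * U c d - O d * V c * V d + O d * U c d * V d.
pose L2 b d := - (O b * U b d * U b d) + 2 * (O b * U b d * V d) - O b * V d * V d
    - O d * V b * U b d + O d * V b * V d + O d * U b d * U b d - O d * U b d * V d.
pose L3 b c := - (O b * U b c * U b c) + 2 * (O b * U b c * V c) - O b * V c * V c
    - O c * V b * U b c + O c * V b * V c + O c * U b c * U b c - O c * U b c * V c.
exists (fun c d => (rdeg phi)%:R * (\sum_(y <- fibre phi c) \sum_(z <- fibre phi d) K1 y z)
  - L1 c d).
exists (fun b d => (rdeg phi)%:R * (\sum_(x <- fibre phi b) \sum_(z <- fibre phi d) K2 x z)
  - L2 b d).
exists (fun b c => (rdeg phi)%:R * (\sum_(x <- fibre phi b) \sum_(y <- fibre phi c) K3 x y)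
  - L3 b c).
move=> b c d.
(* In T0 to T17, exchanges of summations bring each tree into one of the four shapes. *)
have T0 : ts b c d (fun x y z => o x * u x y * u x z) = O b * U b c * U b d.
  rewrite (ts_fork Ho);
    last by move=> x y z; rewrite ?(uC y x) ?(uC z x) ?(uC z y); ring.
  by rewrite ?(UC c b) ?(UC d b) ?(UC d c); ring.
have T1 : ts b c d (fun x y z => o x * u x y * v z) = O b * U b c * V d.
  rewrite ts23 ts12 (ts_two Hv Ho);
    last by move=> z x y; rewrite ?(uC y x) ?(uC z x) ?(uC z y); ring.
  by rewrite ?(UC c b) ?(UC d b) ?(UC d c); ring.
have T2 : ts b c d (fun x y z => o x * u x z * v y) = O b * U b d * V c.
  rewrite ts12 (ts_two Hv Ho);
    last by move=> y x z; rewrite ?(uC y x) ?(uC z x) ?(uC z y); ring.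
  by rewrite ?(UC c b) ?(UC d b) ?(UC d c); ring.
have T3 : ts b c d (fun x y z => o x * v y * v z) = O b * V c * V d.
  rewrite (ts_star Ho Hv Hv);
    last by move=> x y z; rewrite ?(uC y x) ?(uC z x) ?(uC z y); ring.
  by rewrite ?(UC c b) ?(UC d b) ?(UC d c); ring.
have T4 : ts b c d (fun x y z => o y * v x * u x z) = O c * V b * U b d.
  rewrite ts12 (ts_two Ho Hv);
    last by move=> y x z; rewrite ?(uC y x) ?(uC z x) ?(uC z y); ring.
  by rewrite ?(UC c b) ?(UC d b) ?(UC d c); ring.
have T5 : ts b c d (fun x y z => o y * v x * v z) = O c * V b * V d.
  rewrite ts12 (ts_star Ho Hv Hv);
    last by move=> y x z; rewrite ?(uC y x) ?(uC z x) ?(uC z y); ring.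
  by rewrite ?(UC c b) ?(UC d b) ?(UC d c); ring.
have T6 : ts b c d (fun x y z => o y * u x y * u x z) = O c * U b c * U b d.
  rewrite ts12 (ts_path Ho);
    last by move=> y x z; rewrite ?(uC y x) ?(uC z x) ?(uC z y); ring.
  by rewrite ?(UC c b) ?(UC d b) ?(UC d c); ring.
have T7 : ts b c d (fun x y z => o y * u x y * u y z) = O c * U b c * U c d.
  rewrite ts12 (ts_fork Ho);
    last by move=> y x z; rewrite ?(uC y x) ?(uC z x) ?(uC z y); ring.
  by rewrite ?(UC c b) ?(UC d b) ?(UC d c); ring.
have T8 : ts b c d (fun x y z => o y * u x y * v z) = O c * U b c * V d.
  rewrite ts23 ts12 ts23 (ts_two Hv Ho);
    last by move=> z y x; rewrite ?(uC y x) ?(uC z x) ?(uC z y); ring.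
  by rewrite ?(UC c b) ?(UC d b) ?(UC d c); ring.
have T9 : ts b c d (fun x y z => o y * u x z * u y z) = O c * U b d * U c d.
  rewrite ts12 ts23 (ts_path Ho);
    last by move=> y z x; rewrite ?(uC y x) ?(uC z x) ?(uC z y); ring.
  by rewrite ?(UC c b) ?(UC d b) ?(UC d c); ring.
have T10 : ts b c d (fun x y z => o y * u x z * v z) = O c * U b d * V d.
  rewrite ts12 ts23 (ts_two Ho Hv);
    last by move=> y z x; rewrite ?(uC y x) ?(uC z x) ?(uC z y); ring.
  by rewrite ?(UC c b) ?(UC d b) ?(UC d c); ring.
have T11 : ts b c d (fun x y z => o z * v x * u x y) = O d * V b * U b c.
  rewrite ts23 ts12 (ts_two Ho Hv);
    last by move=> z x y; rewrite ?(uC y x) ?(uC z x) ?(uC z y); ring.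
  by rewrite ?(UC c b) ?(UC d b) ?(UC d c); ring.
have T12 : ts b c d (fun x y z => o z * v x * v y) = O d * V b * V c.
  rewrite ts23 ts12 (ts_star Ho Hv Hv);
    last by move=> z x y; rewrite ?(uC y x) ?(uC z x) ?(uC z y); ring.
  by rewrite ?(UC c b) ?(UC d b) ?(UC d c); ring.
have T13 : ts b c d (fun x y z => o z * u x y * u x z) = O d * U b c * U b d.
  rewrite ts23 ts12 (ts_path Ho);
    last by move=> z x y; rewrite ?(uC y x) ?(uC z x) ?(uC z y); ring.
  by rewrite ?(UC c b) ?(UC d b) ?(UC d c); ring.
have T14 : ts b c d (fun x y z => o z * u x y * v y) = O d * U b c * V c.
  rewrite ts23 ts12 ts23 (ts_two Ho Hv);
    last by move=> z y x; rewrite ?(uC y x) ?(uC z x) ?(uC z y); ring.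
  by rewrite ?(UC c b) ?(UC d b) ?(UC d c); ring.
have T15 : ts b c d (fun x y z => o z * u x y * u y z) = O d * U b c * U c d.
  rewrite ts23 ts12 ts23 (ts_path Ho);
    last by move=> z y x; rewrite ?(uC y x) ?(uC z x) ?(uC z y); ring.
  by rewrite ?(UC c b) ?(UC d b) ?(UC d c); ring.
have T16 : ts b c d (fun x y z => o z * u x z * v y) = O d * U b d * V c.
  rewrite ts12 ts23 (ts_two Hv Ho);
    last by move=> y z x; rewrite ?(uC y x) ?(uC z x) ?(uC z y); ring.
  by rewrite ?(UC c b) ?(UC d b) ?(UC d c); ring.
have T17 : ts b c d (fun x y z => o z * u x z * u y z) = O d * U b d * U c d.
  rewrite ts23 ts12 (ts_fork Ho);
    last by move=> z x y; rewrite ?(uC y x) ?(uC z x) ?(uC z y); ring.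
  by rewrite ?(UC c b) ?(UC d b) ?(UC d c); ring.
have -> : (fun x y z => L3_form (v x) (v y) (v z) (u x y) (u x z) (u y z) (o x) (o y) (o z)) =
  (fun x y z => 2 * (o x * u x y * u x z)
      + (-2) * (o x * u x y * v z)
      + (-2) * (o x * u x z * v y)
      + 2 * (o x * v y * v z)
      + 1 * (o y * v x * u x z)
      + (-1) * (o y * v x * v z)
      + (-1) * (o y * u x y * u x z)
      + (-1) * (o y * u x y * u y z)
      + 2 * (o y * u x y * v z)
      + 1 * (o y * u x z * u y z)
      + (-1) * (o y * u x z * v z)
      + 1 * (o z * v x * u x y)
      + (-1) * (o z * v x * v y)
      + (-1) * (o z * u x y * u x z)
      + (-1) * (o z * u x y * v y)
      + 1 * (o z * u x y * u y z)
      + 2 * (o z * u x z * v y)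
      + (-1) * (o z * u x z * u y z)
      + (K1 y z + K2 x z + K3 x y)).
  by apply/funext => x; apply/funext => y; apply/funext => z; rewrite /L3_form /K1 /K2 /K3; ring.
clearbody K1 K2 K3; rewrite !tsD ts_cst1 ts_cst2 ts_cst3 !tsZ
  T0 T1 T2 T3 T4 T5 T6 T7 T8 T9 T10 T11 T12 T13 T14 T15 T16 T17.
rewrite /L3_form /L1 /L2 /L3.
ring.
Qed.

(** The monomials that join x and z through q cancel, so those involving both x and z are free of q,
    which can stay fixed. All terms in q or c go into k1 and k2. *)
Lemma sum_Dil_form q c : exists k1 k2 : P1 R -> R, forall b d,
  \sum_(x <- fibre phi b) \sum_(z <- fibre phi d)
    Dil_form (v x) (v q) (v z) (u x q) (u x z) (u q z) (o x) (o q) (o z) =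
  Dil_form (V b) (V c) (V d) (U b c) (U b d) (U c d) (O b) (O c) (O d) + (k1 b + k2 d).
Proof.
pose K1 x := v q * o x - u x q * o x - v x * o q + u x q * o q.
pose K2 z := - (v q * o z) + v z * o z - u q z * o q + u q z * o z + v z * o q - v z * o z.
pose L1 b := V c * O b - U b c * O b - V b * O c + U b c * O c.
pose L2 d := - (V c * O d) + V d * O d - U c d * O c + U c d * O d + V d * O c - V d * O d.
exists (fun b => (rdeg phi)%:R * (\sum_(x <- fibre phi b) K1 x) - L1 b).
exists (fun d => (rdeg phi)%:R * (\sum_(z <- fibre phi d) K2 z) - L2 d).
move=> b d.
have T1 : \sum_(x <- fibre phi b) \sum_(z <- fibre phi d) o x * u x z = O b * U b d.
  rewrite -Ho mulr_suml; apply: eq_big_seq => x xb; exact: sum_fibre_u.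
have T2 : \sum_(x <- fibre phi b) \sum_(z <- fibre phi d) o z * u x z = O d * U b d.
  rewrite exchange_big -Ho mulr_suml UC; apply: eq_big_seq => z zd.
  by under eq_bigr do rewrite uC; exact: sum_fibre_u.
have T3 : \sum_(x <- fibre phi b) \sum_(z <- fibre phi d) o x * v z = O b * V d.
  by rewrite -Ho -Hv mulr_suml; apply: eq_bigr => x _; rewrite mulr_sumr.
have T4 : \sum_(x <- fibre phi b) \sum_(z <- fibre phi d) v x * o z = V b * O d.
  by rewrite -Ho -Hv mulr_suml; apply: eq_bigr => x _; rewrite mulr_sumr.
have T5 : \sum_(x <- fibre phi b) \sum_(z <- fibre phi d) K1 x =
    (rdeg phi)%:R * \sum_(x <- fibre phi b) K1 x.
  by rewrite mulr_sumr; apply: eq_bigr => x _; rewrite sum_fibre_cst.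
have T6 : \sum_(x <- fibre phi b) \sum_(z <- fibre phi d) K2 z =
    (rdeg phi)%:R * \sum_(z <- fibre phi d) K2 z.
  by rewrite sum_fibre_cst.
transitivity (\sum_(x <- fibre phi b) \sum_(z <- fibre phi d)
    (o x * u x z - o z * u x z - o x * v z + v x * o z + K1 x + K2 z)).
  apply: eq_bigr => x _; apply: eq_bigr => z _; rewrite /Dil_form /K1 /K2; ring.
clearbody K1 K2.
under eq_bigr do rewrite !big_split !sumrN /=.
rewrite !big_split !sumrN /= T1 T2 T3 T4 T5 T6 /Dil_form /L1 /L2; ring.
Qed.

End FormalSums.

(** * Paths avoiding the degenerate configurations *)

Section Motion.
Variable R : realType.
Variable phi : ratmap R.
Hypothesis d0 : (0 < rdeg phi)%N.
Implicit Types (b c d : P1 R) (t s : R) (z : {poly Cplx R}).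

Lemma cderiv_prod (I : eqType) (r : seq I) (F : I -> R -> Cplx R) (o : I -> Cplx R) t :
  (forall i, i \in r -> cderiv (F i) t (F i t * o i)) ->
  cderiv (fun s => \prod_(i <- r) F i s) t ((\prod_(i <- r) F i t) * \sum_(i <- r) o i).
Proof.
elim: r => [|i r IH] dF.
  under eq_fun do rewrite big_nil; rewrite !big_nil mulr0; exact: cderiv_cst.
under eq_fun do rewrite big_cons; rewrite !big_cons.
apply: cderiv_eq (cderivM (dF i (mem_head _ _)) (IH _)) _.
  by move=> j jr; apply: dF; rewrite inE jr orbT.
by rewrite mulrDr mulrAC mulrA.
Qed.

Definition path_pt z s : Cplx R * Cplx R := (z.[s%:C], 1).

Definition dlog_up z t c : Cplx R :=
  z^`().[t%:C] * (hcoord c).2 / br (path_pt z t) (hcoord c).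

(** By [prod_fibre] this is the logarithmic derivative of [phi(p), c] where that bracket is
    nonzero. *)
Definition dlog_down z t c : Cplx R := \sum_(g <- fibre phi c) dlog_up z t g.

Lemma cderiv_up z t c : br (path_pt z t) (hcoord c) != 0 ->
  cderiv (fun s => br (path_pt z s) (hcoord c)) t
    (br (path_pt z t) (hcoord c) * dlog_up z t c).
Proof.
move=> n0; rewrite /dlog_up mulrC divfK// /br /=.
apply: cderiv_eq (cderivB (cderivM (cderiv_horner z t) (cderiv_cst (hcoord c).2 t))
  (cderiv_cst (1 * (hcoord c).1) t)) _.
by rewrite mulr0 addr0 subr0.
Qed.

Lemma br_fibre_neq0 p c : br (philift phi p) (hcoord c) != 0 ->
  forall g, g \in fibre phi c -> br p (hcoord g) != 0.
Proof.
move=> n0 g gc; apply: contraNneq n0 => g0.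
apply/eqP; apply: (mulfI (mu_neq0 d0 c)); rewrite mulr0 -prod_fibre//.
by apply/eqP; rewrite prodf_seq_eq0; apply/hasP; exists g; rewrite //= g0.
Qed.

Lemma cderiv_down z t c : br (philift phi (path_pt z t)) (hcoord c) != 0 ->
  cderiv (fun s => br (philift phi (path_pt z s)) (hcoord c)) t
    (br (philift phi (path_pt z t)) (hcoord c) * dlog_down z t c).
Proof.
move=> n0; have m0 := mu_neq0 d0 c.
have E s : br (philift phi (path_pt z s)) (hcoord c) =
    (mu phi c)^-1 * \prod_(g <- fibre phi c) br (path_pt z s) (hcoord g).
  by rewrite prod_fibre// mulKf.
rewrite E; under eq_fun do rewrite E.
have dP := @cderiv_prod _ (fibre phi c) (fun g s => br (path_pt z s) (hcoord g))
  (dlog_up z t) t (fun g gc => cderiv_up (br_fibre_neq0 n0 gc)).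
apply: cderiv_eq (cderivM (cderiv_cst (mu phi c)^-1 t) dP) _.
by rewrite mul0r add0r mulrA.
Qed.

Section Obstacles.
Variable Q : seq (P1 R).
Let P : seq (P1 R) := flatten [seq fibre phi c | c <- Q].

Definition lin_poly c : {poly Cplx R} := (hcoord c).2 *: 'X - (hcoord c).1%:P.

Lemma horner_lin_poly c (w : Cplx R) : (lin_poly c).[w] = br (w, 1) (hcoord c).
Proof. by rewrite /lin_poly !hornerE /br /= mul1r mulrC. Qed.

(** Numerator and denominator of the cross ratio as polynomials in the moving point. Degenerate
    triples get (1, 0), which is admissible everywhere. *)
Definition obstacle (F : P1 R -> {poly Cplx R}) (x : P1 R * P1 R * P1 R) :
    {poly Cplx R} * {poly Cplx R} :=
  let: (b, c, d) := x in
  if [|| b == c, b == d | c == d] then (1, 0)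
  else (bracket b d *: F c, bracket b c *: F d).

Lemma admissible10 (w : Cplx R) : admissible (1 : {poly Cplx R}) 0 w.
Proof. by rewrite /admissible horner0 (hornerC 1 w) cabs1 cabs0 oner_eq0. Qed.

(** Where exactly one of F c and F d vanishes, exactly one of the two products does, so their
    absolute values differ. *)
Lemma obstacle_admissible (F : P1 R -> {poly Cplx R}) :
  (forall c d, c != d -> exists w, (F c).[w] = 0 /\ (F d).[w] != 0 \/
     (F c).[w] != 0 /\ (F d).[w] = 0) ->
  forall x, exists w, admissible (obstacle F x).1 (obstacle F x).2 w.
Proof.
move=> HF [[b c] d]; rewrite /obstacle.
case: ifP => [_|/negbT]; first by exists 0; exact: admissible10.
rewrite !negb_or => /and3P[bc bd cd]; have [w Hw] := HF _ _ cd; exists w.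
rewrite -bracket_eq0 in bc; rewrite -bracket_eq0 in bd.
rewrite /admissible /= !hornerZ !cabsM.
case: Hw => [[-> n0]|[n0 ->]]; rewrite cabs0 mulr0 ?[0 == _]eq_sym mulf_eq0 !cabs_eq0.
  by rewrite (negPf bc).
by rewrite (negPf bd).
Qed.

Lemma obstacle_good (F : P1 R -> {poly Cplx R}) p (w : Cplx R) b c d :
  (forall e, (F e).[w] = br p (hcoord e)) ->
  admissible (obstacle F (b, c, d)).1 (obstacle F (b, c, d)).2 w -> good_pt p b c d.
Proof.
move=> HF; rewrite /obstacle /good_pt; case: (b == c) => //; case: (b == d) => //.
case: (c == d) => //=; rewrite /admissible !hornerZ !HF.
by rewrite [bracket b d * _]mulrC [bracket b c * _]mulrC.
Qed.

Lemma lin_poly_sep c d : c != d -> exists w, (lin_poly c).[w] = 0 /\ (lin_poly d).[w] != 0 \/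
     (lin_poly c).[w] != 0 /\ (lin_poly d).[w] = 0.
Proof.
have sep (w : Cplx R) e : Some w != e ->
    (lin_poly (Some w)).[w] = 0 /\ (lin_poly e).[w] != 0.
  move=> we; have wE e' : br (w, 1) (hcoord e') = bracket (Some w) e' by [].
  by rewrite !horner_lin_poly !wE bracketxx bracket_eq0.
case: c d => [w|] [w'|] //.
- by move=> /sep h; exists w; left.
- by move=> /sep h; exists w; left.
- by rewrite eq_sym => /sep [h h']; exists w'; right.
Qed.

(** A finite point of either fibre separates c from d, and one exists because infinity cannot lie
    above both. *)
Lemma fibre_poly_sep c d : c != d ->
  exists w, (fibre_poly phi c).[w] = 0 /\ (fibre_poly phi d).[w] != 0 \/
     (fibre_poly phi c).[w] != 0 /\ (fibre_poly phi d).[w] = 0.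
Proof.
have sep (w : Cplx R) e e' : e != e' -> Some w \in fibre phi e ->
    (fibre_poly phi e).[w] = 0 /\ (fibre_poly phi e').[w] != 0.
  move=> ee' we; rewrite -!br_philift_finite; split.
    by apply/eqP/negPn/negP => /br_fibre_neq0/(_ _ we);
      rewrite (bracketxx (Some w) : br (w, 1) _ = 0) eqxx.
  apply: contra ee' => /eqP h.
  have [l l0 E] := philift_hcoord d0 (Some w).
  move: h; rewrite [(w, 1)](_ : _ = hcoord (Some w))// E /br /=.
  move/eqP; rewrite -!mulrA -mulrBr mulf_eq0 (negPf l0) /= => h.
  by rewrite -bracket_eq0 -(fibre_map d0 we).
have ex e : exists g, g \in fibre phi e.
  have := size_fibre e d0; case: (fibre phi e) => [e0|g s _]; first by have := d0; rewrite -e0.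
  by exists g; rewrite mem_head.
move=> cd; have [[w|] gc] := ex c; first by exists w; left; apply: sep.
have [[w|] gd] := ex d.
  by have [|h1 h2] := sep w d c _ gd; [rewrite eq_sym|exists w; right].
by move: cd; rewrite -(fibre_map d0 gc) -(fibre_map d0 gd) eqxx.
Qed.

(** Keeping phi(w) away from Q also keeps w away from the fibres in P, by [br_fibre_neq0]. The other
    two conditions make the derivatives above and below phi available. *)
Lemma obstacles : exists L : seq ({poly Cplx R} * {poly Cplx R}),
  (forall NM, NM \in L -> exists w, admissible NM.1 NM.2 w) /\
  (forall w, (forall NM, NM \in L -> admissible NM.1 NM.2 w) ->
    [/\ forall c, c \in Q -> br (philift phi (w, 1)) (hcoord c) != 0,
        forall b c d, b \in P -> c \in P -> d \in P -> good_pt (w, 1) b c d &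
        forall b c d, b \in Q -> c \in Q -> d \in Q ->
          good_pt (philift phi (w, 1)) b c d]).
Proof.
pose trip (S : seq (P1 R)) := [seq (b, e.1, e.2) | b <- S, e <- [seq (c, d) | c <- S, d <- S]].
have in_trip S b c d : b \in S -> c \in S -> d \in S -> (b, c, d) \in trip S.
  move=> bS cS dS; apply/allpairsP; exists (b, (c, d)); split => //=.
  by apply/allpairsP; exists (c, d).
exists ([seq (fibre_poly phi c, 0) | c <- Q] ++ [seq obstacle lin_poly x | x <- trip P] ++
  [seq obstacle (fibre_poly phi) x | x <- trip Q]); split.
  move=> NM; rewrite !mem_cat => /or3P[] /mapP[x _ ->].
  - have [w Hw] : exists w, ~~ root (fibre_poly phi x) w.
      apply: contrapT => H; have n0 := fibre_poly_neq0 x d0.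
      have rn (i : nat) : root (fibre_poly phi x) i%:R.
        by apply/negPn/negP => hi; apply: H; exists i%:R.
      have := @max_poly_roots _ (fibre_poly phi x)
        [seq (i%:R : Cplx R) | i <- iota 0 (size (fibre_poly phi x))] n0.
      rewrite size_map size_iota ltnn => h; apply: notF; apply: h.
        by apply/allP => _ /mapP[i _ ->].
      by rewrite map_inj_uniq ?iota_uniq// => i j /eqP; rewrite eqr_nat => /eqP.
    by exists w; rewrite /admissible /= horner0 cabs0 cabs_eq0.
  - exact: (obstacle_admissible lin_poly_sep).
  - exact: (obstacle_admissible fibre_poly_sep).
move=> w Hw; split.
- move=> c cQ; have := Hw (fibre_poly phi c, 0).
  rewrite mem_cat map_f//= => /(_ isT).
  by rewrite /admissible /= horner0 cabs0 cabs_eq0 -br_philift_finite.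
- move=> b c d bP cP dP; apply: (obstacle_good (horner_lin_poly^~ w)).
  by apply: Hw; rewrite !mem_cat (map_f _ (in_trip _ _ _ _ bP cP dP)) !orbT.
- move=> b c d bQ cQ dQ; apply: (@obstacle_good (fibre_poly phi) _ w).
    by move=> e; rewrite -br_philift_finite.
  by apply: Hw; rewrite !mem_cat (map_f _ (in_trip _ _ _ _ bQ cQ dQ)) !orbT.
Qed.

End Obstacles.
End Motion.

(** * Continuity and homogeneity *)

Section Continuity.
Variable R : realType.
Implicit Types (b c d : P1 R).

Lemma cvg_sum_seq (T I : Type) (F : set_system T) (FF : Filter F) (r : seq I)
    (f : I -> T -> Cplx R) (l : I -> Cplx R) :
  (forall i, f i x @[x --> F] --> l i) ->
  \sum_(i <- r) f i x @[x --> F] --> \sum_(i <- r) l i.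
Proof.
move=> fl; elim: r => [|i r IH].
  by rewrite big_nil; under eq_fun do rewrite big_nil; exact: cvg_cst.
by rewrite big_cons; under eq_fun do rewrite big_cons; exact: (cvgD (fl i) IH).
Qed.

Lemma br_scale (k x y : Cplx R) q : br (k * x, k * y) q = k * br (x, y) q.
Proof. by rewrite /br /= -!mulrA mulrBr. Qed.

Lemma L3_ptZ (k x y : Cplx R) b c d : k != 0 -> L3_pt (k * x, k * y) b c d = L3_pt (x, y) b c d.
Proof. by move=> k0; rewrite /L3_pt !br_scale -!mulrA /L3h disk_ptZ. Qed.

Lemma Dil_ptZ (k x y : Cplx R) b c d : k != 0 -> Dil_pt (k * x, k * y) b c d = Dil_pt (x, y) b c d.
Proof. by move=> k0; rewrite /Dil_pt !br_scale -!mulrA /Dilh disk_ptZ. Qed.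

Section Path.
Variables (x y : R -> Cplx R) (t : R).
Hypothesis xy0 : (x t != 0) || (y t != 0).
Hypotheses (xt : x s @[s --> t] --> x t) (yt : y s @[s --> t] --> y t).

Let cvg_br b (k : Cplx R) :
  br (x s, y s) (hcoord b) * k @[s --> t] --> br (x t, y t) (hcoord b) * k.
Proof.
rewrite /br /=; apply: (@cvgM _ _ _ _ (fun s => x s * (hcoord b).2 - y s * (hcoord b).1) (fun=> k));
  last exact: cvg_cst.
by apply: cvgB; [exact: (cvgM xt (cvg_cst _))|exact: (cvgM yt (cvg_cst _))].
Qed.

Let pt_neq0 b c d : b != c -> b != d -> c != d ->
  (br (x t, y t) (hcoord c) * bracket b d != 0) || (br (x t, y t) (hcoord d) * bracket b c != 0).
Proof.
move=> bc bd cd; rewrite -negb_and !mulf_eq0 !bracket_eq0 (negPf bc) (negPf bd) !orbF.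
apply: contra cd => /andP[/eqP h1 /eqP h2]; apply/eqP; apply: (br_eq0 _ h1 h2).
by apply/orP.
Qed.

(** For distinct b, c, d the cross ratio is never 0 / 0, even when p meets one of them; a repetition
    makes the function constant. *)
Lemma cvg_L3_pt b c d : L3_pt (x s, y s) b c d @[s --> t] --> L3_pt (x t, y t) b c d.
Proof.
have [->|cd] := eqVneq c d.
  by rewrite /L3_pt eqxx; exact: cvg_cst.
have [->|bc] := eqVneq b c.
  by rewrite L3_ptbb//; under eq_fun do rewrite L3_ptbb//; exact: cvg_cst.
have [->|bd] := eqVneq b d.
  have dc : d != c by rewrite eq_sym.
  by rewrite L3_ptbcb//; under eq_fun do rewrite L3_ptbcb//; exact: cvg_cst.
rewrite /L3_pt (negPf cd).
apply: (@cvg_L3h _ R (nbhs t) _ (fun s => br (x s, y s) (hcoord c) * bracket b d)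
  (fun s => br (x s, y s) (hcoord d) * bracket b c));
  [exact: (pt_neq0 bc bd cd)|exact: cvg_br|exact: cvg_br].
Qed.

Lemma cvg_Dil_pt b c d : Dil_pt (x s, y s) b c d @[s --> t] --> Dil_pt (x t, y t) b c d.
Proof.
have [->|cd] := eqVneq c d.
  by rewrite Dil_ptcc; under eq_fun do rewrite Dil_ptcc; exact: cvg_cst.
have [->|bc] := eqVneq b c.
  by rewrite Dil_ptbb//; under eq_fun do rewrite Dil_ptbb//; exact: cvg_cst.
have [->|bd] := eqVneq b d.
  by rewrite Dil_ptbcb//; under eq_fun do rewrite Dil_ptbcb//; exact: cvg_cst.
apply: (@cvg_Dilh _ R (nbhs t) _ (fun s => br (x s, y s) (hcoord c) * bracket b d)
  (fun s => br (x s, y s) (hcoord d) * bracket b c));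
  [exact: (pt_neq0 bc bd cd)|exact: cvg_br|exact: cvg_br].
Qed.

Lemma cvg_hom n (f : {poly Cplx R}) : hom n f (x s, y s) @[s --> t] --> hom n f (x t, y t).
Proof.
apply: cvg_sum_seq => i; apply: (@cvgM _ _ _ _ (fun=> f`_i)); first exact: cvg_cst.
have hx : x s ^+ i @[s --> t] --> x t ^+ i by apply: cvg_cexpr xt.
have hy : y s ^+ (n - i) @[s --> t] --> y t ^+ (n - i) by apply: cvg_cexpr yt.
exact: (cvgM hx hy).
Qed.

End Path.

Variable phi : ratmap R.
Hypothesis d0 : (0 < rdeg phi)%N.

Lemma homZ n (f : {poly Cplx R}) (k x y : Cplx R) :
  hom n f (k * x, k * y) = k ^+ n * hom n f (x, y).
Proof.
rewrite /hom mulr_sumr; apply: eq_bigr => i _ /=.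
rewrite !exprMn mulrACA -exprD subnKC ?mulrA; last by rewrite -ltnS.
by rewrite [f`_i * _]mulrC -!mulrA.
Qed.

Lemma philiftZ (k x y : Cplx R) : philift phi (k * x, k * y) =
  (k ^+ rdeg phi * (philift phi (x, y)).1, k ^+ rdeg phi * (philift phi (x, y)).2).
Proof. by rewrite /philift !homZ. Qed.

Section Differences.
Variables (pt : Cplx R * Cplx R -> P1 R -> P1 R -> P1 R -> R).
Hypothesis ptZ : forall k x y b c d, k != 0 -> pt (k * x, k * y) b c d = pt (x, y) b c d.
Hypothesis cvg_pt : forall (x y : R -> Cplx R) t, (x t != 0) || (y t != 0) ->
  x s @[s --> t] --> x t -> y s @[s --> t] --> y t -> forall b c d,
  pt (x s, y s) b c d @[s --> t] --> pt (x t, y t) b c d.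

Lemma pt_philiftZ k x y b c d : k != 0 ->
  pt (philift phi (k * x, k * y)) b c d = pt (philift phi (x, y)) b c d.
Proof. by move=> k0; rewrite philiftZ ptZ ?expf_neq0. Qed.

Lemma cvg_pt_philift (x y : R -> Cplx R) t b c d : (x t != 0) || (y t != 0) ->
  x s @[s --> t] --> x t -> y s @[s --> t] --> y t ->
  pt (philift phi (x s, y s)) b c d @[s --> t] --> pt (philift phi (x t, y t)) b c d.
Proof.
move=> xy0 xt yt; apply: (cvg_pt (x := fun s => hom _ (rnum phi) (x s, y s))
  (y := fun s => hom _ (rden phi) (x s, y s))).
- by apply/orP/(philift_neq0 d0)/orP.
- exact: cvg_hom.
- exact: cvg_hom.
Qed.

End Differences.
End Continuity.

(** * Projection formulas *)

Section Projection.
Variable R : realType.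
Variable phi : ratmap R.
Hypothesis d0 : (0 < rdeg phi)%N.
Implicit Types (b c d q : P1 R) (t s : R).
Local Notation V := (Cplx R * Cplx R)%type.

Definition alt (e : P1 R * P1 R) (F : P1 R -> R) : R := F e.1 - F e.2.

Lemma alt2B (e e' : P1 R * P1 R) (F G : P1 R -> P1 R -> R) :
  alt e (fun b => alt e' (fun c => F b c - G b c)) =
  alt e (fun b => alt e' (F b)) - alt e (fun b => alt e' (G b)).
Proof. by rewrite /alt; ring. Qed.

Lemma alt2Z (e e' : P1 R * P1 R) (F : P1 R -> P1 R -> R) (k : R) :
  alt e (fun b => alt e' (fun c => F b c * k)) = k * alt e (fun b => alt e' (F b)).
Proof. by rewrite /alt; ring. Qed.

Lemma alt2N (e e' : P1 R * P1 R) (F : P1 R -> P1 R -> R) :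
  alt e (fun b => alt e' (fun c => - F b c)) = - alt e (fun b => alt e' (F b)).
Proof. by rewrite /alt; ring. Qed.

Lemma eq_alt (e : P1 R * P1 R) (F G : P1 R -> R) : (forall b, F b = G b) -> alt e F = alt e G.
Proof. by move=> FG; rewrite /alt !FG. Qed.

Lemma is_derive_alt (e : P1 R * P1 R) (F : P1 R -> R -> R) (l : P1 R -> R) t :
  (forall b, b \in [:: e.1; e.2] -> is_derive t 1 (F b) (l b)) ->
  is_derive t 1 (fun s => alt e (fun b => F b s)) (alt e l).
Proof.
move=> dF; rewrite /alt; apply: is_deriveB; apply: dF; by rewrite !inE eqxx ?orbT.
Qed.

Lemma cvg_alt (e : P1 R * P1 R) (F : P1 R -> R -> R) t :
  (forall b, F b s @[s --> t] --> F b t) ->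
  alt e (fun b => F b s) @[s --> t] --> alt e (fun b => F b t).
Proof. by move=> cF; apply: cvgB. Qed.

Lemma is_derive_sum_seq (I : eqType) (r : seq I) (F : I -> R -> R) (l : I -> R) t :
  (forall i, i \in r -> is_derive t 1 (F i) (l i)) ->
  is_derive t 1 (fun s => \sum_(i <- r) F i s) (\sum_(i <- r) l i).
Proof.
elim: r => [|i r IH] dF.
  by under eq_fun do rewrite big_nil; rewrite big_nil; exact: is_derive_cst.
under eq_fun do rewrite big_cons; rewrite big_cons; apply: is_deriveD.
  by apply: dF; rewrite mem_head.
by apply: IH => j jr; apply: dF; rewrite inE jr orbT.
Qed.

Lemma cvg_rsum_seq (I : Type) (r : seq I) (F : I -> R -> R) t :
  (forall i, F i s @[s --> t] --> F i t) ->
  \sum_(i <- r) F i s @[s --> t] --> \sum_(i <- r) F i t.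
Proof.
move=> cF; elim: r => [|i r IH].
  by rewrite big_nil; under eq_fun do rewrite big_nil; exact: cvg_cst.
by rewrite big_cons; under eq_fun do rewrite big_cons; exact: (cvgD (cF i) IH).
Qed.

Lemma sum_dlog_up f kappa (z : {poly Cplx R}) t c :
  \sum_(g <- fibre phi c) f g = kappa - ln (cabs (mu phi c)) ->
  br (philift phi (path_pt z t)) (hcoord c) != 0 ->
  \sum_(g <- fibre phi c) (ln (cabs (br (path_pt z t) (hcoord g))) + f g) =
  ln (cabs (br (philift phi (path_pt z t)) (hcoord c))) + kappa.
Proof.
move=> sf n0; rewrite big_split /= sf -ln_cabs_prod; last exact: (br_fibre_neq0 d0 n0).
by rewrite prod_fibre// (ln_cabsM (mu_neq0 d0 c) n0); ring.
Qed.

Section Frames.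
Variables (u U : P1 R -> P1 R -> R) (f : P1 R -> R) (kappa : R).
Hypothesis uC : forall b c, u b c = u c b.
Hypothesis uE : forall b c, b != c -> u b c = ln (cabs (bracket b c)) + f b + f c.
Hypothesis UE : forall b c, b != c -> U b c = ln (cabs (bracket b c)) + kappa.
Hypothesis Hf : forall c, \sum_(g <- fibre phi c) f g = kappa - ln (cabs (mu phi c)).
Variables (z : {poly Cplx R}) (t : R).

Lemma UC b c : U b c = U c b.
Proof. by have [->//|bc] := eqVneq b c; rewrite !UE// 1?eq_sym// bracketC cabsN. Qed.

Definition v_up c : R := ln (cabs (br (path_pt z t) (hcoord c))) + f c.
Definition v_down c : R := \sum_(g <- fibre phi c) v_up g.
Local Notation om := (dlog_up z t).
Local Notation Om := (dlog_down phi z t).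

Lemma is_derive_up b c d :
  (forall e, e \in [:: b; c; d] -> br (path_pt z t) (hcoord e) != 0) ->
  good_pt (path_pt z t) b c d ->
  is_derive t 1 (fun s => L3_pt (path_pt z s) b c d)
    (- Dil_pt (path_pt z t) b c d * (Im (om c) - Im (om d)) +
     L3_form (v_up b) (v_up c) (v_up d) (u b c) (u b d) (u c d)
       (Re (om b)) (Re (om c)) (Re (om d)) / 3) /\
  is_derive t 1 (fun s => Dil_pt (path_pt z s) b c d)
    (Dil_form (v_up b) (v_up c) (v_up d) (u b c) (u b d) (u c d)
       (Im (om b)) (Im (om c)) (Im (om d))).
Proof.
move=> n0; apply: (@is_derive_pt R (path_pt z) om t u v_up f 0) => //.
- by move=> e _; rewrite addr0.
- by move=> e /n0; exact: cderiv_up.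
Qed.

Lemma is_derive_down b c d :
  (forall e, e \in [:: b; c; d] -> br (philift phi (path_pt z t)) (hcoord e) != 0) ->
  good_pt (philift phi (path_pt z t)) b c d ->
  is_derive t 1 (fun s => L3_pt (philift phi (path_pt z s)) b c d)
    (- Dil_pt (philift phi (path_pt z t)) b c d * (Im (Om c) - Im (Om d)) +
     L3_form (v_down b) (v_down c) (v_down d) (U b c) (U b d) (U c d)
       (Re (Om b)) (Re (Om c)) (Re (Om d)) / 3) /\
  is_derive t 1 (fun s => Dil_pt (philift phi (path_pt z s)) b c d)
    (Dil_form (v_down b) (v_down c) (v_down d) (U b c) (U b d) (U c d)
       (Im (Om b)) (Im (Om c)) (Im (Om d))).
Proof.
(* The constant kappa of a bracket is shared equally between its two points. *)
move=> n0; apply: (@is_derive_pt R (fun s => philift phi (path_pt z s)) Om t U v_down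
  (fun=> kappa / 2) (kappa / 2)) => //.
- exact: UC.
- by move=> e e' /UE ->; rewrite -addrA -splitr.
- by move=> e /n0 e0; rewrite /v_down (sum_dlog_up (Hf e) e0) -addrA -splitr.
- by move=> e /n0; exact: cderiv_down.
Qed.

End Frames.

Definition Dil_diff (B D : P1 R * P1 R) q (p : V) : R :=
  alt B (fun b => alt D (fun d =>
    \sum_(x <- fibre phi b) \sum_(z <- fibre phi d) Dil_pt p x q z -
    Dil_pt (philift phi p) b (rat_eval phi q) d)).

Definition L3_diff (B C D : P1 R * P1 R) (p : V) : R :=
  alt B (fun b => alt C (fun c => alt D (fun d =>
    ts phi b c d (L3_pt p) - L3_pt (philift phi p) b c d))).

Lemma Dil_diff_ext B D q p p' : (forall b c d, Dil_pt p b c d = Dil_pt p' b c d) ->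
  (forall b c d, Dil_pt (philift phi p) b c d = Dil_pt (philift phi p') b c d) ->
  Dil_diff B D q p = Dil_diff B D q p'.
Proof.
move=> e1 e2; have E1 : Dil_pt p = Dil_pt p' by do !apply/funext => ?; exact: e1.
have E2 : Dil_pt (philift phi p) = Dil_pt (philift phi p').
  by do !apply/funext => ?; exact: e2.
by rewrite /Dil_diff E1 E2.
Qed.

Lemma L3_diff_ext B C D p p' : (forall b c d, L3_pt p b c d = L3_pt p' b c d) ->
  (forall b c d, L3_pt (philift phi p) b c d = L3_pt (philift phi p') b c d) ->
  L3_diff B C D p = L3_diff B C D p'.
Proof.
move=> e1 e2; have E1 : L3_pt p = L3_pt p' by do !apply/funext => ?; exact: e1.
have E2 : L3_pt (philift phi p) = L3_pt (philift phi p').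
  by do !apply/funext => ?; exact: e2.
by rewrite /L3_diff E1 E2.
Qed.

Lemma Dil_diff_derive B D q : exists L : seq ({poly Cplx R} * {poly Cplx R}),
  (forall NM, NM \in L -> exists w, admissible NM.1 NM.2 w) /\
  forall z t, (forall NM, NM \in L -> admissible NM.1 NM.2 z.[t%:C]) ->
    is_derive t 1 (fun s => Dil_diff B D q (path_pt z s)) 0.
Proof.
have [u [U [f [kappa [uC uE UE Hu Hf]]]]] := potential d0.
(* The last entry places q itself among the fibre points covered by [gP]. *)
pose Q := [:: B.1; B.2; D.1; D.2; rat_eval phi q].
have [L [LQ HL]] := obstacles d0 Q; exists L; split=> // z t /HL[n0 gP gQ].
have inP b x : b \in Q -> x \in fibre phi b -> x \in flatten [seq fibre phi c | c <- Q].
  by move=> bQ xb; apply/flatten_mapP; exists b.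
have BQ b : b \in [:: B.1; B.2] -> b \in Q.
  by rewrite !inE => /orP[] ->; rewrite ?orbT.
have DQ b : b \in [:: D.1; D.2] -> b \in Q.
  by rewrite !inE => /orP[] ->; rewrite ?orbT.
have qQ : rat_eval phi q \in Q by rewrite !inE eqxx !orbT.
have qf : q \in fibre phi (rat_eval phi q) by rewrite mem_fibre.
have [k1 [k2 Hk]] := sum_Dil_form d0 uC (UC UE) Hu
  (v := v_up f z t) (o := fun c => Im (dlog_up z t c))
  (fun c => erefl) (fun c => esym (Im_sum _ _ _)) q (rat_eval phi q).
have up0 b x : b \in Q -> x \in fibre phi b -> br (path_pt z t) (hcoord x) != 0.
  by move=> bQ xb; apply: (br_fibre_neq0 d0 (n0 b bQ)).
apply: is_derive_eq.
  apply: is_derive_alt => b bB; apply: is_derive_alt => d dD; apply: is_deriveB.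
    apply: is_derive_sum_seq => x xb; apply: is_derive_sum_seq => y yd.
    have := @is_derive_up u f uC uE z t x q y.
    case=> [e||_ h]; [| |exact: h].
      rewrite !inE => /or3P[] /eqP ->; [exact: up0 (BQ b bB) xb|exact: up0 qQ qf|].
      exact: up0 (DQ d dD) yd.
    by apply: gP; [exact: inP (BQ b bB) xb|exact: inP qQ qf|exact: inP (DQ d dD) yd].
  have := @is_derive_down U f kappa UE Hf z t b (rat_eval phi q) d.
  case=> [e||_ h]; [| |exact: h].
    by rewrite !inE => /or3P[] /eqP ->; apply: n0; [exact: BQ|exact: qQ|exact: DQ].
  by apply: gQ; [exact: BQ|exact: qQ|exact: DQ].
(* Only k1 b + k2 d is left, and the alternations over B and D cancel it. *)
under [X in alt B X]eq_fun do under eq_fun do rewrite Hk addrAC subrr add0r.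
by rewrite /alt; ring.
Qed.

(** The difference of the two sides is constant in a, and at a = q both sides vanish because [q, q]
    and [phi(q), phi(q)] do. *)
Lemma Dil_projection B D q a :
  alt B (fun b => alt D (fun d =>
    \sum_(x <- fibre phi b) \sum_(z <- fibre phi d) Dil_pt (hcoord a) x q z)) =
  alt B (fun b => alt D (fun d => Dil_pt (philift phi (hcoord a)) b (rat_eval phi q) d)).
Proof.
have [L [LQ HL]] := Dil_diff_derive B D q.
have DZ k x y : k != 0 -> Dil_diff B D q (k * x, k * y) = Dil_diff B D q (x, y).
  move=> k0; apply: Dil_diff_ext => b c d; first exact: Dil_ptZ.
  exact: (@pt_philiftZ R phi _ (@Dil_ptZ R)).
have Dc (x y : R -> Cplx R) t : (x t != 0) || (y t != 0) ->
    x s @[s --> t] --> x t -> y s @[s --> t] --> y t ->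
    Dil_diff B D q (x s, y s) @[s --> t] --> Dil_diff B D q (x t, y t).
  move=> xy0 xt yt; rewrite /Dil_diff.
  apply: (@cvg_alt B (fun b s => alt D (fun d =>
    \sum_(x' <- fibre phi b) \sum_(z <- fibre phi d) Dil_pt (x s, y s) x' q z -
    Dil_pt (philift phi (x s, y s)) b (rat_eval phi q) d))) => b.
  apply: (@cvg_alt D (fun d s =>
    \sum_(x' <- fibre phi b) \sum_(z <- fibre phi d) Dil_pt (x s, y s) x' q z -
    Dil_pt (philift phi (x s, y s)) b (rat_eval phi q) d)) => d.
  have h c' : Dil_pt (philift phi (x s, y s)) b c' d @[s --> t] -->
      Dil_pt (philift phi (x t, y t)) b c' d.
    exact: (@cvg_pt_philift R phi d0 (@Dil_pt R) (@cvg_Dil_pt R) x y t b c' d xy0 xt yt).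
  apply: cvgB; last exact: h.
  apply: (@cvg_rsum_seq _ _ (fun x' s =>
    \sum_(z <- fibre phi d) Dil_pt (x s, y s) x' q z)) => x'.
  apply: (@cvg_rsum_seq _ _ (fun z s => Dil_pt (x s, y s) x' q z)) => z.
  exact: cvg_Dil_pt.
have := Phi_constant DZ Dc LQ HL a q.
have -> : Dil_diff B D q (hcoord q) = 0.
  have z1 b d : Dil_pt (hcoord q) b q d = 0.
    by rewrite /Dil_pt br_hcoord bracketxx mul0r Dilh0l.
  have z2 b d : Dil_pt (philift phi (hcoord q)) b (rat_eval phi q) d = 0.
    have [l l0 ->] := philift_hcoord d0 q; rewrite /Dil_pt br_scale.
    rewrite (_ : br (_, _) _ = 0) ?mulr0 ?mul0r ?Dilh0l//.
    by rewrite /br /= mulrC subrr.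
  have z3 b d : \sum_(x <- fibre phi b) \sum_(z <- fibre phi d) Dil_pt (hcoord q) x q z = 0.
    by rewrite big1 // => x _; rewrite big1.
  by rewrite /Dil_diff /alt !z2 !z3 !subrr.
by move/eqP; rewrite /Dil_diff alt2B subr_eq0 => /eqP.
Qed.

Section Weighted.
Variables (a : P1 R) (w W : P1 R -> R).
Hypothesis HW : forall c, \sum_(g <- fibre phi c) w g = W c.

(** For each y above c, [Dil_projection] with q = y gives a value depending on c only, so the
    weights w y can be summed separately. *)
Lemma Dil_weighted (B D : P1 R * P1 R) c :
  alt B (fun b => alt D (fun d =>
    ts phi b c d (fun x y z => Dil_pt (hcoord a) x y z * w y))) =
  alt B (fun b => alt D (fun d => Dil_pt (philift phi (hcoord a)) b c d * W c)).
Proof.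
pose S y b d := \sum_(x <- fibre phi b) \sum_(z <- fibre phi d) Dil_pt (hcoord a) x y z.
have tsE b d : ts phi b c d (fun x y z => Dil_pt (hcoord a) x y z * w y) =
    \sum_(y <- fibre phi c) w y * S y b d.
  rewrite ts12; apply: eq_bigr => y _; rewrite /S mulr_sumr; apply: eq_bigr => x _.
  by rewrite mulr_sumr; apply: eq_bigr => z _; rewrite mulrC.
transitivity (\sum_(y <- fibre phi c) w y * alt B (fun b => alt D (fun d => S y b d))).
  rewrite /alt !tsE -!sumrB; apply: eq_bigr => y _; by rewrite !mulrBr.
transitivity (\sum_(y <- fibre phi c) w y *
    alt B (fun b => alt D (fun d => Dil_pt (philift phi (hcoord a)) b c d))).
  by apply: eq_big_seq => y yc; rewrite /S Dil_projection (fibre_map d0 yc).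
rewrite -mulr_suml HW.
by rewrite (alt2Z B D (fun b d => Dil_pt (philift phi (hcoord a)) b c d)).
Qed.

Lemma Dil_weighted' (B C : P1 R * P1 R) d :
  alt B (fun b => alt C (fun c =>
    ts phi b c d (fun x y z => Dil_pt (hcoord a) x y z * w z))) =
  alt B (fun b => alt C (fun c => Dil_pt (philift phi (hcoord a)) b c d * W d)).
Proof.
have e b c : ts phi b c d (fun x y z => Dil_pt (hcoord a) x y z * w z) =
    - ts phi b d c (fun x y z => Dil_pt (hcoord a) x y z * w y).
  rewrite ts23 -mulN1r -tsZ; apply: eq_bigr => x _; apply: eq_bigr => z _.
  by apply: eq_bigr => y _; rewrite Dil_ptC mulN1r mulNr.
have e' b c : Dil_pt (philift phi (hcoord a)) b c d * W d =
    - (Dil_pt (philift phi (hcoord a)) b d c * W d) by rewrite Dil_ptC mulNr.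
rewrite (eq_alt B (fun b => eq_alt C (e b))) (eq_alt B (fun b => eq_alt C (e' b))).
rewrite (alt2N B C (fun b c => ts phi b d c (fun x y z => Dil_pt (hcoord a) x y z * w y))).
rewrite (alt2N B C (fun b c => Dil_pt (philift phi (hcoord a)) b d c * W d)).
by rewrite Dil_weighted.
Qed.

End Weighted.

(** Each k misses one of b, c, d and dies under that alternation. The pair tA, A is compared at
    fixed c, the pair tB, A' at fixed d. *)
Lemma alt3_zero (B C D : P1 R * P1 R) (tA A tB A' : P1 R -> P1 R -> P1 R -> R)
    (k1 k2 k3 : P1 R -> P1 R -> R) :
  (forall c, alt B (fun b => alt D (fun d => tA b c d)) =
     alt B (fun b => alt D (fun d => A b c d))) ->
  (forall d, alt B (fun b => alt C (fun c => tB b c d)) =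
     alt B (fun b => alt C (fun c => A' b c d))) ->
  alt B (fun b => alt C (fun c => alt D (fun d => - tA b c d + tB b c d + A b c d - A' b c d +
    (k1 c d + k2 b d + k3 b c) / 3))) = 0.
Proof.
rewrite /alt => hA hB; have := hA C.1; have := hA C.2; have := hB D.1; have := hB D.2; lra.
Qed.

Lemma L3_diff_derive B C D : exists L : seq ({poly Cplx R} * {poly Cplx R}),
  (forall NM, NM \in L -> exists w, admissible NM.1 NM.2 w) /\
  forall z t, (forall NM, NM \in L -> admissible NM.1 NM.2 z.[t%:C]) ->
    is_derive t 1 (fun s => L3_diff B C D (path_pt z s)) 0.
Proof.
have [u [U [f [kappa [uC uE UE Hu Hf]]]]] := potential d0.
pose Q := [:: B.1; B.2; C.1; C.2; D.1; D.2].
have [L [LQ HL]] := obstacles d0 Q; exists L; split=> // z t /HL[n0 gP gQ].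
have inP b x : b \in Q -> x \in fibre phi b -> x \in flatten [seq fibre phi c | c <- Q].
  by move=> bQ xb; apply/flatten_mapP; exists b.
have BQ b : b \in [:: B.1; B.2] -> b \in Q.
  by rewrite !inE => /orP[] ->; rewrite ?orbT.
have CQ b : b \in [:: C.1; C.2] -> b \in Q.
  by rewrite !inE => /orP[] ->; rewrite ?orbT.
have DQ b : b \in [:: D.1; D.2] -> b \in Q.
  by rewrite !inE => /orP[] ->; rewrite ?orbT.
have [k1 [k2 [k3 Hk]]] := sum_L3_form d0 uC (UC UE) Hu (v := v_up f z t)
  (o := fun c => Re (dlog_up z t c)) (fun c => erefl) (fun c => esym (Re_sum _ _ _)).
have up0 b x : b \in Q -> x \in fibre phi b -> br (path_pt z t) (hcoord x) != 0.
  by move=> bQ xb; apply: (br_fibre_neq0 d0 (n0 b bQ)).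
apply: is_derive_eq.
  apply: is_derive_alt => b bB; apply: is_derive_alt => c cC; apply: is_derive_alt => d dD.
  apply: is_deriveB.
    apply: is_derive_sum_seq => x xb; apply: is_derive_sum_seq => y yc.
    apply: is_derive_sum_seq => w wd.
    have := @is_derive_up u f uC uE z t x y w.
    case=> [e||h _]; [| |exact: h].
      rewrite !inE => /or3P[] /eqP ->; [exact: up0 (BQ b bB) xb|exact: up0 (CQ c cC) yc|].
      exact: up0 (DQ d dD) wd.
    by apply: gP; [exact: inP (BQ b bB) xb|exact: inP (CQ c cC) yc|exact: inP (DQ d dD) wd].
  have := @is_derive_down U f kappa UE Hf z t b c d.
  case=> [e||h _]; [| |exact: h].
    by rewrite !inE => /or3P[] /eqP ->; apply: n0; [exact: BQ|exact: CQ|exact: DQ].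
  by apply: gQ; [exact: BQ|exact: CQ|exact: DQ].
pose p := path_pt z t; pose oy c := Im (dlog_up z t c); pose Oy c := Im (dlog_down phi z t c).
have oyE c : \sum_(g <- fibre phi c) oy g = Oy c by rewrite -Im_sum.
(* The factor Im (om y) - Im (om w) of [Dil_pt] splits into a weight at y and a weight at w, for
   [Dil_weighted] and [Dil_weighted']. *)
pose tA b c d := ts phi b c d (fun x y w => Dil_pt p x y w * oy y).
pose tB b c d := ts phi b c d (fun x y w => Dil_pt p x y w * oy w).
rewrite -[RHS](@alt3_zero B C D tA (fun b c d => Dil_pt (philift phi p) b c d * Oy c)
  tB (fun b c d => Dil_pt (philift phi p) b c d * Oy d) k1 k2 k3).
- apply: eq_alt => b; apply: eq_alt => c; apply: eq_alt => d.
  transitivity (ts phi b c d (fun x y w => (-1) * (Dil_pt p x y w * oy y) +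
    (Dil_pt p x y w * oy w + 3^-1 * (L3_form (v_up f z t x) (v_up f z t y)
                         (v_up f z t w) (u x y) (u x w)
                         (u y w) (Re (dlog_up z t x))
                         (Re (dlog_up z t y)) (Re (dlog_up z t w))))) -
     (- Dil_pt (philift phi p) b c d * (Oy c - Oy d) +
            L3_form (v_down f z t b) (v_down f z t c)
              (v_down f z t d) (U b c) (U b d) (U c d)
              (Re (dlog_down phi z t b)) (Re (dlog_down phi z t c))
              (Re (dlog_down phi z t d)) / 3)).
    congr (_ - _); apply: eq_bigr => x _; apply: eq_bigr => y _; apply: eq_bigr => w _.
    rewrite -/p -/(oy y) -/(oy w); ring.
  rewrite !tsD !tsZ Hk -/(tA b c d) -/(tB b c d) /v_down /dlog_down; ring.
- by move=> c; exact: (@Dil_weighted (Some z.[t%:C]) oy Oy oyE B D c).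
- by move=> d; exact: (@Dil_weighted' (Some z.[t%:C]) oy Oy oyE B C d).
Qed.

Lemma L3_projection B C D a a' : L3_diff B C D (hcoord a) = L3_diff B C D (hcoord a').
Proof.
have [L [LQ HL]] := L3_diff_derive B C D.
have DZ k x y : k != 0 -> L3_diff B C D (k * x, k * y) = L3_diff B C D (x, y).
  move=> k0; apply: L3_diff_ext => b c d; first exact: L3_ptZ.
  exact: (@pt_philiftZ R phi _ (@L3_ptZ R)).
have Dc (x y : R -> Cplx R) t : (x t != 0) || (y t != 0) ->
    x s @[s --> t] --> x t -> y s @[s --> t] --> y t ->
    L3_diff B C D (x s, y s) @[s --> t] --> L3_diff B C D (x t, y t).
  move=> xy0 xt yt; rewrite /L3_diff.
  apply: (@cvg_alt B (fun b s => alt C (fun c => alt D (fun d =>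
    ts phi b c d (L3_pt (x s, y s)) - L3_pt (philift phi (x s, y s)) b c d)))) => b.
  apply: (@cvg_alt C (fun c s => alt D (fun d =>
    ts phi b c d (L3_pt (x s, y s)) - L3_pt (philift phi (x s, y s)) b c d))) => c.
  apply: (@cvg_alt D (fun d s =>
    ts phi b c d (L3_pt (x s, y s)) - L3_pt (philift phi (x s, y s)) b c d)) => d.
  have h : L3_pt (philift phi (x s, y s)) b c d @[s --> t] -->
      L3_pt (philift phi (x t, y t)) b c d.
    exact: (@cvg_pt_philift R phi d0 (@L3_pt R) (@cvg_L3_pt R) x y t b c d xy0 xt yt).
  apply: cvgB; last exact: h.
  apply: (@cvg_rsum_seq _ _ (fun x' s =>
    \sum_(y' <- fibre phi c) \sum_(z <- fibre phi d) L3_pt (x s, y s) x' y' z)) => x'.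
  apply: (@cvg_rsum_seq _ _ (fun y' s =>
    \sum_(z <- fibre phi d) L3_pt (x s, y s) x' y' z)) => y'.
  apply: (@cvg_rsum_seq _ _ (fun z s => L3_pt (x s, y s) x' y' z)) => z.
  exact: cvg_L3_pt.
exact: (Phi_constant DZ Dc LQ HL).
Qed.

(** For c = d numerator and denominator agree and are nonzero by assumption, so the cross ratio is
    1, as [L3_pt] prescribes. *)
Lemma L3crE a b c d : cr_defined a b c d -> L3cr a b c d = L3_pt (hcoord a) b c d.
Proof.
rewrite /cr_defined /L3cr /cr /L3_pt /cr_num /cr_den => def.
have [e|cd] := eqVneq c d.
  move: def; rewrite e; set n := bracket a d * _; rewrite orbb => n0.
  by rewrite (negPf n0) divff// L3_Some /L3h disk_pt_div ?divff ?oner_eq0.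
rewrite !br_hcoord; move: def.
set n := bracket a c * _; set m := bracket a d * _ => def.
have [m0|m0] := eqVneq m 0; first by rewrite L3_None m0 L3h0r.
rewrite L3_Some /L3h; congr Lp3.
have := disk_ptZ (n / m) 1 m0.
by rewrite mulr1 mulrC divfK// => <-.
Qed.

Lemma sum_fibre_L3_pt b c d a : \sum_(x <- fibre phi a) L3_pt (philift phi (hcoord x)) b c d =
  (rdeg phi)%:R * L3_pt (hcoord a) b c d.
Proof.
rewrite -(sum_fibre_cst d0 a); apply: eq_big_seq => x /(fibre_map d0) xa.
have [l l0 ->] := philift_hcoord d0 x; rewrite xa.
by rewrite (L3_ptZ (hcoord a).1 (hcoord a).2 b c d l0) -surjective_pairing.
Qed.

End Projection.

Lemma alt_sum (R : realType) (I : Type) (r : seq I) (e : P1 R * P1 R) (F : I -> P1 R -> R) :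
  alt e (fun b => \sum_(i <- r) F i b) = \sum_(i <- r) alt e (F i).
Proof. by rewrite /alt sumrB. Qed.

(** In degree 0 a nonempty fibre forces [fibre_poly] to be 0. If this happened at a and b with
    [a, b] <> 0, both polynomials of phi would be 0, against coprimality. *)
Lemma fibre_rdeg0 (R : realType) (phi : ratmap R) (a b x y : P1 R) :
  rdeg phi = 0%N -> x \in fibre phi a -> y \in fibre phi b -> a = b.
Proof.
move=> d0; have fp0 c z : z \in fibre phi c -> fibre_poly phi c = 0.
  apply: contraTeq => n0; have := size_fibre_poly phi c; rewrite d0 /fibre /Defs.roots d0.
  case: (closed_field_poly_normal (fibre_poly phi c)) => r /= e sz.
  have s1 : size (fibre_poly phi c) = 1%N.
    by apply/eqP; rewrite eqn_leq sz lt0n size_poly_eq0.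
  move: s1; rewrite [in X in X -> _]e size_scale ?lead_coef_eq0// size_prod_XsubC.
  case=> /size0nil ->.
  move: sz; rewrite leq_eqVlt ltnS leqn0 size_poly_eq0 (negPf n0) orbF => /eqP ->.
  by rewrite subnn.
move=> /fp0/eqP; rewrite subr_eq0 => /eqP ea /fp0/eqP; rewrite subr_eq0 => /eqP eb.
apply/eqP; rewrite -bracket_eq0; apply/negPn/negP => n0.
have P0 : bracket a b *: rnum phi = 0.
  rewrite /bracket scalerBl [(hcoord a).2 * _]mulrC -!scalerA eb ea !scalerA.
  by rewrite [(hcoord a).1 * _]mulrC subrr.
have Q0 : bracket a b *: rden phi = 0.
  rewrite /bracket scalerBl [(hcoord a).1 * _]mulrC -!scalerA -ea -eb !scalerA.
  by rewrite [(hcoord b).2 * _]mulrC subrr.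
have := ratmap_coprime phi; move/eqP: P0; rewrite scaler_eq0 (negPf n0) => /eqP ->.
move/eqP: Q0; rewrite scaler_eq0 (negPf n0) => /eqP ->.
by rewrite coprimep0 eqp01.
Qed.

Lemma big_ord2_alt (R : realType) (A : 'I_2 -> P1 R) (n : nat) (F : P1 R -> R) :
  \sum_(i < 2) (-1) ^+ (n + i) * F (A i) = (-1) ^+ n * alt (A ord0, A ord_max) F.
Proof.
rewrite big_ord_recl big_ord1 /alt /= addn0 addn1 exprS mulN1r mulNr -mulrBr.
by rewrite (_ : lift ord0 ord0 = ord_max)//; apply/val_inj.
Qed.

(* The indices 1, 2 are the elements of 'I_2; shifting all four of them by one
   does not change the sign. *)
Theorem theorem3p1 (R : realType) (phi : ratmap R) (A B C D : 'I_2 -> P1 R)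
  (hdef : forall i j k l : 'I_2, cr_defined (A i) (B j) (C k) (D l)) :
  \sum_(i < 2) \sum_(j < 2) \sum_(k < 2) \sum_(l < 2)
    (-1) ^+ (i + j + k + l) *
    (\sum_(a <- fibre phi (A i)) \sum_(b <- fibre phi (B j))
       \sum_(c <- fibre phi (C k)) \sum_(d <- fibre phi (D l)) L3cr a b c d
     - (rdeg phi)%:R * L3cr (A i) (B j) (C k) (D l)) = 0.
Proof.
have [d0|] := posnP (rdeg phi).
  (* For a constant map, a nonempty product of fibres would force A i = B j = C k, where the cross
     ratio is undefined. *)
  rewrite big1// => i _; rewrite big1// => j _; rewrite big1// => k _; rewrite big1// => l _.
  rewrite d0 mul0r subr0 big1_seq ?mulr0//= => a aA.
  rewrite big1_seq//= => b bB; rewrite big1_seq//= => c cC.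
  rewrite big1_seq//= => d dD; exfalso; move: (hdef i j k l); rewrite cr_definedE.
  have AB := fibre_rdeg0 d0 aA bB; have BC := fibre_rdeg0 d0 bB cC.
  by rewrite AB BC !eqxx.
move=> d0.
pose S a' b c d : R := \sum_(a <- fibre phi a') (ts phi b c d (L3_pt (hcoord a)) -
  L3_pt (philift phi (hcoord a)) b c d).
have SE i j k l : \sum_(a <- fibre phi (A i)) \sum_(b <- fibre phi (B j))
       \sum_(c <- fibre phi (C k)) \sum_(d <- fibre phi (D l)) L3cr a b c d
     - (rdeg phi)%:R * L3cr (A i) (B j) (C k) (D l) = S (A i) (B j) (C k) (D l).
  rewrite /S sumrB sum_fibre_L3_pt// L3crE//; congr (_ - _).
  apply: eq_big_seq => a /(fibre_map d0) aA; apply: eq_big_seq => b /(fibre_map d0) bB.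
  apply: eq_big_seq => c /(fibre_map d0) cC; apply: eq_big_seq => d /(fibre_map d0) dD.
  (* Points that coincide above have images that coincide below, so definedness passes to the
     preimages. *)
  apply: L3crE; have := hdef i j k l; rewrite !cr_definedE; apply: contra.
  rewrite -aA -bB -cC -dD.
  by case/or4P => /andP[/eqP -> /eqP ->]; rewrite !eqxx ?orbT.
pose B' := (B ord0, B ord_max); pose C' := (C ord0, C ord_max); pose D' := (D ord0, D ord_max).
pose E a' := alt B' (fun b => alt C' (fun c => alt D' (S a' b c))).
transitivity (\sum_(i < 2) (-1) ^+ (0 + i) * E (A i)).
  apply: eq_bigr => i _; rewrite /E -big_ord2_alt; apply: eq_bigr => j _.
  rewrite -big_ord2_alt; apply: eq_bigr => k _.
  by rewrite -big_ord2_alt; apply: eq_bigr => l _; rewrite SE.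
(* By [L3_projection] every point of the fibre contributes the value at one base point, here
   infinity; thus E a' does not depend on a'. *)
have EE a' : E a' = (rdeg phi)%:R * L3_diff phi B' C' D' (hcoord None).
  rewrite -(sum_fibre_cst d0 a').
  transitivity (\sum_(a <- fibre phi a') L3_diff phi B' C' D' (hcoord a)); last first.
    by apply: eq_bigr => a _; apply: L3_projection.
  rewrite /L3_diff -alt_sum; apply: eq_alt => b; rewrite -alt_sum; apply: eq_alt => c.
  by rewrite -alt_sum.
by rewrite big_ord2_alt /alt !EE subrr mulr0.
Qed.
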